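(* Let $d\ge2$ be an integer, $0<r_0<r<1$, and let $f\in\mathcal F_r$ satisfy $$f_r(\eta)=\sum_{l=0}^\infty\sum_{k=1}^{Z(d,l)}\hat f_r(l,k)\,Y_{l,k}(\eta),\qquad \eta\in S^d .$$ Let $t_{1,n},\dots,t_{n,n}$ be $n\ge1$ distinct points on $S^d$, let $a_{1,n},\dots,a_{n,n}$ be real weights, and let $\nu_n=\sum_{k=1}^n a_{k,n}\delta_{t_{k,n}}$, where $\delta_t$ denotes the Dirac mass at $t$. Let $\mu$ be a finite Borel measure on $\mathbb R^{d+1}$ with support in $S^d$, and let $1\le p,p'\le\infty$ with $\frac1p+\frac1{p'}=1$. Then $$\left|\int_{S^d}f\,d\mu-\sum_{k=1}^n a_{k,n}f(t_{k,n})\right|\le\frac1{r_0}\,\|D(f)\|_{L_p(rS^d)}\,\|U^{\mu-\nu_n}\|_{L_{p'}(rS^d)} .$$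
   Context: $S^d=\{x\in\mathbb R^{d+1}:\|x\|=1\}$, with $\|\cdot\|$ the Euclidean norm; $rS^d$ is the sphere of radius $r$ centred at $0$. $\mu_d$ denotes the ($d$-dimensional, unnormalized) surface measure on $S^d$, respectively on $rS^d$, and $\omega_d=2\pi^{(d+1)/2}/\Gamma((d+1)/2)=\mu_d(S^d)$. For $1\le p<\infty$, $\|g\|_{L_p(rS^d)}=\left(\int_{rS^d}|g|^p\,d\mu_d\right)^{1/p}$, and $\|g\|_{L_\infty(rS^d)}$ is the essential supremum of $|g|$ over $rS^d$. A spherical harmonic of degree $l$ is the restriction to $S^d$ of a homogeneous harmonic polynomial of degree $l$ on $\mathbb R^{d+1}$; the space of these has dimension $Z(d,l)=\frac{2l+d-1}{l+d-1}\binom{l+d-1}{l}$ for $l\ge1$ and $Z(d,0)=1$. $\{Y_{l,k}: l\ge0,\ 1\le k\le Z(d,l)\}$ is a fixed real orthonormal basis of $L^2(S^d)$ (with respect to $\mu_d$), with $Y_{l,k}$ a spherical harmonic of degree $l$. For $f:\mathbb R^{d+1}\to\mathbb R$, $f_r:S^d\to\mathbb R$ is $f_r(x)=f(rx)$, and $\hat f_r(l,k)=\int_{S^d}f_r Y_{l,k}\,d\mu_d$. The operator $D$ is defined (formally) by the series $$D(f_r)=\sum_{l=0}^\infty\sum_{k=1}^{Z(d,l)}\frac{2l+d-1}{(d-1)\omega_d}\,\hat f_r(l,k)\,Y_{l,k}$$ on $S^d$, and $D(f)$ denotes the function on $rS^d$ given by $D(f)(r\eta)=D(f_r)(\eta)$,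 $\eta\in S^d$. Let $G=(\mathbb R^{d+1}\setminus\{x:\|x\|\le r\})\cup\{\infty\}$, so $\partial G=rS^d$. $\mathcal F_r$ is the class of functions $f:\mathbb R^{d+1}\to\mathbb R$ that are harmonic on $G$, continuous on $\overline G$, vanish at infinity, and satisfy $\|D(f)\|_{L_\infty(rS^d)}<\infty$ (i.e. the series defining $D(f)$ represents an essentially bounded function on $rS^d$). For a finite signed measure $\sigma$ supported on $S^d$, the Newtonian potential is $U^\sigma(x)=\int_{S^d}\|x-y\|^{-(d-1)}\,d\sigma(y)$. *)

(* Defs.v *)
From HB Require Import structures.
From mathcomp Require Import all_boot all_order all_algebra.
From mathcomp Require mpoly.
(* The notations of mpoly clash with those of MathComp-Analysis. *)
Import -(notations) mpoly.
From mathcomp Require Import all_classical all_reals all_analysis.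
From mathcomp Require Import measurable_realfun.

Set Implicit Arguments.
Unset Strict Implicit.
Unset Printing Implicit Defensive.

Import Order.TTheory GRing.Theory Num.Theory.
Import numFieldNormedType.Exports.

Local Open Scope classical_set_scope.
Local Open Scope ring_scope.

(* R^n is the type 'rV[R]_n, whose library topology (that of the sup norm) is
   the usual one.  It is given its Borel sigma-algebra. *)
HB.instance Definition _ (R : realType) (n : nat) :=
  @isMeasurable.Build default_measure_display 'rV[R]_n
    (<<s [set U : set 'rV[R]_n | open U] >>)
    (@sigma_algebra0 _ _ _) (@sigma_algebraC _ _) (@sigma_algebra_bigcup _ _ _).

Section borel_rV.
Context {R : realType} {n : nat}.

Lemma open_measurable_rV (U : set 'rV[R]_n) : open U -> measurable U.
Proof. by move=> oU; apply: sub_sigma_algebra. Qed.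

Lemma continuous_measurable_rV (f : 'rV[R]_n -> R) :
  continuous f -> measurable_fun setT f.
Proof.
move=> /continuousP cf; apply: (measurability _ (RGenOpens.measurableE R)).
move=> _ [_ [a [b ->] <-]]; rewrite setTI; apply: open_measurable_rV.
exact/cf/interval_open.
Qed.

Lemma measurable_fun_rV d (T : measurableType d) (f : T -> 'rV[R]_n) :
  (forall i, measurable_fun setT (fun x => f x ord0 i)) -> measurable_fun setT f.
Proof.
move=> mf.
apply: (@measurability _ _ _ _ _ _ [set U : set 'rV[R]_n | open U]) => //.
move=> _ [U oU <-]; rewrite setTI.
pose B (qk : 'rV[rat]_n * nat) : set 'rV[R]_n :=
  [set y | forall i, ball (ratr (qk.1 ord0 i) : R) (qk.2.+1%:R^-1) (y ord0 i)].
pose F k : set 'rV[R]_n := if unpickle k is Some qk then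
  (if `[< B qk `<=` U >] then B qk else set0) else set0.
have mB qk : measurable (f @^-1` B qk).
  have -> : f @^-1` B qk = \bigcap_(i in [set: 'I_n])
     ((fun x => f x ord0 i) @^-1` (ball (ratr (qk.1 ord0 i) : R) (qk.2.+1%:R^-1))).
    by apply/seteqP; split => [x Bx i _|x Bx i]; [exact: Bx|exact: (Bx i Logic.I)].
  apply: fin_bigcap_measurable => // i _; rewrite -[X in measurable X]setTI.
  by apply: mf => //; exact: measurable_ball.
have -> : U = \bigcup_k F k.
  apply/seteqP; split => [x Ux|x [k _]]; last first.
    rewrite /F; case: unpickle => // qk; case: asboolP => // BU; exact: BU.
  have /nbhs_ballP[e /= e0 xeU] := oU x Ux.
  have [k ke] : exists k : nat, k.+1%:R^-1 < e / 2.
    have e20 : 0 < e / 2 by rewrite divr_gt0.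
    by near \oo => k; exists k; near: k; exact: near_infty_natSinv_lt (PosNum e20).
  have k0 : 0 < k.+1%:R^-1 :> R by rewrite invr_gt0.
  have qP i : exists q : rat, ball (x ord0 i) (k.+1%:R^-1) (ratr q : R).
    have [|q] := @rat_in_itvoo R (x ord0 i - k.+1%:R^-1) (x ord0 i + k.+1%:R^-1).
      by rewrite ltrBlDr -addrA ltrDl addr_gt0.
    rewrite in_itv/= => /andP[q1 q2]; exists q.
    by rewrite /ball/= ltr_distlC q1 q2.
  pose q : 'rV[rat]_n := \row_i sval (cid (qP i)).
  have xB : B (q, k) x.
    by move=> i /=; apply: ball_sym; rewrite mxE; case: cid.
  exists (pickle (q, k)) => //; rewrite /F pickleK.
  case: asboolP => //; case => y yB; apply: xeU; split => // a i.
  rewrite (ord1 a) [e]splitr.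
  apply: (@ball_triangle _ _ (ratr (q ord0 i) : R)).
    by apply: ball_sym; apply: (le_ball (ltW ke)); exact: xB.
  by apply: (le_ball (ltW ke)); exact: yB.
rewrite preimage_bigcup; apply: bigcupT_measurable => k; rewrite /F.
case: unpickle => [qk|]; last by rewrite preimage_set0.
by case: ifP => _; [exact: mB|rewrite preimage_set0].
Unshelve. all: by end_near. Qed.

End borel_rV.

Section lebesgue_rV.
Context {R : realType}.

Definition cons_rV n (p : measurableTypeR R * 'rV[R]_n) : 'rV[R]_n.+1 :=
  \row_i oapp (p.2 ord0) (p.1 : R) (unlift ord0 i).

Lemma measurable_cons_rV n : measurable_fun setT (@cons_rV n).
Proof.
apply: measurable_fun_rV => i; rewrite /cons_rV; under eq_fun do rewrite mxE.
case: (unlift ord0 i) => [j|] /=; last exact: measurable_fst.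
apply: (measurableT_comp (f := fun v : 'rV[R]_n => v ord0 j)) => //.
by apply: continuous_measurable_rV; exact: coord_continuous.
Qed.

Section lebesgue_succ.
Variables (n : nat) (m : {sigma_finite_measure set 'rV[R]_n -> \bar R}).

Definition lebesgue_succ : set 'rV[R]_n.+1 -> \bar R :=
  pushforward ((@lebesgue_measure R) \x m)%E (@cons_rV n).

Let lebesgue_succ0 : lebesgue_succ set0 = 0%E.
Proof. by rewrite /lebesgue_succ /pushforward preimage_set0 measure0. Qed.

Let lebesgue_succ_ge0 A : (0 <= lebesgue_succ A)%E.
Proof. by rewrite /lebesgue_succ /pushforward measure_ge0. Qed.

Let lebesgue_succ_sigma_additive : semi_sigma_additive lebesgue_succ.
Proof.
have mc := @measurable_cons_rV n.
by apply: measure_semi_sigma_additive.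
Qed.

HB.instance Definition _ := isMeasure.Build _ _ _ lebesgue_succ
  lebesgue_succ0 lebesgue_succ_ge0 lebesgue_succ_sigma_additive.

Let lebesgue_succ_sigma_finite : sigma_finite setT lebesgue_succ.
Proof.
have /sigma_finiteP[F [TF ndF Foo]] := sigma_finiteT (@lebesgue_measure R).
have /sigma_finiteP[G [TG ndG Goo]] := sigma_finiteT m.
pose g (v : 'rV[R]_n.+1) : measurableTypeR R * 'rV[R]_n :=
  (v ord0 ord0, \row_i v ord0 (lift ord0 i)).
have mc i : measurable_fun setT (fun v : 'rV[R]_n.+1 => v ord0 i).
  by apply: continuous_measurable_rV; exact: coord_continuous.
have mg : measurable_fun setT g.
  apply: measurable_fun_pair => /=; first exact: mc.
  by apply: measurable_fun_rV => i; under eq_fun do rewrite mxE; exact: mc.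
have gK : cancel (@cons_rV n) g.
  move=> [x v]; rewrite /g /cons_rV mxE unlift_none /=; congr pair.
  by apply/rowP => i; rewrite !mxE liftK.
have FGT : \bigcup_k (F k `*` G k) = setT.
  rewrite -setXTT TF TG predeqE => -[x y]; split.
    by move=> [k _ []/= ? ?]; split; exists k.
  move=> [/= [k _ Fkx] [l _ Gly]]; exists (maxn k l) => //; split.
  - by move: x Fkx; exact/subsetPset/ndF/leq_maxl.
  - by move: y Gly; exact/subsetPset/ndG/leq_maxr.
exists (fun i => g @^-1` (F i `*` G i)).
  by rewrite -preimage_bigcup FGT preimage_setT.
move=> i; have [mF Fi] := Foo i; have [mG Gi] := Goo i; split.
  by rewrite -[X in measurable X]setTI; apply: mg => //; exact: measurableX.
rewrite /lebesgue_succ /pushforward -comp_preimage.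
rewrite (_ : g \o _ = id); last by apply/funext => x /=; rewrite gK.
by rewrite preimage_id product_measure1E// lte_mul_pinfty// ge0_fin_numE.
Qed.

HB.instance Definition _ := Measure_isSigmaFinite.Build _ _ _ lebesgue_succ
  lebesgue_succ_sigma_finite.

End lebesgue_succ.

(* Lebesgue measure on R^n, as an iterated product along cons_rV. *)
Fixpoint lebesgue_rV n : {sigma_finite_measure set 'rV[R]_n -> \bar R} :=
  match n with
  | 0 => \d_(0 : 'rV[R]_0)
  | k.+1 => lebesgue_succ (lebesgue_rV k)
  end.

End lebesgue_rV.

Section sphere.
Context {R : realType}.

Definition enorm n (x : 'rV[R]_n) : R := Num.sqrt (\sum_i x ord0 i ^+ 2).

Definition sphere n (r : R) : set 'rV[R]_n := [set x | enorm x = r].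

Definition punctured_ball n (r : R) : set 'rV[R]_n :=
  [set x | 0 < enorm x <= r].

Definition radial_proj n (r : R) (x : 'rV[R]_n) : 'rV[R]_n :=
  (r / enorm x) *: x.

Lemma continuous_enorm n : continuous (@enorm n).
Proof.
move=> x; apply: (@continuous_comp _ _ _ (fun x : 'rV[R]_n => \sum_i x ord0 i ^+ 2) Num.sqrt).
  move: x; apply: continuous_big => [|i _ x]; first exact: add_continuous.
  apply: (@continuous_comp _ _ _ (fun x : 'rV[R]_n => x ord0 i) (fun t => t ^+ 2)).
    exact: coord_continuous.
  exact: exprn_continuous.
exact: sqrt_continuous.
Qed.

Lemma measurable_enorm n : measurable_fun setT (@enorm n).
Proof. by apply: continuous_measurable_rV; exact: continuous_enorm. Qed.

Lemma measurable_punctured_ball n r : measurable (@punctured_ball n r).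
Proof.
rewrite (_ : punctured_ball r = setT `&` @enorm n @^-1` `]0, r]).
  by apply: measurable_enorm => //; exact: measurable_itv.
by apply/seteqP; split => x /=; rewrite in_itv/= => // -[].
Qed.

Lemma measurable_radial_proj n r : measurable_fun setT (@radial_proj n r).
Proof.
apply: measurable_fun_rV => i; under eq_fun do rewrite mxE.
apply: measurable_funM; last first.
  by apply: continuous_measurable_rV; exact: coord_continuous.
apply: measurable_funM => //.
under eq_fun do rewrite -powR_inv1 ?sqrtr_ge0//.
by apply: (measurableT_comp (measurable_powR _)); exact: measurable_enorm.
Qed.

(* The surface measure of the sphere r S^(n-1) for r > 0, as a measure on R^n:
   the cone {t a | 0 < t <= 1, a \in A} over A `<=` r S^(n-1) has volume
   (r / n) area(A).  The absolute value only serves to get a measure when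
   r <= 0. *)
Section surface_measure.
Variables (n : nat) (r : R).

Definition surface_measure (A : set 'rV[R]_n) : \bar R :=
  (`|n%:R / r|%:E *
    lebesgue_rV n (radial_proj r @^-1` A `&` punctured_ball r))%E.

Let mu : {measure set 'rV[R]_n -> \bar R} :=
  mrestr (lebesgue_rV n) (@measurable_punctured_ball n r).

Let surface_measure0 : surface_measure set0 = 0%E.
Proof. by rewrite /surface_measure preimage_set0 set0I measure0 mule0. Qed.

Let surface_measure_ge0 A : (0 <= surface_measure A)%E.
Proof. by rewrite /surface_measure mule_ge0. Qed.

Let surface_measure_sigma_additive : semi_sigma_additive surface_measure.
Proof.
have mp := @measurable_radial_proj n r.
by apply: (measure_semi_sigma_additive
  (s := pushforward (mscale (`|n%:R / r|)%:nng mu) (@radial_proj n r))).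
Qed.

HB.instance Definition _ := isMeasure.Build _ _ _ surface_measure
  surface_measure0 surface_measure_ge0 surface_measure_sigma_additive.

End surface_measure.

End sphere.

Section potential.
Context {R : realType}.

Definition measure_support n (mu : {measure set 'rV[R]_n -> \bar R}) :
    set 'rV[R]_n :=
  [set x | forall U : set 'rV[R]_n, open U -> U x -> (0 < mu U)%E].

(* Integral against a finite signed measure, via its Jordan decomposition;
   Hahn_decomposition_uniq shows that the choice of P and N is immaterial. *)
Definition charge_integral disp (T : measurableType disp)
    (sigma : {charge set T -> \bar R}) (A : set T) (g : T -> R) : R :=
  let P := cid (Hahn_decomposition sigma) in
  let N := cid (svalP P) in
  \int[jordan_pos (svalP N)]_(x in A) g x -
  \int[jordan_neg (svalP N)]_(x in A) g x.

Definition newton_potential d (sigma : {charge set 'rV[R]_d.+1 -> \bar R})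
    (x : 'rV[R]_d.+1) : R :=
  charge_integral sigma (@sphere R d.+1 1) (fun y => enorm (x - y) ^- d.-1).

Section discrete_charge.
Context disp (T : measurableType disp) (n : nat).
Variables (a : 'I_n -> R) (t : 'I_n -> T).

Definition discrete_charge (A : set T) : \bar R :=
  (\sum_(k < n) (a k)%:E * \d_(t k) A)%E.

Let discrete_charge0 : discrete_charge set0 = 0%E.
Proof. by rewrite /discrete_charge big1// => k _; rewrite measure0 mule0. Qed.

Let discrete_charge_finite A : measurable A -> discrete_charge A \is a fin_num.
Proof.
by move=> mA; apply/sum_fin_numP => k _ _; rewrite fin_numM// fin_num_measure.
Qed.

Let discrete_charge_sigma_additive : semi_sigma_additive discrete_charge.
Proof.
have H (s : seq 'I_n) : exists c : {charge set T -> \bar R},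
    forall A, c A = (\sum_(k <- s) (a k)%:E * \d_(t k) A)%E.
  elim: s => [|k s [c cE]]; first by exists czero => A; rewrite big_nil.
  exists (cadd (cscale (a k) (charge_of_finite_measure \d_(t k))) c) => A.
  by rewrite big_cons -cE.
have [c cE] := H (index_enum 'I_n).
rewrite (_ : discrete_charge = c); last by apply/funext => A; rewrite cE.
exact: charge_semi_sigma_additive.
Qed.

HB.instance Definition _ := isCharge.Build _ _ _ discrete_charge
  discrete_charge0 discrete_charge_finite discrete_charge_sigma_additive.

End discrete_charge.

End potential.

Section spherical_harmonics.
Context {R : realType} (d : nat).
Local Notation E := 'rV[R]_d.+1.

Definition sphere_integral (g : E -> R) : R :=
  \int[surface_measure 1]_(x in sphere 1) g x.

(* Only the values of g on r S^d matter. *)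
Definition sphere_Lnorm (r : R) (p : \bar R) (g : E -> R) : \bar R :=
  ('N[surface_measure r]_p[EFin \o (g \_ (sphere r))])%E.

(* omega_d = 2 pi^((d+1)/2) / Gamma((d+1)/2). *)
Definition sphere_area : R := fine (surface_measure 1 (sphere 1 : set E)).

(* The quotient is exact. *)
Definition harmonic_dim (l : nat) : nat :=
  if l is 0 then 1
  else (((2 * l + d - 1) * 'C(l + d - 1, l)) %/ (l + d - 1))%N.

Definition spherical_harmonic (l : nat) (y : E -> R) :=
  exists P : mpoly d.+1 R,
    [/\ P \is ishomog1 l mdeg,
        \sum_(i < d.+1) mderiv i (mderiv i P) = 0 &
        forall x : E, sphere 1 x -> y x = meval (x ord0) P].

Definition harmonic_family := forall l, 'I_(harmonic_dim l) -> E -> R.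

Variable Y : harmonic_family.

Definition partial_sum (c : forall l, 'I_(harmonic_dim l) -> R) (N : nat)
    (x : E) : R :=
  \sum_(l < N) \sum_(k < harmonic_dim l) c l k * Y k x.

Definition cvg_L2 (c : forall l, 'I_(harmonic_dim l) -> R) (g : E -> R) :=
  (fun N => sphere_Lnorm 1 2%:E (fun x => partial_sum c N x - g x))
    @ \oo --> 0%E.

Definition harmonic_onb :=
  [/\ forall l (k : 'I_(harmonic_dim l)), spherical_harmonic l (Y k),
      forall l l' (k : 'I_(harmonic_dim l)) (k' : 'I_(harmonic_dim l')),
        sphere_integral (fun x => Y k x * Y k' x) =
          ((l == l') && (k == k' :> nat))%:R &
      forall g : E -> R, measurable_fun (sphere 1) g ->
        (sphere_Lnorm 1 2%:E g < +oo)%E ->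
        cvg_L2 (fun l k => sphere_integral (fun x => g x * Y k x)) g].

Definition fourier_coef (r : R) (f : E -> R) l (k : 'I_(harmonic_dim l)) : R :=
  sphere_integral (fun x => f (r *: x) * Y k x).

Definition D_coef (r : R) (f : E -> R) l (k : 'I_(harmonic_dim l)) : R :=
  (2 * l%:R + d%:R - 1) / ((d%:R - 1) * sphere_area) * fourier_coef r f k.

(* g, of which only the values on r S^d matter, is D(f): the series D(f_r)
   converges to g(r .) in L^2(S^d). *)
Definition is_D (r : R) (f g : E -> R) :=
  measurable_fun (sphere r) g /\ cvg_L2 (D_coef r f) (fun x => g (r *: x)).

Definition harmonic_on (U : set E) (f : E -> R) :=
  let e i : E := delta_mx ord0 i in
  forall x, U x ->
    [/\ forall i, derivable f x (e i),
        forall i j, derivable ('D_(e i) f) x (e j),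
        forall i j, {for x, continuous ('D_(e j) ('D_(e i) f))} &
        \sum_(i < d.+1) 'D_(e i) ('D_(e i) f) x = 0].

(* In dimension d + 1 >= 3, a function harmonic near infinity is harmonic at
   infinity (i.e. its Kelvin transform extends harmonically to 0) with value 0
   there exactly when it vanishes at infinity. *)
Definition class_F (r : R) (f : E -> R) :=
  [/\ harmonic_on [set x | r < enorm x] f,
      {within [set x | r <= enorm x], continuous f},
      forall eps : R, 0 < eps ->
        exists M : R, forall x, M < enorm x -> `|f x| < eps &
      exists2 g, is_D r f g & (sphere_Lnorm r +oo g < +oo)%E].

End spherical_harmonics.

(* Main.v *)
Require Import Defs.
From HB Require Import structures.
From mathcomp Require Import all_boot all_order all_algebra.
From mathcomp Require mpoly.
Import -(notations) mpoly.
From mathcomp Require Import ring lra.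
From mathcomp Require Import all_classical all_reals all_analysis.
From mathcomp Require Import measurable_realfun ess_sup_inf.

Set Implicit Arguments.
Unset Strict Implicit.
Unset Printing Implicit Defensive.

Import Order.TTheory GRing.Theory Num.Theory.
Import numFieldNormedType.Exports.

Local Open Scope classical_set_scope.
Local Open Scope ring_scope.

(** The operator [D] is made so that pairing [D f] with the Newton kernel amounts to
    pairing [f] with the Poisson kernel, which reproduces harmonic functions.

    In detail, a function harmonic outside the ball of radius [r], continuous up to its
    boundary and vanishing at infinity is the exterior Poisson integral of its boundary
    values ([poisson_formula_exterior]). At a point [x] of the unit sphere, inversion
    turns the exterior kernel into the kernel of the unit ball at [r x]
    ([poisson_integral_inversion]). For a spherical harmonic [y] of degree [l], the
    integral over [u] of [y u] times that kernel is [omega r^l y(x)]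
    ([poisson_integral_harmonic]), while the integral of [y u] times
    [|x - r u|^-(d-1)] is [omega (d-1) / (2l+d-1) r^l y(x)]
    ([newton_integral_harmonic]). The ratio of these constants is, up to [omega], the
    multiplier of [D]. Both kernels being bounded, the [L^2] expansions of [f_r] and of
    [D f] can be integrated against them term by term ([cvg_L2_integral]), whence

      [f x = r^(d-1) \int |x - r u|^-(d-1) Df (r u) d sigma(u)]   for [|x| = 1]

    ([newton_representation]). Integrating this against [mu - nu] and exchanging the
    integrals ([fubini_kernel]) yields the integral of [Df] against the potential of
    [mu - nu] ([quadrature_errorE]). On the sphere of radius [r] the surface measure is
    [r^d] times that of the unit sphere, so the factor becomes [r^-1], which is at most
    [r0^-1], and the Hoelder inequality concludes.

    Poisson's formula is obtained by comparing a harmonic function with its Poisson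
    integral near the boundary, with the maximum principle ([max_principle]). That the
    Poisson kernel has mass [omega] ([poisson_mass]) comes from the invariance of the
    surface measure under plane rotations, which are products of shears
    ([plane_rot_shear]). *)

(** * Linear maps and Lebesgue measure *)

Section image_measure.
Context d d' (T1 : measurableType d) (T2 : measurableType d') (R : realType).
Variables (m : {measure set T1 -> \bar R}) (f : T1 -> T2).
Hypothesis mf : measurable_fun setT f.

(** The measurability of [f], which inference cannot find for the maps below, is
    made an argument. *)
Definition image_measure : {measure set T2 -> \bar R}.
Proof. by unshelve refine (pushforward m f : {measure set T2 -> \bar R}). Defined.

End image_measure.

Section lebesgue_linear.
Context {R : realType}.
Local Notation leb := (@lebesgue_measure R).

Lemma lebesgue_translate (c : R) (A : set (measurableTypeR R)) :
  measurable A -> leb ((fun x => x + c) @^-1` A) = leb A.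
Proof.
have mc : measurable_fun setT (fun x : measurableTypeR R => x + c : measurableTypeR R).
  exact: measurable_funD.
move=> mA; rewrite -[LHS]/(image_measure leb mc A).
apply/esym/lebesgue_measure_unique => // X /ocitvP[->|[[a b] /= ab ->]].
  by rewrite !measure0.
rewrite /pushforward (_ : _ @^-1` _ = `]a - c, b - c]%classic); last first.
  by apply/seteqP; split => x /=; rewrite !in_itv/= ltrBlDr lerBrDr.
rewrite !lebesgue_measure_itv/= !lte_fin ltrD2r; case: ifP => // _.
by rewrite -!EFinD opprB addrA subrK.
Qed.

Lemma lebesgue_dilate (c : R) (A : set (measurableTypeR R)) : 0 < c ->
  measurable A -> leb ((fun x => c * x) @^-1` A) = ((c^-1)%:E * leb A)%E.
Proof.
move=> c0; have c'0 : 0 <= c by exact: ltW.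
have mc : measurable_fun setT (fun x : measurableTypeR R => c * x : measurableTypeR R).
  exact: measurable_funM.
move=> mA.
suff -> : leb A = (c%:E * leb ((fun x => (c * x)%R) @^-1` A))%E.
  by rewrite muleA -EFinM mulVf ?gt_eqF// mul1e.
rewrite -[RHS]/(mscale (NngNum c'0) (image_measure leb mc) A).
apply/lebesgue_measure_unique => // X /ocitvP[->|[[a b] /= ab ->]].
  by rewrite !measure0.
rewrite /mscale/= /pushforward (_ : _ @^-1` _ = `]a / c, b / c]%classic); last first.
  by apply/seteqP; split => x /=; rewrite !in_itv/= ltr_pdivrMr// ler_pdivlMr// mulrC.
rewrite !lebesgue_measure_itv/= !lte_fin ltr_pM2r ?invr_gt0//; case: ifP => // _.
  by rewrite -!EFinD -EFinM; congr EFin; field; rewrite gt_eqF.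
by rewrite mule0.
Qed.

Lemma measurable_addrV n (v : 'rV[R]_n) : measurable_fun setT (fun x : 'rV[R]_n => x + v).
Proof.
apply: measurable_fun_rV => i; under eq_fun do rewrite mxE.
apply: measurable_funD => //.
by apply: continuous_measurable_rV; exact: coord_continuous.
Qed.

Lemma measurable_coord n i : measurable_fun setT (fun x : 'rV[R]_n => x ord0 i).
Proof. by apply: continuous_measurable_rV; exact: coord_continuous. Qed.

Lemma measurable_scalerV n (c : R) : measurable_fun setT (fun x : 'rV[R]_n => c *: x).
Proof.
apply: measurable_fun_rV => i; under eq_fun do rewrite mxE.
by apply: measurable_funM => //; exact: measurable_coord.
Qed.

Section fibers.
Context d1 d2 (T1 : measurableType d1) (T2 : measurableType d2).
Variables (m1 : {sigma_finite_measure set T1 -> \bar R})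
  (m2 : {sigma_finite_measure set T2 -> \bar R}).

Lemma product_measure_section2 A : measurable A ->
  (m1 \x m2)%E A = (\int[m2]_y m1 (ysection A y))%E.
Proof.
move=> mA; rewrite -[RHS]/((m1 \x^ m2)%E A).
by apply: product_measure_unique => // B C mB mC; exact: product_measure2E.
Qed.

(** By Fubini, a map that preserves the measure of one factor, for each value of
    the other, preserves the product measure. *)
Lemma product_measure_fiber1 (phi : T2 -> T1 -> T1) A :
  measurable_fun setT (fun p : T1 * T2 => (phi p.2 p.1, p.2)) ->
  (forall y B, measurable B -> m1 (phi y @^-1` B) = m1 B) ->
  measurable A ->
  (m1 \x m2)%E ((fun p => (phi p.2 p.1, p.2)) @^-1` A) = (m1 \x m2)%E A.
Proof.
move=> mphi phiE mA; rewrite !product_measure_section2//; last first.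
  by rewrite -[X in measurable X]setTI; exact: mphi.
apply: eq_integral => y _.
rewrite (_ : ysection _ y = phi y @^-1` ysection A y).
  by apply: phiE; exact: measurable_ysection.
by apply/seteqP; split => x /=; rewrite /ysection/= !inE.
Qed.

Lemma product_measure_fiber2 (phi : T1 -> T2 -> T2) A :
  measurable_fun setT (fun p : T1 * T2 => (p.1, phi p.1 p.2)) ->
  (forall x B, measurable B -> m2 (phi x @^-1` B) = m2 B) ->
  measurable A ->
  (m1 \x m2)%E ((fun p => (p.1, phi p.1 p.2)) @^-1` A) = (m1 \x m2)%E A.
Proof.
move=> mphi phiE mA; apply: eq_integral => x _ /=.
rewrite (_ : xsection _ x = phi x @^-1` xsection A x).
  by apply: phiE; exact: measurable_xsection.
by apply/seteqP; split => y /=; rewrite /xsection/= !inE.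
Qed.

End fibers.

Lemma lebesgue_rVS n (A : set 'rV[R]_n.+1) :
  lebesgue_rV n.+1 A = (leb \x lebesgue_rV n)%E (@cons_rV R n @^-1` A).
Proof. by []. Qed.

Lemma cons_rV0 n p : @cons_rV R n p ord0 ord0 = p.1.
Proof. by rewrite /cons_rV mxE unlift_none. Qed.

Lemma cons_rV_lift n p i : @cons_rV R n p ord0 (lift ord0 i) = p.2 ord0 i.
Proof. by rewrite /cons_rV mxE liftK. Qed.

Lemma rVS_eq n (x y : 'rV[R]_n.+1) : x ord0 ord0 = y ord0 ord0 ->
  (forall i, x ord0 (lift ord0 i) = y ord0 (lift ord0 i)) -> x = y.
Proof. by move=> h0 h; apply/rowP => j; case: (unliftP ord0 j) => [i ->|->]. Qed.

Lemma measurable_preimage_cons n (A : set 'rV[R]_n.+1) :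
  measurable A -> measurable (@cons_rV R n @^-1` A).
Proof.
by move=> mA; rewrite -[X in measurable X]setTI; exact: measurable_cons_rV.
Qed.

Lemma lift_ord0 n (i : 'I_n) : (lift ord0 i == ord0) = false.
Proof. by []. Qed.

Lemma ord0_lift n (i : 'I_n) : (ord0 == lift ord0 i) = false.
Proof. by []. Qed.

Lemma lebesgue_rV_translate n (v : 'rV[R]_n) (A : set 'rV[R]_n) :
  measurable A -> lebesgue_rV n ((fun x => x + v) @^-1` A) = lebesgue_rV n A.
Proof.
elim: n => [|n IH] in v A *.
  by move=> _; congr (_ _); apply/seteqP; split => x /=; rewrite [v]thinmx0 addr0.
have mA := @measurable_preimage_cons n A; move=> /mA{}mA; rewrite !lebesgue_rVS.
set v0 : measurableTypeR R := v ord0 ord0.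
pose v' : 'rV[R]_n := \row_i v ord0 (lift ord0 i).
set B := _ @^-1` A in mA *.
rewrite (_ : _ @^-1` _ = (fun p => (p.1 + v0, p.2)) @^-1`
    ((fun p : measurableTypeR R * 'rV[R]_n => (p.1, p.2 + v')) @^-1` B)); last first.
  suff e p : cons_rV p + v = cons_rV (p.1 + v0, p.2 + v').
    by apply/seteqP; split => p /=; rewrite /B/= e.
  by apply: rVS_eq => [|i]; rewrite mxE ?cons_rV0 ?cons_rV_lift// !mxE.
have mv : measurable_fun setT (fun p : measurableTypeR R * 'rV[R]_n => (p.1, p.2 + v')).
  apply: measurable_fun_pair => //=.
  by apply: (measurableT_comp (@measurable_addrV _ v')).
rewrite (@product_measure_fiber1 _ _ _ _ leb (lebesgue_rV n) (fun y (x : measurableTypeR R) => x + v0 : measurableTypeR R)).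
- rewrite (@product_measure_fiber2 _ _ _ _ leb (lebesgue_rV n) (fun x (y : 'rV[R]_n) => y + v'))//.
  by move=> _ C; exact: IH.
- apply: measurable_fun_pair => //=.
  by apply: measurable_funD => //; exact: measurable_fst.
- by move=> _ C; exact: lebesgue_translate.
- by rewrite -[X in measurable X]setTI; exact: mv.
Qed.

Lemma lebesgue_rV_dilate n (c : R) (A : set 'rV[R]_n) : 0 < c -> measurable A ->
  lebesgue_rV n ((fun x => c *: x) @^-1` A) = ((c ^- n)%:E * lebesgue_rV n A)%E.
Proof.
move=> c0; elim: n => [|n IH] in A *.
  move=> _; rewrite expr0 invr1 mul1e; congr (_ _).
  by apply/seteqP; split => x /=; rewrite [x]thinmx0 scaler0.
have mA := @measurable_preimage_cons n A; move=> /mA{}mA; rewrite !lebesgue_rVS.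
set B := _ @^-1` A in mA *.
pose T (p : measurableTypeR R * 'rV[R]_n) : measurableTypeR R * 'rV[R]_n :=
  (c * p.1 : measurableTypeR R, c *: p.2).
rewrite (_ : _ @^-1` _ = T @^-1` B); last first.
  suff e p : c *: cons_rV p = cons_rV (T p).
    by apply/seteqP; split => p /=; rewrite /B/= e.
  by apply: rVS_eq => [|i]; rewrite mxE ?cons_rV0 ?cons_rV_lift// !mxE.
have mT : measurable_fun setT T.
  apply: measurable_fun_pair => //=.
    by apply: measurable_funM => //; exact: measurable_fst.
  by apply: (measurableT_comp (@measurable_scalerV n c)).
have cn0 : 0 <= c ^+ n.+1 by rewrite exprn_ge0 ?ltW.
have mu m : measurable m -> ((leb \x lebesgue_rV n)%E m =
    mscale (NngNum cn0) (image_measure (leb \x lebesgue_rV n)%E mT) m)%E.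
  apply: product_measure_unique => C D mC mD; rewrite -[LHS]/((c ^+ n.+1)%:E * (leb \x lebesgue_rV n)%E (T @^-1` (C `*` D)))%E.
  rewrite (_ : T @^-1` _ = ((fun x => c * x) @^-1` C) `*` ((fun x => c *: x) @^-1` D)); last by [].
  have -> : ((leb \x lebesgue_rV n)%E
      (((fun x => (c * x)%R) @^-1` C) `*` ((fun x => (c *: x)%R) @^-1` D)) =
      leb ((fun x => (c * x)%R) @^-1` C) * lebesgue_rV n ((fun x => (c *: x)%R) @^-1` D))%E.
    apply: product_measure1E.
      rewrite -[X in measurable X]setTI.
      by apply: (@measurable_funM _ _ _ _ (cst c) id).
    by rewrite -[X in measurable X]setTI; exact: measurable_scalerV.
  rewrite IH// (lebesgue_dilate c0 mC) muleACA -EFinM !muleA -EFinM.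
  have -> : c ^+ n.+1 * (c^-1 * c ^- n) = 1.
    by rewrite exprS; field; rewrite expf_eq0 (gt_eqF c0) andbF.
  by rewrite mul1e.
rewrite (mu _ mA) -[X in (_ = _ * X)%E]/((c ^+ n.+1)%:E * (leb \x lebesgue_rV n)%E (T @^-1` B))%E muleA -EFinM mulVf ?mul1e//.
by rewrite gt_eqF// exprn_gt0.
Qed.

Definition shear n (i j : 'I_n) (c : R) (x : 'rV[R]_n) : 'rV[R]_n :=
  x + (c * x ord0 j) *: delta_mx ord0 i.

Lemma shearE n (i j k : 'I_n) c x :
  shear i j c x ord0 k = x ord0 k + c * x ord0 j * (k == i)%:R.
Proof. by rewrite /shear !mxE eqxx. Qed.

Lemma measurable_shear n (i j : 'I_n) c : measurable_fun setT (@shear n i j c).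
Proof.
apply: measurable_fun_rV => k; under eq_fun do rewrite shearE.
apply: measurable_funD; first exact: measurable_coord.
by do 2 apply: measurable_funM => //; exact: measurable_coord.
Qed.

Lemma lebesgue_rV_shear0 n (j : 'I_n) c (A : set 'rV[R]_n.+1) : measurable A ->
  lebesgue_rV n.+1 (shear ord0 (lift ord0 j) c @^-1` A) = lebesgue_rV n.+1 A.
Proof.
move=> /measurable_preimage_cons mA; rewrite !lebesgue_rVS.
pose phi (y : 'rV[R]_n) (x : measurableTypeR R) : measurableTypeR R :=
  x + c * y ord0 j.
rewrite -[RHS](@product_measure_fiber1 _ _ _ _ leb (lebesgue_rV n) phi)//.
- congr (product_measure1 _ _ _); apply/seteqP; split => p /=;
    suff -> : shear ord0 (lift ord0 j) c (cons_rV p) = cons_rV (phi p.2 p.1, p.2) by [];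
    by apply: rVS_eq => [|i]; rewrite shearE ?cons_rV0 ?cons_rV_lift/= ?mulr1// mulr0 addr0.
- apply: measurable_fun_pair => //=; apply: measurable_funD; first exact: measurable_fst.
  apply: measurable_funM => //.
  by apply: (measurableT_comp (f := fun v : 'rV[R]_n => v ord0 j)) => //; exact: measurable_coord.
- by move=> y B mB; exact: lebesgue_translate.
Qed.

Lemma lebesgue_rV_shearS n (j : 'I_n) c (A : set 'rV[R]_n.+1) : measurable A ->
  lebesgue_rV n.+1 (shear (lift ord0 j) ord0 c @^-1` A) = lebesgue_rV n.+1 A.
Proof.
move=> /measurable_preimage_cons mA; rewrite !lebesgue_rVS.
pose phi (x : measurableTypeR R) (y : 'rV[R]_n) : 'rV[R]_n :=
  y + (c * x) *: delta_mx ord0 j.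
rewrite -[RHS](@product_measure_fiber2 _ _ _ _ leb (lebesgue_rV n) phi)//.
- congr (product_measure1 _ _ _); apply/seteqP; split => p /=;
    suff -> : shear (lift ord0 j) ord0 c (cons_rV p) = cons_rV (p.1, phi p.1 p.2) by [];
    by apply: rVS_eq => [|i]; rewrite shearE ?cons_rV0 ?cons_rV_lift/= ?mulr0 ?addr0// !mxE.
- apply: measurable_fun_pair => //=; apply: measurable_fun_rV => i.
  under eq_fun do rewrite !mxE; apply: measurable_funD.
    by apply: (measurableT_comp (f := fun v : 'rV[R]_n => v ord0 i)) => //; exact: measurable_coord.
  by do 2 apply: measurable_funM => //; exact: measurable_fst.
- by move=> y B mB; exact: lebesgue_rV_translate.
Qed.

(** A rotation when [c ^+ 2 + s ^+ 2 = 1]. The planes containing the first axis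
    suffice to bring any vector to that axis. *)
Definition plane_rot n (j : 'I_n) (c s : R) (x : 'rV[R]_n.+1) : 'rV[R]_n.+1 :=
  \row_k if k == ord0 then c * x ord0 ord0 + s * x ord0 (lift ord0 j)
         else if k == lift ord0 j then c * x ord0 (lift ord0 j) - s * x ord0 ord0
         else x ord0 k.

(** A plane rotation other than the half-turn is a product of three shears, by
    the half-angle formula [tan (u / 2) = sin u / (1 + cos u)]. *)
Lemma plane_rot_shear n (j : 'I_n) c s x : c ^+ 2 + s ^+ 2 = 1 -> 1 + c != 0 ->
  plane_rot j c s x = shear ord0 (lift ord0 j) (s / (1 + c))
    (shear (lift ord0 j) ord0 (- s) (shear ord0 (lift ord0 j) (s / (1 + c)) x)).
Proof.
move=> cs c1; set t := s / (1 + c).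
have h2 : t * (1 + c) = s by rewrite /t divfK.
have h1 : t * s = 1 - c.
  apply: (mulIf c1); rewrite mulrAC h2 -expr2.
  have -> : s ^+ 2 = 1 - c ^+ 2 by rewrite -cs; ring.
  by ring.
apply: rVS_eq => [|i]; rewrite mxE !shearE !(lift_ord0, ord0_lift) !eqxx /=.
  set a := x ord0 ord0; set b := x ord0 (lift ord0 j).
  transitivity (a * (1 - t * s) + b * (2 * t - t * (t * s))); last by ring.
  by rewrite h1 -h2; ring.
have [->|_] /= := eqVneq (lift ord0 i) (lift ord0 j); last by rewrite !mulr0 !addr0.
set a := x ord0 ord0; set b := x ord0 (lift ord0 j).
transitivity (b * (1 - t * s) - s * a); last by ring.
by rewrite h1; ring.
Qed.

Lemma measurable_plane_rot n (j : 'I_n) c s : measurable_fun setT (plane_rot j c s).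
Proof.
apply: measurable_fun_rV => k; under eq_fun do rewrite mxE.
have mc i := @measurable_coord n.+1 i.
case: (k == ord0); first by apply: measurable_funD; apply: measurable_funM.
case: (k == _) => /=; last exact: mc.
by apply: measurable_funB; apply: measurable_funM.
Qed.

Lemma lebesgue_rV_plane_rot n (j : 'I_n) c s (A : set 'rV[R]_n.+1) :
  c ^+ 2 + s ^+ 2 = 1 -> 1 + c != 0 -> measurable A ->
  lebesgue_rV n.+1 (plane_rot j c s @^-1` A) = lebesgue_rV n.+1 A.
Proof.
move=> cs c1 mA; set t := s / (1 + c).
have mpre i k u (B : set 'rV[R]_n.+1) : measurable B -> measurable (shear i k u @^-1` B).
  by move=> mB; rewrite -[X in measurable X]setTI; exact: measurable_shear.
rewrite (_ : _ @^-1` A = shear ord0 (lift ord0 j) t @^-1`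
   (shear (lift ord0 j) ord0 (- s) @^-1` (shear ord0 (lift ord0 j) t @^-1` A))).
  rewrite lebesgue_rV_shear0; last by apply: (mpre); exact: (mpre).
  by rewrite lebesgue_rV_shearS ?lebesgue_rV_shear0//; exact: mpre.
by apply/seteqP; split => x /=; rewrite plane_rot_shear.
Qed.

Lemma enorm_sqr n (x : 'rV[R]_n) : enorm x ^+ 2 = \sum_i x ord0 i ^+ 2.
Proof. by rewrite /enorm sqr_sqrtr// sumr_ge0// => i _; rewrite sqr_ge0. Qed.

Lemma enorm_plane_rot n (j : 'I_n) c s (x : 'rV[R]_n.+1) :
  c ^+ 2 + s ^+ 2 = 1 -> enorm (plane_rot j c s x) = enorm x.
Proof.
move=> cs; rewrite /enorm; congr Num.sqrt.
rewrite (bigD1 ord0)//= (bigD1 (lift ord0 j))//= [RHS](bigD1 ord0)//=.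
rewrite [in RHS](bigD1 (lift ord0 j))//= !addrA; congr (_ + _).
  rewrite !mxE eqxx lift_ord0 eqxx.
  set a := x _ _; set b := x _ _.
  transitivity ((c ^+ 2 + s ^+ 2) * (a ^+ 2 + b ^+ 2)); first by ring.
  by rewrite cs mul1r.
by apply: eq_bigr => k /andP[k0 k1]; rewrite mxE (negbTE k0) (negbTE k1).
Qed.

Lemma plane_rotZ n (j : 'I_n) c s k (x : 'rV[R]_n.+1) :
  plane_rot j c s (k *: x) = k *: plane_rot j c s x.
Proof. by apply/rowP => i; rewrite !mxE; do 2?case: ifP => _ //; ring. Qed.

Lemma plane_rotB n (j : 'I_n) c s (x y : 'rV[R]_n.+1) :
  plane_rot j c s (x - y) = plane_rot j c s x - plane_rot j c s y.
Proof. by apply/rowP => i; rewrite !mxE; do 2?case: ifP => _ //; ring. Qed.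

(** Every vector is brought to a multiple of the first basis vector by
    cancelling its other coordinates one by one, each with one rotation; the
    half-turn is never needed since the coordinate to be cancelled is nonzero. *)
Lemma plane_rot_axis n (P : set 'rV[R]_n.+1) :
  (forall j c s x, c ^+ 2 + s ^+ 2 = 1 -> 1 + c != 0 -> P (plane_rot j c s x) -> P x) ->
  forall x : 'rV[R]_n.+1,
  (forall y : 'rV[R]_n.+1, enorm y = enorm x ->
    (forall j : 'I_n, y ord0 (lift ord0 j) = 0) -> P y) -> P x.
Proof.
(* Induction on the number of nonzero coordinates other than the first. *)
move=> Prot x; have [m] := ubnP #|[pred j : 'I_n | x ord0 (lift ord0 j) != 0]|.
elim: m x => // m IH x; rewrite ltnS => xm Py.
have [/forallP x0|] := boolP [forall j : 'I_n, x ord0 (lift ord0 j) == 0].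
  by apply: Py => // j; exact/eqP.
rewrite negb_forall => /existsP[j xj].
set a := x ord0 ord0; set b := x ord0 (lift ord0 j) in xj *.
pose q := Num.sqrt (a ^+ 2 + b ^+ 2).
have q2 : q ^+ 2 = a ^+ 2 + b ^+ 2 by rewrite sqr_sqrtr// addr_ge0 ?sqr_ge0.
have b2 : 0 < b ^+ 2 by rewrite lt0r sqr_ge0 sqrf_eq0 xj.
have q0 : 0 < q by rewrite sqrtr_gt0 ltr_wpDl ?sqr_ge0.
have cs : (a / q) ^+ 2 + (b / q) ^+ 2 = 1.
  by rewrite !expr_div_n -mulrDl -q2 divff// sqrf_eq0 gt_eqF.
have c1 : 1 + a / q != 0.
  rewrite addrC addr_eq0; apply/eqP => e.
  have aq : a = - q by rewrite -[a](divfK (lt0r_neq0 q0)) e mulN1r.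
  by move: q2; rewrite aq sqrrN; lra.
apply: (Prot j (a / q) (b / q)) => //; apply: IH; last first.
  by move=> y; rewrite enorm_plane_rot//; exact: Py.
apply: leq_trans xm; apply: proper_card; apply/properP; split.
  apply/fintype.subsetP => k.
  rewrite !inE mxE lift_ord0.
  case: ifP => // /eqP -> _; exact: xj.
exists j; rewrite !inE// mxE lift_ord0 eqxx negbK.
by rewrite -/a -/b; apply/eqP; ring.
Qed.

End lebesgue_linear.

(** * The surface measure *)

Section surface_measure_theory.
Context {R : realType}.
Local Notation leb := (@lebesgue_measure R).

Definition cube n (a b : R) : set 'rV[R]_n := [set x | forall i, a < x ord0 i <= b].
Arguments cube : clear implicits.

Lemma measurable_cube n a b : measurable (cube n a b).
Proof.
rewrite (_ : cube n a b =
  \bigcap_(i in [set: 'I_n]) ((fun x : 'rV[R]_n => x ord0 i) @^-1` `]a, b])).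
  apply: fin_bigcap_measurable => // i _; rewrite -[X in measurable X]setTI.
  by apply: measurable_coord => //; exact: measurable_itv.
apply/seteqP; split => x /= h i; first by move=> _; rewrite /= in_itv/=; exact: h.
by have := h i Logic.I; rewrite /= in_itv.
Qed.

Lemma lebesgue_rV_cube n (a b : R) : a <= b ->
  lebesgue_rV n (cube n a b) = ((b - a) ^+ n)%:E.
Proof.
move=> ab; elim: n => [|n IH].
  rewrite expr0 -[LHS]/(\d_(0 : 'rV[R]_0) _) diracE mem_set//=.
  by case.
rewrite lebesgue_rVS.
rewrite (_ : @cons_rV R n @^-1` _ = (`]a, b]%classic : set (measurableTypeR R)) `*` cube n a b).
  rewrite [LHS]product_measure1E//; last exact: measurable_cube.
  rewrite IH exprS EFinM; congr (_ * _)%E.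
  suff : leb `]a, b]%classic = (b - a)%:E by [].
  rewrite lebesgue_measure_itv/= lte_fin; case: ltrP => // ba.
  by congr EFin; apply/esym/eqP; rewrite subr_eq0 eq_le ba ab.
apply/seteqP; split => -[x y] /=; rewrite in_itv/=.
  move=> h; split; first by have := h ord0; rewrite cons_rV0.
  by move=> i; have := h (lift ord0 i); rewrite cons_rV_lift.
by move=> [h1 h2] i; case: (unliftP ord0 i) => [k ->|->]; rewrite ?cons_rV0 ?cons_rV_lift.
Qed.

Lemma enorm_ge0 n (x : 'rV[R]_n) : 0 <= enorm x.
Proof. exact: sqrtr_ge0. Qed.

Lemma ler_coord_enorm n (x : 'rV[R]_n) i : `|x ord0 i| <= enorm x.
Proof.
rewrite -ler_sqr ?nnegrE ?enorm_ge0// enorm_sqr real_normK ?num_real//.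
by rewrite (bigD1 i)//= lerDl sumr_ge0// => j _; rewrite sqr_ge0.
Qed.

(** A ball lies in a cube; this is what makes the surface measures finite. *)
Lemma lebesgue_rV_punctured_ball n (r : R) : (lebesgue_rV n (punctured_ball r) < +oo)%E.
Proof.
pose M := Num.max r 0.
apply: (@le_lt_trans _ _ (lebesgue_rV n (cube n (- (M + 1)) M))).
  apply: le_measure; rewrite ?inE//; first exact: measurable_punctured_ball.
    exact: measurable_cube.
  move=> x /= /andP[_ xr] i; have := ler_coord_enorm x i; rewrite ler_norml => /andP[h1 h2].
  have rM : r <= M by rewrite le_max lexx.
  by apply/andP; split; lra.
have M0 : 0 <= M by rewrite le_max lexx orbT.
by rewrite lebesgue_rV_cube ?ltry//; lra.
Qed.

Let surface_measure_fin n r : fin_num_fun (@surface_measure R n r).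
Proof.
move=> A mA; rewrite /surface_measure fin_numM//.
rewrite ge0_fin_numE// (le_lt_trans _ (lebesgue_rV_punctured_ball n r))//.
apply: le_measure; rewrite ?inE; last by move=> ? [].
  apply: measurableI; last exact: measurable_punctured_ball.
  by rewrite -[X in measurable X]setTI; exact: measurable_radial_proj.
exact: measurable_punctured_ball.
Qed.

HB.instance Definition _ n r := Measure_isFinite.Build _ _ _
  (@surface_measure R n r) (surface_measure_fin (n := n) r).

Lemma measurable_sphere n (r : R) : measurable (sphere r : set 'rV[R]_n).
Proof.
rewrite (_ : sphere r = setT `&` @enorm R n @^-1` [set r]).
  by apply: measurable_enorm.
by rewrite setTI.
Qed.

Lemma enormZ n (k : R) (x : 'rV[R]_n) : enorm (k *: x) = `|k| * enorm x.
Proof.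
rewrite /enorm -sqrtr_sqr -sqrtrM ?sqr_ge0//; congr Num.sqrt.
by rewrite mulr_sumr; apply: eq_bigr => i _; rewrite mxE exprMn.
Qed.

Lemma enorm0 n : enorm (0 : 'rV[R]_n) = 0.
Proof. by rewrite -(scale0r 0) enormZ normr0 mul0r. Qed.

Lemma enorm_eq0 n (x : 'rV[R]_n) : enorm x = 0 -> x = 0.
Proof.
move=> x0; apply/rowP => i; rewrite mxE; apply/eqP; rewrite -normr_le0.
by rewrite -x0 ler_coord_enorm.
Qed.

(** The cones over [A] and over its rescaling are homothetic; the factor [1 / r] in
    the definition of the surface measure lowers the exponent [n + 1] of the volume
    to [n]. *)
Lemma surface_measure_scale n (r : R) (A : set 'rV[R]_n.+1) : 0 < r -> measurable A ->
  surface_measure r A = ((r ^+ n)%:E * surface_measure 1 ((fun x => r *: x) @^-1` A))%E.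
Proof.
move=> r0 mA; rewrite /surface_measure divr1.
set B := radial_proj r @^-1` A `&` _; set C := radial_proj 1 @^-1` _ `&` _.
have mB : measurable B.
  apply: measurableI; last exact: measurable_punctured_ball.
  by rewrite -[X in measurable X]setTI; exact: measurable_radial_proj.
have CB : C = (fun x => r *: x) @^-1` B.
  have e x : radial_proj r (r *: x) = r *: radial_proj 1 x.
    rewrite /radial_proj enormZ gtr0_norm// !scalerA; congr (_ *: _).
    by rewrite mul1r invfM (mulrA r r^-1) divff ?gt_eqF// mul1r mulrC.
  have e' x : punctured_ball r (r *: x) = punctured_ball 1 x.
    rewrite /punctured_ball/= enormZ gtr0_norm// pmulr_rgt0//.
    by rewrite -[X in _ <= X]mulr1 ler_pM2l.
  by apply/seteqP; split => x; rewrite /B /C /= e e'.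
rewrite CB lebesgue_rV_dilate// !muleA; congr (_ * _)%E.
rewrite -!EFinM; congr EFin; rewrite normrM [in `|r^-1|]gtr0_norm ?invr_gt0//.
by rewrite exprS; field; rewrite !gt_eqF ?exprn_gt0.
Qed.

Lemma surface_measure_plane_rot n (j : 'I_n) c s (A : set 'rV[R]_n.+1) :
  c ^+ 2 + s ^+ 2 = 1 -> 1 + c != 0 -> measurable A ->
  surface_measure 1 (plane_rot j c s @^-1` A) = surface_measure 1 A.
Proof.
move=> cs c1 mA; rewrite /surface_measure; congr (_ * _)%E.
rewrite -[RHS](lebesgue_rV_plane_rot j cs c1).
  congr (_ _); apply/seteqP; split => x;
   by rewrite /= /punctured_ball/= /radial_proj enorm_plane_rot// plane_rotZ.
apply: measurableI; last exact: measurable_punctured_ball.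
by rewrite -[X in measurable X]setTI; exact: measurable_radial_proj.
Qed.

Lemma sphere_rot n (j : 'I_n) c s : c ^+ 2 + s ^+ 2 = 1 ->
  plane_rot j c s @^-1` sphere 1 = sphere 1 :> set 'rV[R]_n.+1.
Proof. by move=> cs; apply/seteqP; split => x; rewrite /sphere/= enorm_plane_rot. Qed.

Lemma integral_plane_rot n (j : 'I_n) c s (F : 'rV[R]_n.+1 -> R) :
  c ^+ 2 + s ^+ 2 = 1 -> 1 + c != 0 ->
  measurable_fun setT F -> (forall x, 0 <= F x) ->
  \int[surface_measure 1]_(x in sphere 1) F (plane_rot j c s x) =
  \int[surface_measure 1]_(x in sphere 1) F x.
Proof.
move=> cs c1 mF F0; rewrite /Rintegral; congr fine.
rewrite -{1}(sphere_rot j cs).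
rewrite -(@ge0_integral_pushforward _ _ _ _ _ _ (measurable_plane_rot j c s) (surface_measure 1) _ (EFin \o F)); first last.
- by move=> x _; rewrite /= lee_fin.
- by apply/measurable_EFinP; exact: measurable_funTS.
- exact: measurable_sphere.
apply: eq_measure_integral; first exact: measurable_plane_rot.
by move=> ? A mA _; exact: surface_measure_plane_rot.
Qed.

Lemma ge0_integral_sphere_scale n (r : R) (F : 'rV[R]_n.+1 -> \bar R) : 0 < r ->
  measurable_fun (sphere r) F -> (forall x, 0 <= F x)%E ->
  (\int[surface_measure r]_(x in sphere r) F x =
  (r ^+ n)%:E * \int[surface_measure 1]_(x in sphere 1) F (r *: x))%E.
Proof.
move=> r0 mF F0.
have ms := @measurable_scalerV R n.+1 r.
have rn0 : 0 <= r ^+ n by rewrite exprn_ge0// ltW.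
pose m := image_measure (surface_measure 1) ms.
have F0' x : sphere r x -> (0 <= F x)%E by move=> _; exact: F0.
have mS := @measurable_sphere n.+1 r.
have mE : (\int[m]_(x in sphere r) F x =
    \int[surface_measure 1]_(x in sphere 1) F (r *: x))%E.
  rewrite [LHS](@ge0_integral_pushforward _ _ _ _ _ _ ms (surface_measure 1) _ F mS mF); last first.
    by move=> x _; exact: F0.
  congr (integral _ _ _); apply/seteqP; split => x; rewrite /sphere/= enormZ gtr0_norm//.
    by move=> h; apply: (mulfI (lt0r_neq0 r0)); rewrite h mulr1.
  by move=> ->; rewrite mulr1.
transitivity (\int[mscale (NngNum rn0) m]_(x in sphere r) F x)%E.
  by apply: eq_measure_integral => A mA _; exact: surface_measure_scale.
by rewrite (@ge0_integral_mscale _ _ _ m _ mS (NngNum rn0) F mF F0') mE.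
Qed.

End surface_measure_theory.

(** * Discrete Laplacian and the maximum principle *)

Section one_variable.
Context {R : realType}.
Implicit Types (u du ddu : R -> R) (t h : R).

(** Rolle's theorem for [u t + u (- t) - 2 u 0 - c t ^ 2], with [c] making it vanish at
    [h], then the mean value theorem for [du]. *)
Lemma second_difference_MVT u du ddu h : 0 < h ->
  (forall t, `|t| <= h -> is_derive t 1 u (du t)) ->
  (forall t, `|t| <= h -> is_derive t 1 du (ddu t)) ->
  exists2 x, `|x| <= h & u h + u (- h) - 2 * u 0 = h ^+ 2 * ddu x.
Proof.
move=> h0 Du Ddu; set c := (u h + u (- h) - 2 * u 0) / h ^+ 2.
pose F t := u t + u (- t) - 2 * u 0 - c * t ^+ 2.
have DF t : `|t| <= h -> is_derive t 1 F (du t - du (- t) - 2 * c * t).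
  move=> th; have Du1 := Du t th.
  have Du2 : is_derive (- t) 1 u (du (- t)) by apply: Du; rewrite normrN.
  have Du3 := is_derive1_comp Du2 (is_deriveNid t 1).
  apply: is_derive_eq (_ : is_derive t 1 (u + (u \o -%R) - cst (2 * u 0) - c \*: (id ^+ 2)) _) _.
  by rewrite subr0 /= /GRing.scale/= expr1; ring.
have F0 : F 0 = 0 by rewrite /F oppr0 expr0n/=; ring.
have Fh : F h = 0 by rewrite /F /c divfK ?subrr// expf_eq0/= gt_eqF.
have itvh t : t \in `[0, h] -> `|t| <= h.
  by rewrite in_itv/= => /andP[t0 th]; rewrite ger0_norm.
have cF : {within `[0, h], continuous F}.
  by apply: derivable_within_continuous => t /itvh /DF[].
have dF t : t \in `]0, h[ -> derivable F t 1.
  by move=> th; have [] := DF t (itvh _ (subset_itv_oo_cc th)).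
have [x xh [_ Fx]] := Rolle h0 dF cF (etrans F0 (esym Fh)).
have := itvh _ (subset_itv_oo_cc xh) => /[dup] xh' /DF[_].
move: (xh); rewrite in_itv/= => /andP[x0 x_h].
rewrite Fx => /esym/eqP; rewrite subr_eq0 => /eqP e.
have itvx t : t \in `[- x, x] -> `|t| <= h.
  by rewrite in_itv/= -ler_norml => /le_trans; apply; exact: ltW.
have xx : - x < x by lra.
have [|y yx] := @MVT R du ddu (- x) x xx (fun t tx => Ddu t (itvx t (subset_itv_oo_cc tx))).
  by apply: derivable_within_continuous => t /itvx /Ddu[].
rewrite e opprK => {}e; exists y; first exact/itvx/subset_itv_oo_cc.
have cE : c = ddu y by apply: (mulIf (lt0r_neq0 x0)); lra.
by rewrite -cE /c [RHS]mulrC divfK// expf_eq0/= gt_eqF.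
Qed.

End one_variable.

Section discrete_laplacian.
Context {R : realType} {n : nat}.
Local Notation E := 'rV[R]_n.
Local Notation e i := (delta_mx ord0 i : E).
Implicit Types (v w : E -> R) (z : E).

(** Harmonicity is used through difference quotients of the Laplacian, of step
    [1 / (k + 1)]: to require that they tend to 0 is weaker than harmonicity and
    suffices for the maximum principle, and it passes under integrals by dominated
    convergence, without differentiating under them. *)
Definition dlap v z (k : nat) : R :=
  k.+1%:R ^+ 2 * \sum_i (v (z + k.+1%:R^-1 *: e i) + v (z - k.+1%:R^-1 *: e i) - 2 * v z).

Definition dharmonic v z := dlap v z @ \oo --> 0.

Lemma dlapD v w z k : dlap (fun x => v x + w x) z k = dlap v z k + dlap w z k.
Proof.
rewrite /dlap -mulrDr -big_split/=; congr (_ * _); apply: eq_bigr => i _; ring.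
Qed.

Lemma dlapZ (c : R) v z k : dlap (fun x => c * v x) z k = c * dlap v z k.
Proof.
rewrite /dlap [RHS]mulrCA; congr (_ * _); rewrite mulr_sumr; apply: eq_bigr => i _; ring.
Qed.

Lemma dharmonicD v w z : dharmonic v z -> dharmonic w z ->
  dharmonic (fun x => v x + w x) z.
Proof.
move=> hv hw; rewrite /dharmonic -(addr0 0) (_ : dlap _ _ = dlap v z \+ dlap w z).
  exact: cvgD.
by apply/funext => k; rewrite dlapD.
Qed.

Lemma dharmonicZ (c : R) v z : dharmonic v z -> dharmonic (fun x => c * v x) z.
Proof.
move=> hv; rewrite /dharmonic -(mulr0 c) (_ : dlap _ _ = fun k => c * dlap v z k).
  exact: cvgMl_tmp.
by apply/funext => k; rewrite dlapZ.
Qed.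

Lemma dharmonicB v w z : dharmonic v z -> dharmonic w z ->
  dharmonic (fun x => v x - w x) z.
Proof.
move=> hv /(dharmonicZ (-1)) hw; have := dharmonicD hv hw.
by under [X in dharmonic X]eq_fun do rewrite mulN1r.
Qed.

Section lines.
Variables (v : E -> R) (z : E) (dv ddv : 'I_n -> R -> R) (r : R).
Hypothesis r0 : 0 < r.
Hypothesis Dv : forall (i : 'I_n) (t : R), `|t| < r ->
  is_derive t (1 : R) (fun t : R => v (z + t *: e i)) (dv i t).
Hypothesis Ddv : forall i (t : R), `|t| < r -> is_derive t 1 (dv i) (ddv i t).

Lemma dlap_MVT k : k.+1%:R^-1 < r ->
  exists2 x : 'I_n -> R, (forall i, `|x i| <= k.+1%:R^-1) &
    dlap v z k = \sum_i ddv i (x i).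
Proof.
move=> kr.
have k0 : 0 < k.+1%:R^-1 :> R by rewrite invr_gt0.
have H i : exists x, `|x| <= k.+1%:R^-1 /\
    v (z + k.+1%:R^-1 *: e i) + v (z - k.+1%:R^-1 *: e i) - 2 * v z = k.+1%:R^-1 ^+ 2 * ddv i x.
  have [||x xk] := @second_difference_MVT R (fun t => v (z + t *: e i)) (dv i) (ddv i) _ k0.
  - by move=> t /le_lt_trans/(_ kr); exact: Dv.
  - by move=> t /le_lt_trans/(_ kr); exact: Ddv.
  by rewrite /= scale0r addr0 scaleNr => e; exists x.
have [x xP] := choice H; exists x => [i|]; first by have [] := xP i.
rewrite /dlap mulr_sumr; apply: eq_bigr => i _; have [_ ->] := xP i.
by rewrite exprVn mulVKf// expf_eq0/= pnatr_eq0.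
Qed.

Lemma dlap_bound M k : k.+1%:R^-1 < r ->
  (forall i t, `|t| < r -> `|ddv i t| <= M) -> `|dlap v z k| <= n%:R * M.
Proof.
move=> kr ddvM; have [x xk ->] := dlap_MVT kr.
apply: (le_trans (ler_norm_sum _ _ _)).
rewrite mulr_natl -[n in leRHS]card_ord -sumr_const; apply: ler_sum => i _.
exact/ddvM/(le_lt_trans (xk i)).
Qed.

Lemma dharmonic_lines : (forall i, {for 0, continuous (ddv i)}) ->
  \sum_i ddv i 0 = 0 -> dharmonic v z.
Proof.
move=> cdd dd0; apply/cvgrPdist_le => eps eps0.
have n0 : 0 < n.+1%:R :> R by [].
have en0 : 0 < eps / n.+1%:R by rewrite divr_gt0.
have H : \forall t \near (0 : R), forall i : 'I_n, `|ddv i 0 - ddv i t| <= eps / n.+1%:R.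
  have H1 (i : 'I_n) : \forall t \near nbhs (0 : R), `|ddv i 0 - ddv i t| <= eps / n.+1%:R.
    by have /cvgrPdist_le := cdd i; apply.
  exact: (filter_forall _ H1).
have [q /= q0 qH] := H.
have mq0 : 0 < Num.min q r by rewrite lt_min q0.
near=> k.
have kq : k.+1%:R^-1 < Num.min q r.
  by near: k; exact: near_infty_natSinv_lt (PosNum mq0).
move: kq; rewrite lt_min => /andP[kq kr].
have [x xk ->] := dlap_MVT kr.
rewrite -[X in `|X - _|]dd0 -sumrB (le_trans (ler_norm_sum _ _ _))//.
apply: (@le_trans _ _ (\sum_(i < n) eps / n.+1%:R)).
  apply: ler_sum => i _; apply: (qH (x i)) => /=.
  by rewrite sub0r normrN (le_lt_trans (xk i)).
rewrite sumr_const card_ord -[_ *+ n]mulr_natr mulrAC ler_pdivrMr// ler_pM2l//.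
by rewrite ler_nat.
Unshelve. all: by end_near. Qed.

End lines.

End discrete_laplacian.

Section maximum_principle.
Context {R : realType} {n : nat}.
Local Notation E := 'rV[R]_n.+1.
Local Notation e i := (delta_mx ord0 i : E).

Lemma normr_le_enorm (x : E) : `|x| <= enorm x.
Proof.
rewrite [leLHS]/Num.Def.normr/= mx_normrE; apply: bigmax_le; first exact: enorm_ge0.
by move=> -[i j] _ /=; rewrite (ord1 i) ler_coord_enorm.
Qed.

Lemma enorm_delta i : enorm (e i) = 1.
Proof.
apply/eqP; rewrite -(@eqrXn2 _ 2) ?enorm_ge0// enorm_sqr expr1n (bigD1 i)//= big1.
  by rewrite mxE !eqxx expr1n addr0.
by move=> j /negbTE ji; rewrite mxE ji andbF expr0n.
Qed.

Lemma enorm_sqrDZ (z : E) (t : R) i :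
  enorm (z + t *: e i) ^+ 2 = enorm z ^+ 2 + 2 * t * z ord0 i + t ^+ 2.
Proof.
rewrite !enorm_sqr (bigD1 i)//= [in RHS](bigD1 i)//= !mxE !eqxx mulr1.
rewrite (eq_bigr (fun j => z ord0 j ^+ 2)); first by ring.
by move=> j /negbTE ji; rewrite !mxE eqxx/= ji mulr0 addr0.
Qed.

Lemma dlap_enorm_sqr (z : E) k : dlap (fun x => enorm x ^+ 2) z k = 2 * n.+1%:R.
Proof.
rewrite /dlap (eq_bigr (fun=> 2 * k.+1%:R^-1 ^+ 2)) => [|i _]; last first.
  by rewrite -scaleNr !enorm_sqrDZ; ring.
rewrite sumr_const card_ord -[_ *+ n.+1]mulr_natr; field.
by rewrite addrC natr1 pnatr_eq0.
Qed.

Lemma continuous_enorm_sqr : continuous (fun x : E => enorm x ^+ 2).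
Proof.
move=> x; apply: (@continuous_comp _ _ _ (@enorm R n.+1) (fun t : R => t ^+ 2)).
  exact: continuous_enorm.
exact: exprn_continuous.
Qed.

(** For [a < 0] this is the closed ball of radius [b]. *)
Definition shell (a b : R) : set E := [set z | a <= enorm z <= b].

Lemma compact_shell a b : compact (shell a b).
Proof.
apply: bounded_closed_compact; last first.
  rewrite (_ : shell a b = @enorm R n.+1 @^-1` `[a, b]).
    apply: preimage_closed; last exact: itv_closed.
    by move=> x _; exact: continuous_enorm.
  by apply/seteqP; split => x; rewrite /shell/= in_itv.
exists b; split; first exact: num_real.
move=> M bM x /andP[_ xb].
by apply: (le_trans (normr_le_enorm x)); rewrite (le_trans xb)// ltW.
Qed.

(** At an interior maximum of [v + c |.|^2] the discrete Laplacians of small step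
    of this sum are at most 0, whereas they converge to [2 c (n + 1)]. *)
Lemma max_principle (v : E -> R) a b M :
  {within shell a b, continuous v} ->
  (forall z, a < enorm z < b -> dharmonic v z) ->
  (forall z, enorm z = a \/ enorm z = b -> v z <= M) ->
  forall z, shell a b z -> v z <= M.
Proof.
move=> cv hv bv z0 Cz0; rewrite leNgt; apply/negP => vz0.
(* [c] is so small that [w] still exceeds [M + c b ^ 2], hence all its boundary
   values, at [z0]. *)
pose c := (v z0 - M) / (2 * (b ^+ 2 + 1)).
have b1 : 0 < b ^+ 2 + 1 by rewrite ltr_wpDl// sqr_ge0.
have c0 : 0 < c by rewrite divr_gt0 ?subr_gt0// mulr_gt0.
pose w z := v z + c * enorm z ^+ 2.
have cw : {within shell a b, continuous w}.
  rewrite (_ : w = v + (fun z => c * enorm z ^+ 2))//.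
  move=> x; apply: continuousD; first exact: cv.
  apply: continuous_subspaceT => {}x.
  apply: (@continuousM R E (cst c) (fun z => enorm z ^+ 2) x).
    exact: cst_continuous.
  exact: continuous_enorm_sqr.
have [|z /set_mem Cz zmax] := EVT_max_rV _ (@compact_shell a b) cw; first by exists z0.
have {}zmax x : shell a b x -> w x <= w z by move=> Cx; apply: zmax; rewrite inE.
have wz : M + c * b ^+ 2 < w z.
  apply: lt_le_trans (zmax _ Cz0).
  have cb : c * (b ^+ 2 + 1) = (v z0 - M) / 2 by rewrite /c; field; rewrite gt_eqF.
  have : 0 <= c * enorm z0 ^+ 2 by rewrite mulr_ge0 ?sqr_ge0// ltW.
  by rewrite /w; nra.
have /andP[az zb] : a <= enorm z <= b by [].
have bz : M < v z.
  have : c * enorm z ^+ 2 <= c * b ^+ 2.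
    by rewrite ler_pM2l// ler_sqr ?nnegrE ?enorm_ge0// (le_trans (enorm_ge0 z)).
  by move: wz; rewrite /w; lra.
have zint : a < enorm z < b.
  rewrite !lt_neqAle az zb !andbT; apply/andP; split; apply/negP => /eqP h.
    by have := bv z (or_introl (esym h)); rewrite leNgt bz.
  by have := bv z (or_intror h); rewrite leNgt bz.
have oC : \forall x \near z, shell a b x.
  have zab : enorm z \in `]a, b[ by rewrite in_itv.
  have h : nbhs z (fun x => enorm x \in `]a, b[).
    exact: (@continuous_enorm R n.+1 z _ (near_in_itvoo zab)).
  apply: filterS h => x /=.
  by rewrite in_itv/= => /andP[h1 h2]; rewrite /shell/= !ltW.
have /nbhs_ballP[q /= q0 qC] := oC.
have := hv z zint => /cvgrPdist_lt /(_ (2 * c * n.+1%:R)).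
have n0 : 0 < n.+1%:R :> R by [].
have cn0 : 0 < 2 * c * n.+1%:R by rewrite mulr_gt0// mulr_gt0.
move=> /(_ cn0)[N _ NP].
near \oo => k.
have Nk : (N <= k)%N by near: k; exact: nbhs_infty_ge.
have kq : k.+1%:R^-1 < q by near: k; exact: near_infty_natSinv_lt (PosNum q0).
have k0 : 0 < k.+1%:R^-1 :> R by rewrite invr_gt0.
have /= := NP k Nk; rewrite sub0r normrN => vk.
have wk : dlap w z k <= 0.
  rewrite /dlap mulr_ge0_le0 ?exprn_ge0//; apply: sumr_le0 => i _.
  have hC (s : R) : `|s| = k.+1%:R^-1 -> w (z + s *: e i) <= w z.
    move=> sk; apply/zmax/qC; rewrite -ball_normE/= opprD addNKr normrN.
    rewrite (le_lt_trans (normr_le_enorm _))// enormZ enorm_delta mulr1.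
    by rewrite sk.
  have := hC k.+1%:R^-1 (gtr0_norm k0).
  have := hC (- k.+1%:R^-1); rewrite normrN scaleNr => /(_ (gtr0_norm k0)).
  lra.
move: wk; rewrite /w dlapD dlapZ dlap_enorm_sqr => wk.
have := ltr_normlW (_ : `|- dlap v z k| < _); rewrite normrN => /(_ _ vk); lra.
Unshelve. all: by end_near. Qed.

End maximum_principle.

Section dharmonic_integral.
Context {R : realType} {n : nat} d (T : measurableType d) (m : {measure set T -> \bar R}).
Local Notation E := 'rV[R]_n.
Variables (D : set T) (F : E -> T -> R) (z : E) (N : nat) (B : T -> R).
Local Notation e i := (delta_mx ord0 i : E).
Hypothesis mD : measurable D.
Hypothesis iF0 : m.-integrable D (EFin \o F z).
Hypothesis iF : forall k i, (N <= k)%N ->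
  m.-integrable D (EFin \o F (z + k.+1%:R^-1 *: e i)) /\
  m.-integrable D (EFin \o F (z - k.+1%:R^-1 *: e i)).
Hypothesis dF : forall x, D x -> dharmonic (F ^~ x) z.
Hypothesis iB : m.-integrable D (EFin \o B).
Hypothesis FB : forall k x, (N <= k)%N -> D x -> `|dlap (F ^~ x) z k| <= B x.

Lemma integrable_sum_EFin I (r : seq I) (f : I -> T -> R) :
  (forall i, m.-integrable D (EFin \o f i)) ->
  m.-integrable D (EFin \o (fun x => \sum_(i <- r) f i x)).
Proof.
move=> fi; rewrite (_ : _ \o _ = fun x => (\sum_(i <- r) (EFin \o f i) x)%E).
  by apply: integrable_sum => // i _; exact: fi.
by apply/funext => x /=; rewrite -sumEFin.
Qed.

Lemma Rintegral_sum I (r : seq I) (f : I -> T -> R) :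
  (forall i, m.-integrable D (EFin \o f i)) ->
  \int[m]_(x in D) (\sum_(i <- r) f i x) = \sum_(i <- r) \int[m]_(x in D) f i x.
Proof.
move=> fi; elim: r => [|i r IH].
  rewrite big_nil; under eq_Rintegral do rewrite big_nil.
  by rewrite Rintegral_cst// mul0r.
rewrite big_cons -IH -RintegralD//; last exact: integrable_sum_EFin.
by apply: eq_Rintegral => x _; rewrite big_cons.
Qed.

Lemma integrableZl_EFin (f : T -> R) (c : R) :
  m.-integrable D (EFin \o f) -> m.-integrable D (EFin \o (fun x => c * f x)).
Proof. by move=> fi; rewrite /comp; under eq_fun do rewrite EFinM; exact: integrableZl. Qed.

Lemma integrableD_EFin (f g : T -> R) : m.-integrable D (EFin \o f) ->
  m.-integrable D (EFin \o g) -> m.-integrable D (EFin \o (fun x => f x + g x)).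
Proof. by move=> fi gi; rewrite /comp; under eq_fun do rewrite EFinD; exact: integrableD. Qed.

Lemma integrableB_EFin (f g : T -> R) : m.-integrable D (EFin \o f) ->
  m.-integrable D (EFin \o g) -> m.-integrable D (EFin \o (fun x => f x - g x)).
Proof. by move=> fi gi; rewrite /comp; under eq_fun do rewrite EFinB; exact: integrableB. Qed.

Let dlap_integrable k : (N <= k)%N ->
  m.-integrable D (EFin \o (fun x => dlap (F ^~ x) z k)).
Proof.
move=> Nk; rewrite /dlap; apply: integrableZl_EFin; apply: integrable_sum_EFin => i.
have [i1 i2] := iF i Nk.
by apply: integrableB_EFin; [exact: integrableD_EFin|exact: integrableZl_EFin].
Qed.

Let dlap_integral k : (N <= k)%N ->
  dlap (fun y => \int[m]_(x in D) F y x) z k = \int[m]_(x in D) dlap (F ^~ x) z k.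
Proof.
move=> Nk; have H i : m.-integrable D (EFin \o (fun x => F (z + k.+1%:R^-1 *: e i) x +
    F (z - k.+1%:R^-1 *: e i) x - 2 * F z x)).
  have [i1 i2] := iF i Nk.
  by apply: integrableB_EFin; [exact: integrableD_EFin|exact: integrableZl_EFin].
rewrite /dlap RintegralZl//; last exact: integrable_sum_EFin.
congr (_ * _); rewrite Rintegral_sum//; apply: eq_bigr => i _.
have [i1 i2] := iF i Nk.
rewrite RintegralB//; [|exact: integrableD_EFin|exact: integrableZl_EFin].
by rewrite RintegralD// RintegralZl.
Qed.

(** A discrete Laplacian is a finite combination of values, so it commutes with the
    integral; its limit is then taken by dominated convergence. *)
Lemma dharmonic_integral : dharmonic (fun y => \int[m]_(x in D) F y x) z.
Proof.
rewrite /dharmonic -(cvg_shiftn N).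
rewrite (_ : (fun k => _) = fun k => \int[m]_(x in D) dlap (F ^~ x) z (k + N)); last first.
  by apply/funext => k; rewrite dlap_integral// leq_addl.
have [] := @dominated_convergence _ _ _ m D mD (fun k x => (dlap (F ^~ x) z (k + N))%:E)
  (cst 0%E) (EFin \o B).
- by move=> k; have /integrableP[] := dlap_integrable (leq_addl k N).
- exact: measurable_cst.
- apply: aeW => x Dx; apply: cvg_EFin; first exact: nearW.
  by have := dF Dx; rewrite /dharmonic -(cvg_shiftn N).
- exact: iB.
- by apply: aeW => x k Dx; rewrite lee_fin; apply: FB => //; exact: leq_addl.
move=> _ _; rewrite integral0 => h.
by apply: fine_cvg; exact: h.
Qed.

End dharmonic_integral.

(** * The Poisson kernel *)

Section enorm_triangle.
Context {R : realType} {n : nat}.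
Local Notation E := 'rV[R]_n.
Implicit Types x y z : E.

Lemma CauchySchwarz_rV x y :
  \sum_i x ord0 i * y ord0 i <= enorm x * enorm y.
Proof.
have [x0|x0] := eqVneq (enorm x) 0.
  by rewrite x0 mul0r (enorm_eq0 x0) big1// => i _; rewrite mxE mul0r.
have [y0|y0] := eqVneq (enorm y) 0.
  by rewrite y0 mulr0 (enorm_eq0 y0) big1// => i _; rewrite mxE mulr0.
have xy0 : 0 < enorm x * enorm y by rewrite mulr_gt0// lt0r ?x0 ?y0 enorm_ge0.
have : 0 <= \sum_i (enorm y * x ord0 i - enorm x * y ord0 i) ^+ 2.
  by apply: sumr_ge0 => i _; rewrite sqr_ge0.
rewrite (eq_bigr (fun i => enorm y ^+ 2 * x ord0 i ^+ 2 + enorm x ^+ 2 * y ord0 i ^+ 2 -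
  2 * (enorm x * enorm y) * (x ord0 i * y ord0 i))); last by move=> i _; ring.
rewrite sumrB big_split/= -!mulr_sumr -!enorm_sqr => h.
rewrite -(ler_pM2l xy0) -subr_ge0.
by rewrite -(pmulr_rge0 _ (ltr0n R 2)); move: h; congr (0 <= _); ring.
Qed.

Lemma enormD x y : enorm (x + y) <= enorm x + enorm y.
Proof.
rewrite -ler_sqr ?nnegrE ?addr_ge0 ?enorm_ge0// enorm_sqr.
rewrite (eq_bigr (fun i => x ord0 i ^+ 2 + y ord0 i ^+ 2 + 2 * (x ord0 i * y ord0 i))).
  rewrite !big_split/= -!enorm_sqr -mulr_sumr.
  by have := CauchySchwarz_rV x y; rewrite sqrrD -mulr_natl; lra.
by move=> i _; rewrite mxE; ring.
Qed.

Lemma enormN x : enorm (- x) = enorm x.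
Proof. by rewrite -scaleN1r enormZ normrN1 mul1r. Qed.

Lemma enormBC x y : enorm (x - y) = enorm (y - x).
Proof. by rewrite -opprB enormN. Qed.

Lemma enormB_ge x y : enorm x - enorm y <= enorm (x - y).
Proof. by rewrite lerBlDr -{1}[x](subrK y) enormD. Qed.

Lemma ler_dist_enorm x y : `|enorm x - enorm y| <= enorm (x - y).
Proof. by rewrite ler_norml lerNl opprB {1}enormBC !enormB_ge. Qed.

Lemma enormB_sqr x y :
  enorm (x - y) ^+ 2 = enorm x ^+ 2 + enorm y ^+ 2 - 2 * \sum_i x ord0 i * y ord0 i.
Proof.
rewrite !enorm_sqr mulr_sumr -sumrN -!big_split/=; apply: eq_bigr => i _.
by rewrite !mxE; ring.
Qed.

End enorm_triangle.

Section inverse_powers.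
Context {R : realType}.

(** The derivative of a negative power of the distance [sqrt (s + 2 b t + t ^ 2)]
    to a fixed point, along a line; the exponent grows by 2 instead of 1, which
    keeps the family of these powers stable under derivation. *)
Lemma is_derive_dist_line (s b t : R) m : 0 < s + 2 * b * t + t ^+ 2 ->
  is_derive t (1 : R) (fun t : R => Num.sqrt (s + 2 * b * t + t ^+ 2) ^- m)
    (- m%:R * (b + t) * Num.sqrt (s + 2 * b * t + t ^+ 2) ^- m.+2).
Proof.
move=> q0; set q := fun t : R => s + 2 * b * t + t ^+ 2.
have Dq : is_derive t (1 : R) q (2 * (b + t)).
  have D1 := is_derive_id t (1 : R).
  have D2 := is_deriveD (is_deriveD (is_derive_cst s t (1 : R)) (is_deriveZ (2 * b) D1))
    (is_deriveX 2 D1).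
  apply: is_derive_eq D2 _.
  by rewrite add0r /GRing.scale/= expr1; ring.
have r0 : 0 < Num.sqrt (q t) by rewrite sqrtr_gt0.
have Ds : is_derive t (1 : R) (Num.sqrt \o q) ((2 * Num.sqrt (q t))^-1 * (2 * (b + t))).
  exact: (@is_derive1_comp R Num.sqrt q t _ _ (is_derive1_sqrt q0) Dq).
have := is_deriveX m Ds; rewrite exprfctE => Dx.
have nz : Num.sqrt (q t) ^+ m != 0 by rewrite expf_eq0 negb_and (gt_eqF r0) orbT.
have Dv := @is_deriveV R (fun x => Num.sqrt (q x) ^+ m) t _ 1 nz Dx.
apply: is_derive_eq Dv _.
rewrite -/(q t) /= /GRing.scale/=; set a := Num.sqrt (q t) in r0 *.
case: m {Dx nz} => [|m]; first by rewrite !mul0r mulr0 oppr0 !mul0r.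
rewrite !exprS /= invfM; field.
by rewrite !expf_eq0 (gt_eqF r0) !andbF.
Qed.

Lemma ler_exprVn (a r : R) m : 0 < r -> r <= a -> a ^- m <= r ^- m.
Proof.
move=> r0 ra; have a0 := lt_le_trans r0 ra.
by rewrite lef_pV2 ?posrE ?exprn_gt0// lerXn2r// nnegrE ltW.
Qed.

Lemma ler_dist_exprVn (r a b : R) m : 0 < r -> r <= a -> r <= b ->
  `|a ^- m - b ^- m| <= m%:R * r ^- m.+1 * `|a - b|.
Proof.
move=> r0 ra rb; have a0 := lt_le_trans r0 ra; have b0 := lt_le_trans r0 rb.
elim: m => [|m IH]; first by rewrite subrr normr0 !mul0r.
have -> : a ^- m.+1 - b ^- m.+1 = a^-1 * (a ^- m - b ^- m) + b ^- m * (a^-1 * b^-1) * (b - a).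
  by rewrite !exprS; field; rewrite !expf_eq0 !gt_eqF// !andbF.
rewrite (le_trans (ler_normD _ _))// !normrM (distrC b).
rewrite (_ : _%:R * _ * _ = r^-1 * (m%:R * r ^- m.+1 * `|a - b|) + r ^- m * (r^-1 * r^-1) * `|a - b|); last first.
  by rewrite !exprS -natr1; field; rewrite !expf_eq0 !gt_eqF// !andbF.
have av : `|a^-1| <= r^-1 by rewrite gtr0_norm ?invr_gt0// lef_pV2.
have bv : `|b^-1| <= r^-1 by rewrite gtr0_norm ?invr_gt0// lef_pV2.
have bm : `|b ^- m| <= r ^- m by rewrite gtr0_norm ?invr_gt0 ?exprn_gt0// ler_exprVn.
apply: lerD; first by rewrite ler_pM.
by rewrite ler_wpM2r// !ler_pM// mulr_ge0.
Qed.

End inverse_powers.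

Section poisson_kernel.
Context {R : realType} (d : nat).
Local Notation E := 'rV[R]_d.+1.
Local Notation e i := (delta_mx ord0 i : E).
Implicit Types x z y : E.

(** The Poisson kernel of the unit ball, up to the area of the sphere. *)
Definition poisson z y : R := (1 - enorm z ^+ 2) * enorm (z - y) ^- d.+1.

Lemma is_derive_enorm_line x i (t : R) m : 0 < enorm (x + t *: e i) ->
  is_derive t (1 : R) (fun t : R => enorm (x + t *: e i) ^- m)
    (- m%:R * (x ord0 i + t) * enorm (x + t *: e i) ^- m.+2).
Proof.
have dE (u : R) : enorm (x + u *: e i) =
    Num.sqrt (enorm x ^+ 2 + 2 * x ord0 i * u + u ^+ 2).
  rewrite -[LHS]ger0_norm ?enorm_ge0// -sqrtr_sqr enorm_sqrDZ.
  by congr (Num.sqrt (_ + _ + _)); ring.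
by under [X in is_derive _ _ X]eq_fun do rewrite dE; rewrite dE sqrtr_gt0; exact: is_derive_dist_line.
Qed.

Section line.
Variables (z y : E).
Local Notation b i := (z ord0 i - y ord0 i).
Local Notation A i t := (1 - enorm z ^+ 2 - 2 * z ord0 i * t - t ^+ 2).
Local Notation N i m t := (enorm (z - y + t *: e i) ^- m).

(** The first two derivatives of the kernel along a coordinate line are written out
    so that they can be bounded uniformly in [y]. *)
Definition d_poisson i (t : R) : R :=
  - 2 * (z ord0 i + t) * N i d.+1 t - d.+1%:R * A i t * (b i + t) * N i d.+3 t.

Definition dd_poisson i (t : R) : R :=
  - 2 * N i d.+1 t + 4 * d.+1%:R * (z ord0 i + t) * (b i + t) * N i d.+3 t
  - d.+1%:R * A i t * N i d.+3 t
  + d.+1%:R * d.+3%:R * A i t * (b i + t) ^+ 2 * N i d.+1.+4 t.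

Let dN i m (t : R) : 0 < enorm (z - y + t *: e i) ->
  is_derive t (1 : R) (fun t => N i m t) (- m%:R * (b i + t) * N i m.+2 t).
Proof.
move=> h; have := @is_derive_enorm_line (z - y) i t m h.
by rewrite !mxE.
Qed.

Let dA i (t : R) : is_derive t (1 : R) (fun t => A i t) (- 2 * (z ord0 i + t)).
Proof.
have D1 := is_derive_id t (1 : R).
have D2 := is_deriveB (is_deriveB (is_derive_cst (1 - enorm z ^+ 2) t (1 : R))
   (is_deriveZ (2 * z ord0 i) D1)) (is_deriveX 2 D1).
by apply: is_derive_eq D2 _; rewrite sub0r /GRing.scale/= expr1; ring.
Qed.

Let daff (c t : R) : is_derive t (1 : R) (fun t => c + t) 1.
Proof.
have D := is_deriveD (is_derive_cst c t (1 : R)) (is_derive_id t (1 : R)).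
by apply: is_derive_eq D _; rewrite add0r.
Qed.

Lemma is_derive_poisson_line i (t : R) : 0 < enorm (z - y + t *: e i) ->
  is_derive t (1 : R) (fun t : R => poisson (z + t *: e i) y) (d_poisson i t).
Proof.
move=> h; have D := is_deriveM (dA i t) (@dN i d.+1 t h).
rewrite (_ : (fun _ => _) = (fun t => A i t) * (fun t => N i d.+1 t)); last first.
  apply/funext => u; rewrite /poisson (addrAC z) enorm_sqrDZ fctE.
  by congr (_ * _); ring.
by apply: is_derive_eq D _; rewrite /GRing.scale/= /d_poisson; ring.
Qed.

Lemma is_derive2_poisson_line i (t : R) : 0 < enorm (z - y + t *: e i) ->
  is_derive t (1 : R) (d_poisson i) (dd_poisson i t).
Proof.
move=> h.
have D1 := is_deriveM (is_deriveZ (- 2) (daff (z ord0 i) t)) (@dN i d.+1 t h).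
have D2 := is_deriveM (is_deriveM (is_deriveZ d.+1%:R (dA i t)) (daff (b i) t)) (@dN i d.+3 t h).
apply: is_derive_eq (is_deriveB D1 D2) _.
by rewrite /GRing.scale/= /dd_poisson !fctE /= /GRing.scale/=; ring.
Qed.

(** The Poisson kernel is harmonic in [z] because [y] lies on the unit sphere. *)
Lemma sum_dd_poisson : enorm y = 1 -> 0 < enorm (z - y) -> \sum_i dd_poisson i 0 = 0.
Proof.
move=> y1 h; set s := enorm (z - y) in h.
have NE i m : N i m 0 = s ^- m by rewrite scale0r addr0.
have zb : 2 * (\sum_i z ord0 i * b i) = enorm z ^+ 2 + s ^+ 2 - 1.
  rewrite /s enormB_sqr y1.
  under eq_bigr do rewrite mulrBr.
  by rewrite sumrB enorm_sqr; under eq_bigr do rewrite -expr2; ring.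
have bb : \sum_i b i ^+ 2 = s ^+ 2.
  by rewrite /s enorm_sqr; apply: eq_bigr => i _; rewrite !mxE.
have [c0 c0E] : exists c, c = - 2 * s ^- d.+1 - d.+1%:R * (1 - enorm z ^+ 2) * s ^- d.+3.
  by eexists.
rewrite (eq_bigr (fun i => c0 +
   4 * d.+1%:R * s ^- d.+3 * (z ord0 i * b i) +
   d.+1%:R * d.+3%:R * (1 - enorm z ^+ 2) * s ^- d.+1.+4 * b i ^+ 2)); last first.
  by move=> i _; rewrite c0E /dd_poisson !NE; ring.
rewrite !big_split/= -!mulr_sumr bb sumr_const card_ord -[_ *+ d.+1]mulr_natr c0E.
have -> : \sum_i z ord0 i * b i = (enorm z ^+ 2 + s ^+ 2 - 1) / 2.
  by rewrite -zb; field.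
have -> : s ^- d.+1 = s ^+ 2 * s ^- d.+3 by rewrite !exprS; field; rewrite expf_eq0 (gt_eqF h) andbF.
have -> : s ^- d.+1.+4 = s ^- 2 * s ^- d.+3 by rewrite !exprS; field; rewrite expf_eq0 (gt_eqF h) andbF.
rewrite (_ : d.+3%:R = d.+1%:R + 2 :> R); last by rewrite -natrD addn2.
set u := s ^- d.+3; set k := d.+1%:R; field; exact: lt0r_neq0.
Qed.

Lemma dd_poisson_bound (r : R) i (t : R) : 0 < r -> enorm y = 1 ->
  r <= enorm (z - y + t *: e i) -> `|t| <= r ->
  `|dd_poisson i t| <= 2 * r ^- d.+1 + 4 * d.+1%:R * (enorm z + r) * (enorm z + 1 + r) * r ^- d.+3
     + d.+1%:R * (1 + (enorm z + r) ^+ 2) * r ^- d.+3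
     + d.+1%:R * d.+3%:R * (1 + (enorm z + r) ^+ 2) * (enorm z + 1 + r) ^+ 2 * r ^- d.+1.+4.
Proof.
move=> r0 y1 rh tr; have r0' := ltW r0.
have zt : `|z ord0 i + t| <= enorm z + r.
  by rewrite (le_trans (ler_normD _ _))// lerD// ler_coord_enorm.
have bt : `|b i + t| <= enorm z + 1 + r.
  rewrite (le_trans (ler_normD _ _))// lerD// (le_trans (ler_normB _ _))//.
  by rewrite lerD ?ler_coord_enorm// -y1 ler_coord_enorm.
have At : `|A i t| <= 1 + (enorm z + r) ^+ 2.
  have -> : A i t = 1 - enorm (z + t *: e i) ^+ 2 by rewrite enorm_sqrDZ; ring.
  rewrite (le_trans (ler_normB _ _))// normr1 lerD2l ger0_norm ?sqr_ge0//.
  rewrite ler_sqr ?nnegrE ?addr_ge0 ?enorm_ge0//.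
  by rewrite (le_trans (enormD _ _))// lerD2l enormZ enorm_delta mulr1.
have Nt m : `|N i m t| <= r ^- m.
  by rewrite ger0_norm ?invr_ge0 ?exprn_ge0 ?enorm_ge0// ler_exprVn.
have z0 := enorm_ge0 z.
have k1 : `|d.+1%:R| <= d.+1%:R :> R by rewrite normr_nat.
have k3 : `|d.+3%:R| <= d.+3%:R :> R by rewrite normr_nat.
have n4 : `|4| <= 4 :> R by rewrite normr_nat.
have n2 : `|- 2| <= 2 :> R by rewrite normrN normr_nat.
have b2 : `|(b i + t) ^+ 2| <= (enorm z + 1 + r) ^+ 2.
  by rewrite normrX lerXn2r ?nnegrE// ?addr_ge0.
rewrite /dd_poisson (le_trans (ler_normD _ _))// lerD//; last first.
  by rewrite !normrM; repeat (apply: ler_pM; rewrite ?mulr_ge0//).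
rewrite (le_trans (ler_normB _ _))// lerD//; last first.
  by rewrite !normrM; repeat (apply: ler_pM; rewrite ?mulr_ge0//).
rewrite (le_trans (ler_normD _ _))// lerD//.
  by rewrite !normrM; repeat (apply: ler_pM; rewrite ?mulr_ge0//).
by rewrite !normrM; repeat (apply: ler_pM; rewrite ?mulr_ge0//).
Qed.

Lemma continuous_dd_poisson i : 0 < enorm (z - y) -> {for 0, continuous (dd_poisson i)}.
Proof.
move=> h; have h0 : 0 < enorm (z - y + 0 *: e i) by rewrite scale0r addr0.
have cont (f : R -> R) (l : R) : is_derive (0 : R) (1 : R) f l -> {for 0, continuous f}.
  by move=> [? _]; apply/differentiable_continuous/derivable1_diffP.
have cN m := cont _ _ (@dN i m 0 h0).
have cA := cont _ _ (dA i 0).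
have cz := cont _ _ (daff (z ord0 i) 0).
have cb := cont _ _ (daff (b i) 0).
have cc (c : R) : {for 0, continuous (cst c : R -> R)} by exact: cst_continuous.
have cM (f g : R -> R) : {for 0, continuous f} -> {for 0, continuous g} ->
    {for 0, continuous (fun t => f t * g t)}.
  by move=> hf hg; exact: (@continuousM R R f g 0 hf hg).
have cD (f g : R -> R) : {for 0, continuous f} -> {for 0, continuous g} ->
    {for 0, continuous (fun t => f t + g t)}.
  by move=> hf hg; exact: (@continuousD R R R f g 0 hf hg).
have cBB (f g : R -> R) : {for 0, continuous f} -> {for 0, continuous g} ->
    {for 0, continuous (fun t => f t - g t)}.
  by move=> hf hg; exact: (@continuousB R R R f g 0 hf hg).
have cA' := cM _ _ (cc d.+1%:R) cA.
apply: (cD _ _ (cBB _ _ (cD _ _ (cM _ _ (cc (- 2)) (cN d.+1)) (cM _ _ (cM _ _ (cM _ _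
  (cc (4 * d.+1%:R)) cz) cb) (cN d.+3))) (cM _ _ cA' (cN d.+3)))).
exact: (cM _ _ (cM _ _ (cM _ _ (cc (d.+1%:R * d.+3%:R)) cA) (cM _ _ cb cb)) (cN d.+1.+4)).
Qed.

End line.

Lemma poisson_line_ge z y i (t : R) : enorm y = 1 ->
  `|t| <= `|enorm z - 1| / 2 -> `|enorm z - 1| / 2 <= enorm (z - y + t *: e i).
Proof.
move=> y1 tr; have := ler_dist_enorm z y; rewrite y1 => h1.
have := enormB_ge (z - y) (- (t *: e i)); rewrite opprK enormN enormZ enorm_delta mulr1.
lra.
Qed.

Lemma dharmonic_poisson z y : enorm y = 1 -> enorm z != 1 -> dharmonic (poisson ^~ y) z.
Proof.
move=> y1 z1; set r := `|enorm z - 1| / 2.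
have r0 : 0 < r by rewrite divr_gt0// normr_gt0 subr_eq0.
have h0 i (t : R) : `|t| < r -> 0 < enorm (z - y + t *: e i).
  by move=> /ltW tr; apply: (lt_le_trans r0); exact: poisson_line_ge.
have zy : 0 < enorm (z - y).
  by rewrite (lt_le_trans _ (ler_dist_enorm z y))// y1 normr_gt0 subr_eq0.
apply: (dharmonic_lines (dv := d_poisson z y) (ddv := dd_poisson z y) r0).
- by move=> i t tr; apply: is_derive_poisson_line; exact: h0.
- by move=> i t tr; apply: is_derive2_poisson_line; exact: h0.
- by move=> i; exact: continuous_dd_poisson.
- exact: sum_dd_poisson.
Qed.

Lemma dlap_poisson_bound z : enorm z != 1 -> exists N M, forall k y,
  (N <= k)%N -> enorm y = 1 -> `|dlap (poisson ^~ y) z k| <= M.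
Proof.
move=> z1; set r := `|enorm z - 1| / 2.
have r0 : 0 < r by rewrite divr_gt0// normr_gt0 subr_eq0.
have [N _ NP] := near_infty_natSinv_lt (PosNum r0).
exists N; eexists => k y Nk y1.
have h0 i (t : R) : `|t| < r -> r <= enorm (z - y + t *: e i).
  by move=> /ltW tr; exact: poisson_line_ge.
apply: (@dlap_bound _ _ _ _ (d_poisson z y) (dd_poisson z y) r).
- by move=> i t /(h0 i) h; apply: is_derive_poisson_line; exact: (lt_le_trans r0 h).
- by move=> i t /(h0 i) h; apply: is_derive2_poisson_line; exact: (lt_le_trans r0 h).
- exact: NP.
- by move=> i t tr; apply: (dd_poisson_bound (r := r)) => //; [exact: h0|exact: ltW].
Qed.

Lemma poisson_lipschitz z (r : R) : 0 < r -> exists M, forall z' y, enorm y = 1 ->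
  enorm (z - z') <= 1 -> r <= enorm (z - y) -> r <= enorm (z' - y) ->
  `|poisson z y - poisson z' y| <= M * enorm (z - z').
Proof.
move=> r0; pose L := enorm z + 1; exists (2 * L * r ^- d.+1 + (1 + L ^+ 2) * (d.+1%:R * r ^- d.+2)).
move=> z' y y1 zz' rz rz'; have z0 := enorm_ge0 z; have z'0 := enorm_ge0 z'.
have d0 := enorm_ge0 (z - z').
have z'L : enorm z' <= L by have := enormB_ge z' z; rewrite enormBC /L; lra.
have -> : poisson z y - poisson z' y =
    (enorm z' + enorm z) * (enorm z' - enorm z) * enorm (z - y) ^- d.+1 +
    (1 - enorm z' ^+ 2) * (enorm (z - y) ^- d.+1 - enorm (z' - y) ^- d.+1).
  by rewrite /poisson; ring.
rewrite (le_trans (ler_normD _ _))// [leRHS]mulrDl lerD//.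
  rewrite !normrM -[leRHS]mulrA (mulrC _ (enorm (z - z'))) mulrA.
  rewrite !ler_pM ?mulr_ge0//.
  - by rewrite ger0_norm ?addr_ge0// /L in z'L *; lra.
  - by rewrite distrC ler_dist_enorm.
  - by rewrite ger0_norm ?invr_ge0 ?exprn_ge0 ?enorm_ge0// ler_exprVn.
rewrite normrM -mulrA ler_pM//.
  rewrite (le_trans (ler_normB _ _))// normr1 lerD2l ger0_norm ?sqr_ge0//.
  by rewrite lerXn2r ?nnegrE// addr_ge0.
rewrite (le_trans (ler_dist_exprVn d.+1 r0 rz rz'))// ler_wpM2l//.
  by rewrite mulr_ge0// invr_ge0 exprn_ge0// ltW.
by rewrite (le_trans (ler_dist_enorm _ _))// opprB addrA subrK.
Qed.

Lemma poisson_bound z y : enorm y = 1 -> enorm z != 1 ->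
  `|poisson z y| <= (1 + enorm z ^+ 2) * `|enorm z - 1| ^- d.+1.
Proof.
move=> y1 z1; rewrite normrM ler_pM//.
  by rewrite (le_trans (ler_normB _ _))// normr1 lerD2l ger0_norm ?sqr_ge0.
rewrite ger0_norm ?invr_ge0 ?exprn_ge0 ?enorm_ge0// ler_exprVn//.
  by rewrite normr_gt0 subr_eq0.
by rewrite -y1 ler_dist_enorm.
Qed.

Lemma measurable_enormVn n m : measurable_fun setT (fun x : 'rV[R]_n => enorm x ^- m).
Proof.
under eq_fun do rewrite -exprVn -powR_inv1 ?enorm_ge0//.
apply: measurable_funX; apply: (measurableT_comp (measurable_powR _)).
exact: measurable_enorm.
Qed.

Lemma measurable_dist_Vn z m : measurable_fun setT (fun y : E => enorm (z - y) ^- m).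
Proof.
under eq_fun do rewrite enormBC.
apply: (measurableT_comp (@measurable_enormVn d.+1 m)).
exact: measurable_addrV.
Qed.

Lemma measurable_poisson z : measurable_fun setT (poisson z).
Proof. by apply: measurable_funM => //; exact: measurable_dist_Vn. Qed.

End poisson_kernel.

(** * The Poisson integral *)

Section poisson_integral.
Context {R : realType} (d : nat).
Local Notation E := 'rV[R]_d.+1.
Local Notation S := (sphere 1 : set E).
Local Notation sigma := (@surface_measure R d.+1 1).
Local Notation e i := (delta_mx ord0 i : E).
Local Notation omega := (@sphere_area R d).

Lemma integrable_sphere (m : {finite_measure set E -> \bar R}) (r : R) (h : E -> R) (M : R) :
  measurable_fun (sphere r) h -> (forall y, sphere r y -> `|h y| <= M) ->
  m.-integrable (sphere r) (EFin \o h).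
Proof.
move=> mh hM; apply: measurable_bounded_integrable => //.
- exact: measurable_sphere.
- by rewrite ltey_eq fin_num_measure//; exact: measurable_sphere.
- exists M; split; first exact: num_real.
  by move=> x Mx y Sy; apply: (le_trans (hM y Sy)); exact: ltW.
Qed.

Lemma sphere_area_ge0 : 0 <= omega.
Proof. by rewrite fine_ge0. Qed.

Lemma Rintegral_sphere_le (h k : E -> R) (M : R) :
  measurable_fun S h -> measurable_fun S k -> (forall y, S y -> `|k y| <= M) ->
  (forall y, S y -> `|h y| <= k y) ->
  `|\int[sigma]_(y in S) h y| <= \int[sigma]_(y in S) k y.
Proof.
move=> mh mk kM hk; have mS := @measurable_sphere R d.+1 1.
have ik := @integrable_sphere sigma 1 k M mk kM.
have ih : sigma.-integrable S (EFin \o h).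
  apply: (@integrable_sphere sigma 1 h M) => // y Sy.
  by rewrite (le_trans (hk y Sy))// (le_trans (ler_norm _))// kM.
rewrite (le_trans (le_normr_Rintegral _ _))// le_Rintegral//.
have /integrable_abse := ih; by rewrite /comp/=.
Qed.

Section bounded_density.
Variables (g : E -> R) (G : R).
Hypothesis mg : measurable_fun S g.
Hypothesis gG : forall y, S y -> `|g y| <= G.

Definition poisson_integral (z : E) : R := \int[sigma]_(y in S) (poisson z y * g y).

Let mPg z : measurable_fun S (fun y => poisson z y * g y).
Proof. by apply: measurable_funM => //; apply: measurable_funTS; exact: measurable_poisson. Qed.

Let G0 : 0 <= G.
Proof. by apply: le_trans (gG (_ : S (e ord0))) => //; exact: enorm_delta. Qed.

Lemma integrable_poisson z : enorm z != 1 ->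
  sigma.-integrable S (EFin \o (fun y => poisson z y * g y)).
Proof.
move=> z1; apply: (@integrable_sphere sigma 1 _ ((1 + enorm z ^+ 2) * `|enorm z - 1| ^- d.+1 * G)) => //.
by move=> y Sy; rewrite normrM ler_pM// ?poisson_bound// gG.
Qed.

Lemma dharmonic_poisson_integral z : enorm z != 1 -> dharmonic poisson_integral z.
Proof.
move=> z1; have [N1 [M HM]] := dlap_poisson_bound z1.
have oz : \forall x \near z, enorm x != 1.
  pose U := [set t : R | t != 1].
  have oU : nbhs (enorm z) U by apply: open_nbhs_nbhs; split => //; exact: open_neq.
  exact: (@continuous_enorm R d.+1 z _ oU).
have /nbhs_ballP[q /= q0 qC] := oz.
have [N2 _ N2q] := near_infty_natSinv_lt (PosNum q0).
have near_z k i (s : R) : (N2 <= k)%N -> `|s| = k.+1%:R^-1 -> enorm (z + s *: e i) != 1.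
  move=> N2k sk; apply: qC; rewrite -ball_normE/= opprD addNKr normrN.
  rewrite (le_lt_trans (normr_le_enorm _))// enormZ enorm_delta mulr1 sk.
  exact: N2q.
have k0 k : 0 < k.+1%:R^-1 :> R by rewrite invr_gt0.
apply: (@dharmonic_integral _ _ _ _ sigma S _ z (maxn N1 N2) (cst (M * G))).
- exact: measurable_sphere.
- exact: integrable_poisson.
- move=> k i; rewrite geq_max => /andP[_ k2]; split.
    by apply/integrable_poisson/(near_z k) => //; rewrite gtr0_norm.
  rewrite -scaleNr.
  by apply/integrable_poisson/(near_z k) => //; rewrite normrN gtr0_norm.
- move=> y Sy; have := dharmonicZ (g y) (dharmonic_poisson Sy z1).
  by under [X in dharmonic X]eq_fun do rewrite mulrC.
- by apply: (@integrable_sphere sigma 1 _ `|M * G|).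
- move=> k y; rewrite geq_max => /andP[k1 _] Sy.
  under [X in dlap X]eq_fun do rewrite mulrC.
  by rewrite dlapZ normrM mulrC ler_pM// ?gG// HM.
Qed.

Lemma continuous_poisson_integral z : enorm z != 1 ->
  {for z, continuous poisson_integral}.
Proof.
move=> z1; set r := `|enorm z - 1| / 2.
have r0 : 0 < r by rewrite divr_gt0// normr_gt0 subr_eq0.
have [M HM] := @poisson_lipschitz R d z r r0.
pose C := `|M| * G * fine (sigma S) + 1.
have lip z' : enorm (z - z') <= Num.min 1 r ->
    `|poisson_integral z - poisson_integral z'| <= C * enorm (z - z').
  rewrite le_min => /andP[zz1 zzr].
  have z'1 : enorm z' != 1.
    apply/eqP => z'1; have := ler_dist_enorm z z'; rewrite z'1 => h.
    by move: zzr r0; rewrite /r; lra.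
  rewrite /poisson_integral -RintegralB//; first last.
  - exact: integrable_poisson.
  - exact: integrable_poisson.
  - exact: measurable_sphere.
  apply: (@le_trans _ _ (\int[sigma]_(y in S) (`|M| * enorm (z - z') * G))).
    apply: (@Rintegral_sphere_le _ _ (`|M| * enorm (z - z') * G)) => //.
    - by apply: measurable_funB; exact: mPg.
    - move=> y Sy; by rewrite ger0_norm// !mulr_ge0 ?enorm_ge0.
    - move=> y Sy; rewrite -mulrBl normrM ler_pM// ?gG//.
      have zy : 2 * r <= enorm (z - y).
        by have := ler_dist_enorm z y; rewrite (Sy : enorm y = 1) /r; lra.
      apply: (le_trans (HM z' y Sy zz1 _ _)); first by lra.
        by have := enormD (z - z') (z' - y); rewrite subrKA; lra.
      by rewrite ler_wpM2r ?enorm_ge0// ler_norm.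
  rewrite Rintegral_cst; last exact: measurable_sphere.
  rewrite /C mulrDl mul1r -[leLHS]addr0 lerD ?enorm_ge0//.
  by rewrite le_eqVlt; apply/orP; left; apply/eqP; ring.
have C0 : 0 < C by rewrite /C ltr_wpDl// !mulr_ge0 ?fine_ge0.
apply/cvgrPdist_lt; first exact: (nbhs_filter z).
move=> eps eps0.
have m0 : 0 < Num.min (Num.min 1 r) (eps / C) by rewrite !lt_min r0 ltr01 divr_gt0.
have cz : nbhs z (fun z' => enorm (z - z') < Num.min (Num.min 1 r) (eps / C)).
  have c1 : {for z, continuous (fun z' : E => enorm (z - z'))}.
    apply: (@continuous_comp _ _ _ (fun z' : E => z - z') (@enorm R d.+1)).
      by apply: (@continuousB _ _ _ (cst z) id); [exact: cst_continuous|].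
    exact: continuous_enorm.
  have := c1 (fun t : R => t < Num.min (Num.min 1 r) (eps / C)); apply.
  by apply: lt_nbhsl; rewrite subrr enorm0.
apply: filterS cz => z'; rewrite lt_min => /andP[h1 h2].
by rewrite (le_lt_trans (lip z' (ltW h1)))// -ltr_pdivlMl// mulrC.
Qed.

End bounded_density.

End poisson_integral.

(** * Poisson's formula *)

Section compact_continuity.
Context {R : realType} {n : nat}.
Local Notation E := 'rV[R]_n.+1.

Lemma within_continuous_measurable (A : set E) (f : E -> R) :
  measurable A -> {within A, continuous f} -> measurable_fun A f.
Proof.
move=> mA /continuousP cf; apply: (measurability _ (RGenOpens.measurableE R)).
move=> _ [_ [a [b ->] <-]].
have /open_subspaceP[V oV VA] : open (f @^-1` `]a, b[ : set (subspace A)).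
  exact/cf/interval_open.
rewrite setIC -VA.
by apply: measurableI => //; exact: open_measurable_rV.
Qed.

Lemma within_continuous_comp (A B : set E) (f : E -> R) (g : E -> E) :
  {within A, continuous f} -> continuous g -> (forall x, B x -> A (g x)) ->
  {within B, continuous (f \o g)}.
Proof.
move=> /subspace_continuousP cf cg BA; apply/subspace_continuousP => x Bx.
move=> U /(cf (g x) (BA x Bx)) fU.
have h : nbhs x (fun y => A (g y) -> U (f (g y))) := cg x _ fU.
suff : nbhs x (fun y => B y -> U (f (g y))) by [].
by apply: filterS h => y h By; exact/h/BA.
Qed.

Lemma compact_unif_continuous (K : set E) (f : E -> R) (eps : R) :
  compact K -> {within K, continuous f} -> 0 < eps ->
  exists2 q, 0 < q & forall x y, K x -> K y -> enorm (x - y) < q -> `|f x - f y| < eps.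
Proof.
move=> /compact_near_coveringP cK /subspace_continuousP cf eps0.
pose P (q : R) x := K x -> forall y, K y -> enorm (x - y) < q -> `|f x - f y| < eps.
have : \forall q \near 0^'+, K `<=` P q.
  apply: cK => x Kx; have e20 : 0 < eps / 2 by rewrite divr_gt0.
  have /cvgrPdist_lt/(_ _ e20) := cf x Kx.
  rewrite near_withinE => /nbhs_ballP[r /= r0 rP].
  have r20 : 0 < r / 2 by rewrite divr_gt0.
  exists (ball x (r / 2), [set q | q < r / 2]) => /=.
    split; first exact: nbhsx_ballx.
    exact: nbhs_right_lt.
  move=> [x' q] [/= xx' qr] Kx' y Ky x'y.
  have h1 : `|f x - f x'| < eps / 2.
    by apply: rP => //; apply: le_ball xx'; lra.
  have h2 : `|f x - f y| < eps / 2.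
    apply: rP => //; rewrite [r]splitr; apply: ball_triangle xx' _.
    rewrite -ball_normE/=; apply: (lt_trans _ qr); apply: le_lt_trans x'y.
    exact: normr_le_enorm.
  rewrite (_ : f x' - f y = (f x - f y) - (f x - f x')); last by ring.
  by rewrite (le_lt_trans (ler_normB _ _))// [eps]splitr ltrD.
move=> [q /= q0 qP]; exists (q / 2); first by rewrite divr_gt0.
move=> x y Kx Ky xy; apply: (qP (q / 2)) => //=; last by rewrite divr_gt0.
by rewrite sub0r normrN gtr0_norm ?divr_gt0// ltr_pdivrMr// ltr_pMr// ltr1n.
Qed.

End compact_continuity.

Section poisson_formula.
Context {R : realType} (d : nat).
Hypothesis d_gt0 : (0 < d)%N.
Local Notation E := 'rV[R]_d.+1.
Local Notation S := (sphere 1 : set E).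
Local Notation sigma := (@surface_measure R d.+1 1).
Local Notation e0 := (delta_mx ord0 ord0 : E).
Local Notation omega := (@sphere_area R d).

(** Cancelling the other coordinates leaves the first one up to sign; a wrong sign is
    repaired by two quarter-turns. *)
Lemma plane_rot_e0 (P : set E) :
  (forall j c s x, c ^+ 2 + s ^+ 2 = 1 -> 1 + c != 0 -> P (plane_rot j c s x) -> P x) ->
  forall x, P (enorm x *: e0) -> P x.
Proof.
move=> Prot x Px; apply: (plane_rot_axis Prot) => y yx yj.
have yE z : enorm z = enorm x -> 0 <= z ord0 ord0 ->
    (forall j : 'I_d, z ord0 (lift ord0 j) = 0) -> z = enorm x *: e0.
  move=> zx z0 zj.
  have zz : enorm x = z ord0 ord0.
    rewrite -zx /enorm (bigD1 ord0)//= big1 => [|i]; last first.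
      by case: (unliftP ord0 i) => [j ->|->//]; rewrite zj expr0n.
    by rewrite addr0 sqrtr_sqr ger0_norm.
  by apply: rVS_eq => [|i]; rewrite !mxE ?eqxx ?lift_ord0 ?mulr1 ?mulr0 ?zj.
have [y0|y0] := leP 0 (y ord0 ord0); first by rewrite (yE y).
pose j0 : 'I_d := Ordinal d_gt0.
have cs : 0 ^+ 2 + 1 ^+ 2 = 1 :> R by rewrite expr0n expr1n add0r.
have c1 : 1 + 0 != 0 :> R by rewrite addr0 oner_eq0.
apply: (Prot j0 0 1) => //; apply: (Prot j0 0 1) => //.
rewrite (yE (plane_rot j0 0 1 (plane_rot j0 0 1 y)))//.
- by rewrite !enorm_plane_rot.
- by rewrite !(mxE, eqxx, lift_ord0, ord0_lift); lra.
- move=> j; rewrite !(mxE, eqxx, lift_ord0, ord0_lift, yj).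
  by case: eqVneq => _ /=; ring.
Qed.

Lemma poisson_ge0 (z y : E) : enorm z <= 1 -> 0 <= poisson z y.
Proof.
move=> z1; rewrite mulr_ge0 ?invr_ge0 ?exprn_ge0 ?enorm_ge0//.
by rewrite subr_ge0 expr_le1 ?enorm_ge0.
Qed.

(** The integral is invariant under rotations of [z], hence constant on each
    sphere, hence constant by the maximum principle; its value is that at 0. *)
Lemma poisson_mass z : enorm z < 1 ->
  \int[sigma]_(y in S) poisson z y = omega.
Proof.
move=> z1; pose m := poisson_integral (d := d) (cst (1 : R)).
have m1 : measurable_fun S (cst (1 : R) : E -> R) by exact: measurable_cst.
have b1 (y : E) : S y -> `|cst (1 : R) y| <= 1 by move=> _; rewrite normr1.
have mE x : m x = \int[sigma]_(y in S) poisson x y.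
  by apply: eq_Rintegral => y _; rewrite mulr1.
have hm x : enorm x < 1 -> dharmonic m x.
  by move=> x1; apply: (dharmonic_poisson_integral m1 b1); rewrite lt_eqF.
have cm x : enorm x < 1 -> {for x, continuous m}.
  by move=> x1; apply: (continuous_poisson_integral m1 b1); rewrite lt_eqF.
clearbody m.
have radial x : enorm x < 1 -> m x = m (enorm x *: e0).
  apply: (@plane_rot_e0 (fun x => enorm x < 1 -> m x = m (enorm x *: e0)) _ x).
    move=> j c s {}x cs c1; rewrite (enorm_plane_rot j x cs) => h x1.
    apply: (etrans _ (h x1)); rewrite (mE x) (mE (plane_rot j c s x)).
    rewrite -(integral_plane_rot j cs c1 (@measurable_poisson R d (plane_rot j c s x))); last first.
      by move=> y; apply: poisson_ge0; rewrite enorm_plane_rot// ltW.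
    apply: eq_Rintegral => y _; rewrite /poisson enorm_plane_rot//.
    by rewrite -plane_rotB enorm_plane_rot.
  by rewrite enormZ enorm_delta mulr1 ger0_norm ?enorm_ge0.
pose q := enorm z; have q0 : 0 <= q := enorm_ge0 z.
have cq : {within shell (- 1) q, continuous m}.
  apply/subspace_continuousP => x /andP[_ xq]; apply: cvg_within_filter.
  by apply: cm; exact: le_lt_trans z1.
have cqN : {within shell (- 1) q, continuous (fun x => - m x)}.
  by move=> x; apply: continuousN; exact: cq.
have bd x : enorm x = -1 \/ enorm x = q -> m x = m z.
  move=> [x1|xq]; first by have := enorm_ge0 x; rewrite x1; lra.
  by rewrite radial ?xq// -radial.
have S0 : shell (- 1) q (0 : E) by rewrite /shell/= enorm0 q0 andbT; lra.
have hq x : - 1 < enorm x < q -> enorm x < 1 by move=> /andP[_ /lt_trans]; exact.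
have le1 : m 0 <= m z.
  apply: (max_principle cq) S0 => [x /hq|x /bd ->//]; exact: hm.
have le2 : - m 0 <= - m z.
  apply: (max_principle cqN) S0 => [x /hq /hm h|x /bd ->//].
  have := dharmonicZ (-1) h.
  by under [X in dharmonic X]eq_fun do rewrite mulN1r.
rewrite -mE; have -> : m z = m 0 by lra.
rewrite mE (@eq_Rintegral _ _ _ _ _ (cst (1 : R))).
  by rewrite Rintegral_cst ?mul1r//; exact: measurable_sphere.
move=> y; rewrite inE => Sy; rewrite /poisson enorm0 sub0r enormN (Sy : enorm y = 1).
by rewrite expr0n subr0 expr1n invr1 mulr1.
Qed.

Lemma sphere_compact : compact S.
Proof.
rewrite (_ : S = shell 1 1); first exact: compact_shell.
apply/seteqP; split => x; rewrite /sphere /shell/=; first by move=> ->; rewrite lexx.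
by rewrite -eq_le => /eqP.
Qed.

(** Poisson kernels are an approximate identity. The bound on [g] is spread into
    [eps + C |x - y|^(d+1)], whose second term cancels the denominator of the
    kernel at [rho x] since [|x - y| <= 2 |rho x - y|]. *)
Lemma poisson_approx (g : E -> R) (eps : R) : {within S, continuous g} -> 0 < eps ->
  exists2 q, 0 <= q < 1 & forall rho x, q < rho < 1 -> S x ->
    `|poisson_integral g (rho *: x) - omega * g x| <= eps.
Proof.
move=> cg eps0.
have mg := within_continuous_measurable (@measurable_sphere R d.+1 1) cg.
have [G0 gG0] : exists G, forall y, S y -> `|g y| <= G.
  have [M [_ MP]] := compact_bounded (continuous_compact cg sphere_compact).
  by exists (M + 1) => y Sy; apply: (MP (M + 1)); [rewrite ltrDl|exists y].
pose G := `|G0|.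
have gG y : S y -> `|g y| <= G by move=> /gG0 /le_trans; apply; exact: ler_norm.
have om0 := @sphere_area_ge0 R d.
(* [eps1], and [p] below, are such that the two terms contribute at most [eps / 2] each. *)
pose eps1 := eps / (2 * (omega + 1)).
have eps10 : 0 < eps1 by rewrite divr_gt0// mulr_gt0// ltr_wpDl.
have [q q0 gq] := compact_unif_continuous sphere_compact cg eps10.
pose C := 2 * G / q ^+ d.+1.
have GG0 : 0 <= G := normr_ge0 _.
have [q0' eps10'] := (ltW q0, ltW eps10).
have C0 : 0 <= C by rewrite divr_ge0 ?mulr_ge0 ?exprn_ge0.
have gxy x y : S x -> S y -> `|g y - g x| <= eps1 + C * enorm (x - y) ^+ d.+1.
  move=> Sx Sy; have [xy|xy] := ltP (enorm (x - y)) q.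
    rewrite distrC (le_trans (ltW (gq _ _ Sx Sy xy)))// lerDl mulr_ge0//.
    by rewrite exprn_ge0// enorm_ge0.
  apply: (@le_trans _ _ (2 * G)).
    by rewrite (le_trans (ler_normB _ _))// mulr_natl mulr2n lerD ?gG.
  rewrite (@le_trans _ _ (C * q ^+ d.+1))//.
    by rewrite /C divfK// expf_eq0/= gt_eqF.
  rewrite -[leLHS]add0r lerD// ler_wpM2l//.
  by rewrite lerXn2r// nnegrE enorm_ge0.
pose K := C * 2 ^+ d.+1 * omega.
have K0 : 0 <= K by apply: (mulr_ge0 _ om0); apply: (mulr_ge0 C0); rewrite exprn_ge0.
pose p := 1 - Num.min 1 (eps / (4 * (K + 1))).
have mp : 0 < Num.min 1 (eps / (4 * (K + 1))).
  by rewrite lt_min ltr01 divr_gt0// mulr_gt0// ltr_wpDl.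
have m1 : Num.min 1 (eps / (4 * (K + 1))) <= 1 by rewrite ge_min lexx.
have m2 : Num.min 1 (eps / (4 * (K + 1))) <= eps / (4 * (K + 1)) by rewrite ge_min lexx orbT.
exists p; first by rewrite /p; lra.
move=> rho x /andP[prho rho1] Sx.
have rho0 : 0 < rho by apply: le_lt_trans prho; rewrite /p; lra.
have zE : enorm (rho *: x) = rho by rewrite enormZ gtr0_norm// (Sx : enorm x = 1) mulr1.
have z1 : enorm (rho *: x) < 1 by rewrite zE.
have zn1 : enorm (rho *: x) != 1 by rewrite lt_eqF.
have P0 y := poisson_ge0 y (ltW z1).
have iP := integrable_poisson mg gG zn1.
have mS := @measurable_sphere R d.+1 1.
have iP1 : sigma.-integrable S (EFin \o poisson (rho *: x)).
  apply: (@integrable_sphere _ _ sigma 1 _ ((1 + rho ^+ 2) * `|rho - 1| ^- d.+1)).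
    by apply: measurable_funTS; exact: measurable_poisson.
  by move=> y Sy; have := poisson_bound Sy zn1; rewrite zE.
rewrite -(poisson_mass z1) mulrC -RintegralZl// -RintegralB//; last first.
  exact: integrableZl_EFin.
apply: (@le_trans _ _ (\int[sigma]_(y in S)
   (eps1 * poisson (rho *: x) y + C * 2 ^+ d.+1 * (1 - rho ^+ 2)))).
  apply: (@Rintegral_sphere_le _ _ _ _ (eps1 * ((1 + rho ^+ 2) * `|rho - 1| ^- d.+1) + `|C * 2 ^+ d.+1 * (1 - rho ^+ 2)|)).
  - apply: measurable_funB; apply: measurable_funM => //; apply: measurable_funTS;
      exact: measurable_poisson.
  - apply: measurable_funD => //; apply: measurable_funM => //; apply: measurable_funTS.
    exact: measurable_poisson.
  - move=> y Sy; rewrite (le_trans (ler_normD _ _))// lerD2r normrM (gtr0_norm eps10).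
    by rewrite ler_pM2l//; have := poisson_bound Sy zn1; rewrite zE.
  move=> y Sy; rewrite (mulrC (g x)) -mulrBr normrM (ger0_norm (P0 y)).
  apply: (le_trans (ler_wpM2l (P0 y) (gxy x y Sx Sy))).
  rewrite mulrDr mulrC lerD2l /poisson zE.
  have r2 : 0 <= 1 - rho ^+ 2 by rewrite subr_ge0 expr_le1// ltW.
  set u := enorm (rho *: x - y).
  have u0 : 0 < u.
    by have := ler_dist_enorm (rho *: x) y; rewrite zE (Sy : enorm y = 1) -/u ltr0_norm; lra.
  have xyu : enorm (x - y) <= 2 * u.
    have h1 := enormD (x - rho *: x) (rho *: x - y); rewrite subrKA -/u in h1.
    have h2 : enorm (x - rho *: x) = 1 - rho.
      by rewrite -{1}[x]scale1r -scalerBl enormZ (Sx : enorm x = 1) mulr1 gtr0_norm; lra.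
    have h3 := ler_dist_enorm (rho *: x) y; rewrite zE (Sy : enorm y = 1) -/u ltr0_norm in h3; last by lra.
    lra.
  rewrite [leLHS](_ : _ = C * (1 - rho ^+ 2) * (enorm (x - y) / u) ^+ d.+1); last first.
    by rewrite expr_div_n; ring.
  rewrite [leRHS](_ : _ = C * (1 - rho ^+ 2) * 2 ^+ d.+1); last by ring.
  apply: ler_wpM2l; first exact: mulr_ge0.
  rewrite lerXn2r ?nnegrE ?ler_pdivrMr//.
  by rewrite divr_ge0// enorm_ge0.
rewrite RintegralD//; first last.
- exact: (@integrable_sphere _ _ sigma 1 _ `|C * 2 ^+ d.+1 * (1 - rho ^+ 2)|).
- exact: integrableZl_EFin.
rewrite RintegralZl// poisson_mass// Rintegral_cst//.
have e1 : eps1 * omega <= eps / 2.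
  rewrite /eps1 [X in X * _](_ : _ = (eps / 2) / (omega + 1)); last first.
    by field; rewrite gt_eqF// ltr_wpDl.
  rewrite mulrAC ler_pdivrMr ?ltr_wpDl// ler_pM2l ?divr_gt0//; lra.
have e2 : K * (1 - rho ^+ 2) <= eps / 2.
  have r2 : 1 - rho ^+ 2 <= 2 * (eps / (4 * (K + 1))).
    have : 1 - rho <= eps / (4 * (K + 1)) by move: prho; rewrite /p; lra.
    by nra.
  apply: (le_trans (ler_wpM2l K0 r2)).
  rewrite [leLHS](_ : _ = (eps / 2) * K / (K + 1)); last first.
    by field; rewrite gt_eqF// ltr_wpDl.
  rewrite ler_pdivrMr ?ltr_wpDl// ler_pM2l ?divr_gt0//; lra.
suff : eps1 * omega + C * 2 ^+ d.+1 * (1 - rho ^+ 2) * omega <= eps by [].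
have : K * (1 - rho ^+ 2) = C * 2 ^+ d.+1 * (1 - rho ^+ 2) * omega by rewrite /K; ring.
lra.
Qed.

End poisson_formula.

Section poisson_representation.
Context {R : realType} (d : nat).
Local Notation E := 'rV[R]_d.+1.
Local Notation S := (sphere 1 : set E).
Local Notation sigma := (@surface_measure R d.+1 1).
Local Notation omega := (@sphere_area R d).

Lemma sphere_scale (z : E) : 0 < enorm z -> S ((enorm z)^-1 *: z).
Proof.
by move=> z0; rewrite /sphere/= enormZ gtr0_norm ?invr_gt0// mulVf// gt_eqF.
Qed.

(** The points [rho x] and [x / rho] are inverse to each other in the unit sphere. *)
Lemma dist_inversion rho (x y : E) : 0 < rho -> S x -> S y ->
  enorm (rho *: x - y) = rho * enorm (rho^-1 *: x - y).
Proof.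
move=> r0 x1 y1; apply/eqP; rewrite -(@eqrXn2 _ 2)// ?mulr_ge0 ?enorm_ge0 ?(ltW r0)//.
rewrite exprMn !enormB_sqr !enormZ (x1 : enorm x = 1) (y1 : enorm y = 1).
rewrite !gtr0_norm ?invr_gt0// (eq_bigr (fun i => rho * (x ord0 i * y ord0 i))); last first.
  by move=> i _; rewrite mxE mulrA.
rewrite [in X in _ == X](eq_bigr (fun i => rho^-1 * (x ord0 i * y ord0 i))); last first.
  by move=> i _; rewrite mxE mulrA.
by rewrite -!mulr_sumr; apply/eqP; field; rewrite gt_eqF.
Qed.

(** The Kelvin transformation exchanges the Poisson integrals of the ball and of
    its exterior. *)
Lemma poisson_inversion rho (x y : E) : 0 < rho -> S x -> S y ->
  poisson (rho *: x) y = - (rho ^- d * rho * poisson (rho^-1 *: x) y).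
Proof.
move=> r0 Sx Sy; rewrite /poisson dist_inversion// !enormZ (Sx : enorm x = 1).
rewrite !gtr0_norm ?invr_gt0// !mulr1 !exprMn !exprS.
set u := enorm _; have [->|u0] := eqVneq u 0.
  by rewrite !mul0r !mulr0 invr0 !mulr0 oppr0.
by field; rewrite u0 expf_eq0 (negbTE u0) andbF/= gt_eqF//= expf_eq0 gt_eqF ?andbF.
Qed.

Lemma poisson_integral_inversion (g : E -> R) rho (x : E) :
  sigma.-integrable S (EFin \o (fun y => poisson (rho^-1 *: x) y * g y)) ->
  0 < rho -> S x -> poisson_integral g (rho *: x) =
    - (rho ^- d * rho * poisson_integral g (rho^-1 *: x)).
Proof.
move=> iP r0 Sx; rewrite /poisson_integral -RintegralZl//; last exact: measurable_sphere.
rewrite -mulN1r -RintegralZl//; first last.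
- by apply: integrableZl_EFin => //; exact: measurable_sphere.
- exact: measurable_sphere.
apply: eq_Rintegral => y; rewrite inE => Sy.
by rewrite poisson_inversion// mulN1r mulrA mulNr.
Qed.

Section density.
Variable v : E -> R.
Hypothesis d_gt0 : (0 < d)%N.
Hypothesis cv : {within S, continuous v}.

Lemma sphere_continuous_bounded : exists G, forall y, S y -> `|v y| <= G.
Proof.
have [M [_ MP]] := compact_bounded (continuous_compact cv (@sphere_compact R d)).
by exists (M + 1) => y Sy; apply: (MP (M + 1)); [rewrite ltrDl|exists y].
Qed.

Lemma poisson_integral_bound G z : (forall y, S y -> `|v y| <= G) ->
  enorm z < 1 -> `|poisson_integral v z| <= omega * G.
Proof.
move=> vG z1; have mv := within_continuous_measurable (@measurable_sphere R d.+1 1) cv.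
have mP := measurable_funTS (@measurable_poisson R d z) (D := S).
have zn1 : enorm z != 1 by rewrite lt_eqF.
have iP : sigma.-integrable S (EFin \o poisson z).
  by apply: (@integrable_sphere _ _ sigma 1 _ ((1 + enorm z ^+ 2) * `|enorm z - 1| ^- d.+1)) => // y Sy; exact: poisson_bound.
rewrite -(poisson_mass d_gt0 z1) -RintegralZr//; last exact: measurable_sphere.
apply: (@Rintegral_sphere_le _ _ _ _ ((1 + enorm z ^+ 2) * `|enorm z - 1| ^- d.+1 * G)).
- exact: measurable_funM.
- exact: measurable_funM.
- move=> y Sy; have G0 := le_trans (normr_ge0 _) (vG y Sy).
  by rewrite normrM ler_pM// ?poisson_bound// ger0_norm.
- move=> y Sy; have P0 := poisson_ge0 y (ltW z1).
  by rewrite normrM (ger0_norm P0) ler_wpM2l// vG.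
Qed.

End density.

Lemma dharmonic_opp (v : E -> R) z : dharmonic v z -> dharmonic (fun x => - v x) z.
Proof.
by move=> /(dharmonicZ (-1)); under [X in dharmonic X]eq_fun do rewrite mulN1r.
Qed.

Lemma max_principle_norm (v : E -> R) a b M :
  {within shell a b, continuous v} ->
  (forall z, a < enorm z < b -> dharmonic v z) ->
  (forall z, enorm z = a \/ enorm z = b -> `|v z| <= M) ->
  forall z, shell a b z -> `|v z| <= M.
Proof.
move=> cv hv bv z Cz; rewrite ler_norml; apply/andP; split.
  rewrite lerNl; apply: (max_principle (v := fun x => - v x)) Cz.
  - by move=> x; apply: continuousN; exact: cv.
  - by move=> x /hv; exact: dharmonic_opp.
  - by move=> x /bv; rewrite ler_norml lerNl => /andP[].
apply: (max_principle cv hv) Cz => x /bv; exact/le_trans/ler_norm.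
Qed.

(** The difference of the two sides is harmonic in the ball, and small near the unit
    sphere since Poisson kernels are an approximate identity; it is estimated at [z]
    by the maximum principle in a ball of radius close to 1. *)
Lemma poisson_formula_interior (v : E -> R) : (0 < d)%N ->
  {within shell (- 1) 1, continuous v} ->
  (forall z, enorm z < 1 -> dharmonic v z) ->
  forall z, enorm z < 1 -> omega * v z = poisson_integral v z.
Proof.
move=> d_gt0 cv hv z0 z01.
have SB : S `<=` shell (- 1) 1 by move=> x Sx; rewrite /shell/= (Sx : enorm x = 1); lra.
have cS : {within S, continuous v} by apply: continuous_subspaceW cv.
have [G vG] := sphere_continuous_bounded cS.
have mv := within_continuous_measurable (@measurable_sphere R d.+1 1) cS.
have om0 := @sphere_area_ge0 R d.
apply/eqP; rewrite -subr_eq0 -normr_le0; apply/ler_addgt0Pl => eps eps0; rewrite addr0.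
have e2 : 0 < eps / 2 by rewrite divr_gt0.
have [q /andP[q0 q1] qP] := poisson_approx d_gt0 cS e2.
have e3 : 0 < eps / (2 * (omega + 1)) by rewrite divr_gt0// mulr_gt0// ltr_wpDl.
have [q' q'0 q'P] := compact_unif_continuous (@compact_shell R d (- 1) 1) cv e3.
pose m := Num.max (enorm z0) (Num.max q (1 - q')).
have m1 : m < 1 by rewrite !gt_max z01 q1/=; lra.
pose rho := (m + 1) / 2.
have mrho : m < rho by rewrite /rho; lra.
have rho1 : rho < 1 by rewrite /rho; lra.
move: (mrho); rewrite !gt_max => /and3P[z0rho qrho q'rho].
have rho0 : 0 < rho := le_lt_trans (enorm_ge0 z0) z0rho.
have cw x : enorm x < 1 -> {for x, continuous (poisson_integral v)}.
  by move=> x1; apply: (continuous_poisson_integral mv vG); rewrite lt_eqF.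
have hw x : enorm x < 1 -> dharmonic (poisson_integral v) x.
  by move=> x1; apply: (dharmonic_poisson_integral mv vG); rewrite lt_eqF.
pose h x := omega * v x - poisson_integral v x.
have z0C : shell (- 1) rho z0 by rewrite /shell/= (ltW z0rho) andbT; have := enorm_ge0 z0; lra.
apply: (max_principle_norm (v := h)) z0C.
- apply/subspace_continuousP => x /andP[x1 x2].
  have xlt1 : enorm x < 1 by exact: le_lt_trans rho1.
  apply: cvgB; last by apply: cvg_within_filter; exact: cw.
  apply: cvgM; first exact: cvg_cst.
  have /subspace_continuousP/(_ x) := cv.
  have xB : shell (-1) 1 x by rewrite /shell/= x1 ltW.
  move=> /(_ xB); apply: cvg_trans; apply: cvg_app; apply: within_subset.
  by move=> y /andP[y1 y2]; rewrite /shell/= y1 (le_trans y2)// ltW.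
- move=> x /andP[_ x1]; have xlt1 := lt_trans x1 rho1.
  by apply: dharmonicB; [apply: dharmonicZ; exact: hv|exact: hw].
- move=> x [x1|xrho]; first by have := enorm_ge0 x; rewrite x1; lra.
  have x0 : 0 < enorm x by rewrite xrho.
  have Sx := sphere_scale x0; rewrite xrho in Sx.
  set y := _ *: x in Sx; have xE : x = rho *: y by rewrite scalerA divff ?scale1r// gt_eqF.
  have h1 : `|poisson_integral v (rho *: y) - omega * v y| <= eps / 2.
    by apply: qP => //; rewrite qrho.
  have h2 : `|v x - v y| < eps / (2 * (omega + 1)).
    apply: q'P; [|exact: SB|].
      by rewrite /shell/= xrho (ltW rho1); lra.
    rewrite xE -{2}[y]scale1r -scalerBl enormZ (Sx : enorm y = 1) mulr1 ltr0_norm; lra.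
  have h3 : `|omega * v x - omega * v y| <= eps / 2.
    rewrite -mulrBr normrM ger0_norm//.
    apply: (le_trans (ler_wpM2l om0 (ltW h2))).
    rewrite [leLHS](_ : _ = (eps / 2) * omega / (omega + 1)); last first.
      by field; rewrite gt_eqF// ltr_wpDl.
    rewrite ler_pdivrMr ?ltr_wpDl// ler_pM2l ?divr_gt0//; lra.
  rewrite /h (_ : _ - _ = (omega * v x - omega * v y) - (poisson_integral v (rho *: y) - omega * v y)); last first.
    by rewrite -xE; ring.
  by rewrite (le_trans (ler_normB _ _))// [eps]splitr lerD.
Qed.

Lemma one_sub_exprn_le (s : R) m : 0 <= s -> s <= 1 -> 1 - s ^+ m <= m%:R * (1 - s).
Proof.
move=> s0 s1; elim: m => [|m IH]; first by rewrite expr0 subrr mul0r.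
have sm : 0 <= 1 - s ^+ m by rewrite subr_ge0 exprn_ile1.
have h : s * (1 - s ^+ m) <= 1 - s ^+ m by rewrite ler_piMl.
rewrite exprS -natr1 mulrDl mul1r.
rewrite (_ : 1 - s * s ^+ m = (1 - s) + s * (1 - s ^+ m)); [lra|ring].
Qed.

(** The difference of the two sides is harmonic outside the ball. Near the unit
    sphere it is small because inversion brings back the approximate identity inside
    the ball; far away it is small because [v] vanishes at infinity and, as [1 < d],
    so does the Poisson integral, which inversion multiplies by [|z| ^- (d-1)]. The
    maximum principle in a shell bounded by two such spheres concludes. *)
Lemma poisson_formula_exterior (v : E -> R) : (1 < d)%N ->
  {within [set z | 1 <= enorm z], continuous v} ->
  (forall z, 1 < enorm z -> dharmonic v z) ->
  (forall eps : R, 0 < eps -> exists M : R, forall z, M < enorm z -> `|v z| < eps) ->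
  forall z, 1 < enorm z -> omega * v z = - poisson_integral v z.
Proof.
move=> d_gt1 cv hv v_inf z0 z01; have d_gt0 := ltnW d_gt1.
have SB : S `<=` [set z | 1 <= enorm z] by move=> x Sx /=; rewrite (Sx : enorm x = 1).
have cS : {within S, continuous v} by apply: continuous_subspaceW cv.
have [G0 vG0] := sphere_continuous_bounded cS.
pose G := `|G0|; have G_ge0 : 0 <= G := normr_ge0 _.
have vG y : S y -> `|v y| <= G by move=> /vG0 /le_trans; apply; exact: ler_norm.
have mv := within_continuous_measurable (@measurable_sphere R d.+1 1) cS.
have om0 := @sphere_area_ge0 R d.
apply/eqP; rewrite -addr_eq0 -normr_le0; apply/ler_addgt0Pl => eps eps0; rewrite addr0.
have e4 : 0 < eps / 4 by rewrite divr_gt0.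
have e2 : 0 < eps / 2 by rewrite divr_gt0.
have [q /andP[q0 q1] qP] := poisson_approx d_gt0 cS e4.
have e3 : 0 < eps / (4 * (omega + 1)) by rewrite divr_gt0// mulr_gt0// ltr_wpDl.
have s12 : shell 1 2 `<=` [set z : E | 1 <= enorm z] by move=> x /andP[].
have c12 : {within shell 1 2, continuous v} by apply: continuous_subspaceW s12 cv.
have [q' q'0 q'P] := compact_unif_continuous (@compact_shell R d 1 2) c12 e3.
have [M MP] := v_inf _ e3.
pose L := omega * G; have L0 : 0 <= L by rewrite mulr_ge0.
have omega_lt u : `|u| <= eps / (4 * (omega + 1)) -> `|omega * u| <= eps / 4.
  move=> ue; rewrite normrM ger0_norm//.
  apply: (le_trans (ler_wpM2l om0 ue)).
  rewrite [leLHS](_ : _ = (eps / 4) * omega / (omega + 1)); last first.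
    by field; rewrite gt_eqF// ltr_wpDl.
  rewrite ler_pdivrMr ?ltr_wpDl// ler_pM2l ?divr_gt0//; lra.
(* [c] is the margin of the inner sphere around the unit sphere. Its entries serve
   to stay in [shell 1 2], to use the uniform continuity of [v], to use the
   approximate identity, and to keep the factor of the inversion close to 1. *)
pose c := Num.min (Num.min 1 q') (Num.min (1 - q) (eps / (4 * d%:R * (L + 1)))).
have dR : 0 < d%:R :> R by rewrite ltr0n.
have c0 : 0 < c.
  by rewrite !lt_min ltr01 q'0 subr_gt0 q1/= divr_gt0// !mulr_gt0// ltr_wpDl.
pose rho := Num.min (1 + c / 2) ((1 + enorm z0) / 2).
have rho1 : 1 < rho by rewrite lt_min; apply/andP; split; lra.
have rhoz0 : rho < enorm z0 by rewrite gt_min; apply/orP; right; lra.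
have rhoc : rho - 1 < c by rewrite ltrBlDl gt_min; apply/orP; left; lra.
move: rhoc; rewrite !lt_min => /andP[/andP[rc1 rc2] /andP[rc3 rc4]].
(* On the outer sphere, of radius [P], both [v] and [L / P], which bounds the
   Poisson integral, are small. *)
pose P := Num.max (Num.max (enorm z0) (M + 1)) (4 * (L + 1) / eps).
have z0P : enorm z0 <= P by rewrite !le_max lexx.
have MltP : M < P by rewrite !lt_max ltrDl ltr01 orbT.
have LP : 4 * (L + 1) / eps <= P by rewrite le_max lexx orbT.
have P1 : 1 < P by exact: lt_le_trans z0P.
have cw x : 1 < enorm x -> {for x, continuous (poisson_integral v)}.
  by move=> x1; apply: (continuous_poisson_integral mv vG); rewrite gt_eqF.
have hw x : 1 < enorm x -> dharmonic (poisson_integral v) x.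
  by move=> x1; apply: (dharmonic_poisson_integral mv vG); rewrite gt_eqF.
have winv t y : 1 < t -> S y -> poisson_integral v (t *: y) =
    - (t^-1 ^+ d.-1 * poisson_integral v (t^-1 *: y)).
  move=> t1 Sy; have t0 : 0 < t by lra.
  rewrite poisson_integral_inversion//; last first.
    apply: (integrable_poisson mv vG).
    rewrite enormZ gtr0_norm ?invr_gt0// (Sy : enorm y = 1) mulr1 lt_eqF//.
    by rewrite invf_lt1.
  congr (- (_ * _)); rewrite exprVn -{1}(prednK d_gt0) exprS invfM mulrAC mulVf ?mul1r//.
  by rewrite gt_eqF.
pose h x := omega * v x + poisson_integral v x.
have z0C : shell rho P z0 by rewrite /shell/= (ltW rhoz0).
apply: (max_principle_norm (v := h)) z0C.
- apply/subspace_continuousP => x /andP[x1 x2].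
  have xgt1 : 1 < enorm x by exact: lt_le_trans x1.
  apply: cvgD; last by apply: cvg_within_filter; exact: cw.
  apply: cvgM; first exact: cvg_cst.
  have /subspace_continuousP/(_ x (ltW xgt1)) := cv.
  apply: cvg_trans; apply: cvg_app; apply: within_subset.
  by move=> y /andP[y1 y2] /=; rewrite (le_trans _ y1)// ltW.
- move=> x /andP[x1 _]; have xgt1 := lt_trans rho1 x1.
  by apply: dharmonicD; [apply: dharmonicZ; exact: hv|exact: hw].
- move=> x xC.
  have x1 : 1 < enorm x by case: xC => ->.
  have x0 : 0 < enorm x by rewrite (lt_trans _ x1).
  have Sx := sphere_scale x0.
  set t := enorm x in x0 x1 Sx xC; set y := _ *: x in Sx.
  have xE : x = t *: y by rewrite scalerA divff ?scale1r// gt_eqF.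
  have t'1 : t^-1 < 1 by rewrite invf_lt1.
  have t'0 : 0 < t^-1 by rewrite invr_gt0.
  have y't : enorm (t^-1 *: y) < 1 by rewrite enormZ (Sx : enorm y = 1) mulr1 gtr0_norm.
  have wG := poisson_integral_bound d_gt0 cS vG y't.
  have k0 : 0 <= t^-1 ^+ d.-1 by rewrite exprn_ge0// ltW.
  case: xC => xC.
    have tt : 1 - t^-1 <= rho - 1.
      have tV : t * t^-1 = 1 by rewrite divff// gt_eqF.
      by rewrite -xC; nra.
    have h1 : `|poisson_integral v (t^-1 *: y) - omega * v y| <= eps / 4.
      by apply: qP => //; rewrite t'1 andbT; lra.
    have h2 : `|omega * v x - omega * v y| <= eps / 4.
      rewrite -mulrBr; apply: omega_lt; apply/ltW/q'P.
      + by rewrite /shell/= -/t xC (ltW rho1)/=; lra.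
      + by rewrite /shell/= (Sx : enorm y = 1) lexx/=; lra.
      + by rewrite xE -{2}[y]scale1r -scalerBl enormZ (Sx : enorm y = 1) mulr1 xC gtr0_norm ?subr_gt0.
    have h3 : `|(1 - t^-1 ^+ d.-1) * (omega * v y)| <= eps / 4.
      have b1 : 1 - t^-1 ^+ d.-1 <= eps / (4 * (L + 1)).
        apply: (le_trans (one_sub_exprn_le d.-1 (ltW t'0) (ltW t'1))).
        apply: (@le_trans _ _ (d%:R * (rho - 1))).
          by rewrite ler_pM ?ler_nat ?leq_pred// subr_ge0 ltW.
        rewrite (le_trans (ler_wpM2l (ltW dR) (ltW rc4)))// le_eqVlt; apply/orP; left.
        by apply/eqP; field; rewrite (gt_eqF dR) gt_eqF// ltr_wpDl.
      have b2 : 0 <= 1 - t^-1 ^+ d.-1 by rewrite subr_ge0 exprn_ile1// ltW.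
      rewrite normrM ger0_norm// (le_trans (ler_pM b2 (normr_ge0 _) b1 (_ : _ <= L)))//.
        by rewrite normrM ger0_norm// ler_wpM2l// vG.
      rewrite [leLHS](_ : _ = (eps / 4) * L / (L + 1)); last first.
        by field; rewrite gt_eqF// ltr_wpDl.
      rewrite ler_pdivrMr ?ltr_wpDl// ler_pM2l ?divr_gt0//; lra.
    rewrite /h {2}xE winv// (_ : _ + _ = (omega * v x - omega * v y) +
      ((1 - t^-1 ^+ d.-1) * (omega * v y) - t^-1 ^+ d.-1 *
         (poisson_integral v (t^-1 *: y) - omega * v y))); last by ring.
    have k1 : t^-1 ^+ d.-1 <= 1 by rewrite exprn_ile1// ltW.
    have h4 : `|t^-1 ^+ d.-1 * (poisson_integral v (t^-1 *: y) - omega * v y)| <= eps / 4.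
      by rewrite normrM ger0_norm// -[leRHS]mul1r ler_pM.
    rewrite (le_trans (ler_normD _ _))// (le_trans (lerD h2 (ler_normB _ _)))//.
    by rewrite (le_trans (lerD (lexx _) (lerD h3 h4)))//; lra.
  have h1 : `|omega * v x| <= eps / 4.
    by apply/omega_lt/ltW/MP; rewrite -/t xC.
  have h2 : `|t^-1 ^+ d.-1 * poisson_integral v (t^-1 *: y)| <= eps / 4.
    have sd : t^-1 ^+ d.-1 <= t^-1.
      by rewrite -[leRHS]expr1 ler_wiXn2l ?ltW// -subn1 subn_gt0.
    rewrite normrM ger0_norm// (le_trans (ler_pM k0 (normr_ge0 _) sd wG))// -/L.
    rewrite ler_pdivrMl// xC; move: LP; rewrite ler_pdivrMr//; lra.
  rewrite /h {2}xE winv// (le_trans (ler_normB _ _))// (le_trans (lerD h1 h2))//; lra.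
Qed.

End poisson_representation.

(** * Harmonic functions and harmonic polynomials *)

Section harmonic_functions.
Context {R : realType} (d : nat).
Local Notation E := 'rV[R]_d.+1.
Local Notation S := (sphere 1 : set E).
Local Notation e i := (delta_mx ord0 i : E).

Lemma is_derive_line (f : E -> R) (y v : E) (t l : R) :
  is_derive (y + t *: v) v f l -> is_derive t (1 : R) (fun t : R => f (y + t *: v)) l.
Proof.
have eqf : (fun h : R => h^-1 *: ((f \o shift (y + t *: v)) (h *: v) - f (y + t *: v))) =
    (fun h : R => h^-1 *: (((fun t : R => f (y + t *: v)) \o shift t) (h *: (1 : R)) - f (y + t *: v))).
  apply/funext => h /=; congr (_ *: (f _ - _)).
  by rewrite [h *: (1 : R)]mulr1 scalerDl addrCA.
by move=> [h1 h2]; split; [rewrite /derivable -eqf|rewrite /derive -eqf].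
Qed.

Lemma harmonic_on_dharmonic (f : E -> R) (r : R) (z : E) : 0 < r ->
  harmonic_on [set x | r < enorm x] f -> 1 < enorm z ->
  dharmonic (fun x => f (r *: x)) z.
Proof.
move=> r0 hf z1; pose q := enorm z - 1; have q0 : 0 < q by rewrite subr_gt0.
have lineE i (t : R) : r *: (z + t *: e i) = r *: z + (r * t) *: e i.
  by rewrite scalerDr scalerA.
have inU i (t : R) : `|t| < q -> r < enorm (r *: z + (r * t) *: e i).
  move=> tq; rewrite -lineE enormZ gtr0_norm// ltr_pMr//.
  have := enormB_ge z (- (t *: e i)); rewrite opprK enormN enormZ enorm_delta mulr1.
  by move: tq; rewrite /q; lra.
have Dscale (t : R) : is_derive t (1 : R) (fun t : R => r * t) r.
  by apply: is_derive_eq (is_deriveZ r (is_derive_id t (1 : R))) _; rewrite /GRing.scale/= mulr1.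
have q00 : `|0 : R| < q by rewrite normr0.
apply: (@dharmonic_lines R d.+1 _ z
  (fun i t => r * 'D_(e i) f (r *: z + (r * t) *: e i))
  (fun i t => r * (r * 'D_(e i) ('D_(e i) f) (r *: z + (r * t) *: e i))) q q0).
- move=> i t tq; have [h1 _ _ _] := hf _ (inU i t tq).
  under [X in is_derive _ _ X]eq_fun do rewrite lineE.
  have D1 := is_derive_line (derivableP (h1 i)).
  rewrite mulrC.
  exact: (@is_derive1_comp R (fun t : R => f (r *: z + t *: e i)) (fun t => r * t) t _ _ D1 (Dscale t)).
- move=> i t tq; have [_ h2 _ _] := hf _ (inU i t tq).
  have D1 := is_derive_line (derivableP (h2 i i)).
  have D2 := @is_derive1_comp R (fun t : R => 'D_(e i) f (r *: z + t *: e i)) (fun t => r * t) t _ _ D1 (Dscale t).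
  apply: is_derive_eq (is_deriveZ r D2) _.
  by rewrite /GRing.scale/= (mulrC _ r).
- move=> i; have [_ _ h3 _] := hf _ (inU i 0 q00).
  have c1 : {for 0, continuous (fun t : R => r *: z + (r * t) *: e i)}.
    apply: cvgD; first exact: cvg_cst.
    by apply: cvgZr_tmp; apply: cvgMl_tmp; exact: cvg_id.
  have c2 := @continuous_comp _ _ _ (fun t : R => r *: z + (r * t) *: e i) _ 0 c1 (h3 i i).
  have c3 (g : R -> R) : {for 0, continuous g} -> {for 0, continuous (fun t => r * g t)}.
    by move=> cg; apply: cvgMl_tmp; exact: cg.
  exact/c3/c3.
have [_ _ _ h4] := hf _ (inU ord0 0 q00).
under eq_bigr do rewrite mulr0 scale0r addr0.
by rewrite -!mulr_sumr; move: h4; rewrite mulr0 scale0r addr0 => ->; rewrite !mulr0.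
Qed.

End harmonic_functions.

Section polynomial_functions.
Context {R : realType} (n : nat).
Local Notation E := 'rV[R]_n.
Local Notation e i := (delta_mx ord0 i : E).
Implicit Types (p q : mpoly n R).

(** Derivatives and continuity follow the ring operations that build a polynomial. *)
Lemma mpoly_ring_ind (P : mpoly n R -> Prop) :
  (forall c, P (mpolyC n c)) -> (forall i, P (mpolyX R (mnm1 i))) ->
  (forall p q, P p -> P q -> P (p + q)) -> (forall p q, P p -> P q -> P (p * q)) ->
  forall p, P p.
Proof.
move=> PC PX PD PM; apply: mpolyind => [|c m p _ _ Pp].
  by rewrite -mpolyC0; exact: PC.
apply: PD => //; rewrite -mul_mpolyC; apply: (PM) => //; rewrite mpolyXE_id.
have P1 : P 1 by rewrite -mpolyC1; exact: PC.
apply: (big_ind P P1 PM) => i _.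
by elim: (m i) => [|k IH]; [rewrite expr0|rewrite exprS; exact: PM].
Qed.

Lemma is_derive_meval_line p i (z : E) (t : R) :
  is_derive t (1 : R) (fun t : R => meval ((z + t *: e i) ord0) p)
    (meval ((z + t *: e i) ord0) (mderiv i p)).
Proof.
elim/mpoly_ring_ind: p => [c|j|p q Dp Dq|p q Dp Dq].
- under [X in is_derive _ _ X]eq_fun do rewrite mevalC.
  by rewrite mderivC meval0; exact: is_derive_cst.
- rewrite (_ : (fun _ => _) = cst (z ord0 j) + (j == i)%:R \*: id); last first.
    by apply/funext => u; rewrite mevalXU !mxE eqxx/= mulrC.
  rewrite mderivX mevalZ mnm1E.
  have D := is_deriveD (is_derive_cst (z ord0 j) t (1 : R))
    (is_deriveZ ((j == i)%:R : R) (is_derive_id t (1 : R))).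
  apply: is_derive_eq D _; rewrite add0r /GRing.scale/= mulr1.
  have [->|_] := eqVneq j i; last by rewrite mul0r.
  by rewrite mul1r -[X in mnm_sub X _]add0m addmK mpolyX0 meval1.
- under [X in is_derive _ _ X]eq_fun do rewrite mevalD.
  by rewrite mderivD mevalD; exact: is_deriveD.
- under [X in is_derive _ _ X]eq_fun do rewrite mevalM.
  rewrite mderivM mevalD !mevalM.
  by apply: is_derive_eq (is_deriveM Dp Dq) _; rewrite /GRing.scale/=; ring.
Qed.

Lemma continuous_meval p : continuous (fun x : E => meval (x ord0) p).
Proof.
elim/mpoly_ring_ind: p => [c|j|p q Dp Dq|p q Dp Dq] x.
- under [X in continuous_at _ X]eq_fun do rewrite mevalC.
  exact: cst_continuous.
- under [X in continuous_at _ X]eq_fun do rewrite mevalXU.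
  exact: coord_continuous.
- under [X in continuous_at _ X]eq_fun do rewrite mevalD.
  by apply: (@continuousD _ _ _ (fun x : E => meval (x ord0) p)); [exact: Dp|exact: Dq].
- under [X in continuous_at _ X]eq_fun do rewrite mevalM.
  by apply: (@continuousM _ _ (fun x : E => meval (x ord0) p)); [exact: Dp|exact: Dq].
Qed.

Lemma dharmonic_meval p (z : E) : \sum_i mderiv i (mderiv i p) = 0 ->
  dharmonic (fun x : E => meval (x ord0) p) z.
Proof.
move=> hp; apply: (@dharmonic_lines R n _ z
  (fun i t => meval ((z + t *: e i) ord0) (mderiv i p))
  (fun i t => meval ((z + t *: e i) ord0) (mderiv i (mderiv i p))) 1 ltr01).
- by move=> i t _; exact: is_derive_meval_line.
- by move=> i t _; exact: is_derive_meval_line.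
- move=> i; have [D _] := is_derive_meval_line (mderiv i (mderiv i p)) i z 0.
  exact/differentiable_continuous/derivable1_diffP.
under eq_bigr do rewrite scale0r addr0.
transitivity (meval (z ord0) (\sum_i mderiv i (mderiv i p))); last by rewrite hp meval0.
by rewrite raddf_sum.
Qed.

Lemma meval_homog (l : nat) p (x : E) (k : R) : p \is ishomog1 l mdeg ->
  meval ((k *: x) ord0) p = k ^+ l * meval (x ord0) p.
Proof.
move=> /dhomogP hp; rewrite !mevalE mulr_sumr; apply: eq_big_seq => m /hp <-.
under eq_bigr do rewrite mxE exprMn.
rewrite big_split/= mulrCA; congr (_ * (_ * _)).
by rewrite mdegE -prodrXr.
Qed.

End polynomial_functions.

(** * Spherical harmonics against the Poisson and Newton kernels *)

Section spherical_harmonics_kernels.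
Context {R : realType} (d : nat).
Local Notation E := 'rV[R]_d.+1.
Local Notation S := (sphere 1 : set E).
Local Notation sigma := (@surface_measure R d.+1 1).
Local Notation omega := (@sphere_area R d).

(** The cone over the sphere contains a small cube. *)
Lemma sphere_area_gt0 : 0 < omega.
Proof.
have mS := @measurable_sphere R d.+1 1.
rewrite /sphere_area fine_gt0//; apply/andP; split; last first.
  by rewrite ltey_eq fin_num_measure.
have n0 : 0 < d.+1%:R :> R by rewrite ltr0n.
rewrite /surface_measure divr1; apply: mule_gt0.
  by rewrite lte_fin normr_gt0 gt_eqF.
have h : (0 < lebesgue_rV d.+1 (@cube R d.+1 0 d.+1%:R^-1))%E.
  by rewrite lebesgue_rV_cube ?invr_ge0 ?ler0n// lte_fin subr0 exprn_gt0 ?invr_gt0.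
apply: (lt_le_trans h).
apply: le_measure; rewrite ?inE; first exact: measurable_cube.
  apply: measurableI; last exact: measurable_punctured_ball.
  by rewrite -[X in measurable X]setTI; exact: measurable_radial_proj.
move=> x xc; have x0 : 0 < enorm x.
  have /andP[h0 _] := xc ord0.
  by rewrite (lt_le_trans h0)// (le_trans (ler_norm _))// ler_coord_enorm.
split; first by rewrite /= /radial_proj mul1r; exact: sphere_scale.
rewrite /punctured_ball/= x0/= -(@expr_le1 _ 2)// ?enorm_ge0// enorm_sqr.
apply: (@le_trans _ _ (\sum_(i < d.+1) d.+1%:R^-1)).
  apply: ler_sum => i _; have /andP[h1 h2] := xc i.
  rewrite (@le_trans _ _ (d.+1%:R^-1 ^+ 2))//.
    by rewrite lerXn2r// nnegrE ?(ltW h1)// invr_ge0 ler0n.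
  by rewrite expr2 ler_piMl ?invr_ge0 ?ler0n// invf_le1// ler1n.
by rewrite sumr_const card_ord -[_ *+ d.+1]mulr_natr mulVf// gt_eqF.
Qed.

Lemma newton_bound (rho : R) (x u : E) m : 0 <= rho < 1 -> S x -> S u ->
  `|enorm (x - rho *: u) ^- m| <= (1 - rho) ^- m.
Proof.
move=> /andP[rho0 rho1] Sx Su.
rewrite ger0_norm ?invr_ge0 ?exprn_ge0 ?enorm_ge0// ler_exprVn ?subr_gt0//.
have := enormB_ge x (rho *: u).
by rewrite (Sx : enorm x = 1) enormZ (Su : enorm u = 1) mulr1 ger0_norm.
Qed.

Lemma measurable_newton (rho : R) (x : E) m :
  measurable_fun setT (fun u : E => enorm (x - rho *: u) ^- m).
Proof.
under eq_fun do rewrite enormBC.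
apply: (measurableT_comp (f := fun z : E => enorm (z - x) ^- m)).
  apply: (measurableT_comp (@measurable_enormVn R d.+1 m)).
  exact: measurable_addrV.
exact: measurable_scalerV.
Qed.

Section one_harmonic.
Variables (l : nat) (y : E -> R).
Hypothesis Hy : spherical_harmonic l y.

Lemma spherical_harmonic_continuous : {within S, continuous y}.
Proof.
have [P [_ _ yP]] := Hy.
have cP : {within S, continuous (fun x : E => meval (x ord0) P)}.
  by apply: continuous_subspaceT; exact: continuous_meval.
apply: (subspace_eq_continuous _ cP) => x; rewrite inE => Sx; exact/esym/yP.
Qed.

Lemma spherical_harmonic_measurable : measurable_fun S y.
Proof.
exact: within_continuous_measurable (@measurable_sphere R d.+1 1) spherical_harmonic_continuous.
Qed.

Lemma spherical_harmonic_bounded : exists G, forall x, S x -> `|y x| <= G.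
Proof. exact: sphere_continuous_bounded spherical_harmonic_continuous. Qed.

(** Poisson's formula for the homogeneous harmonic polynomial that extends [y]. *)
Lemma poisson_integral_harmonic (rho : R) (x : E) : (0 < d)%N -> 0 <= rho < 1 -> S x ->
  poisson_integral y (rho *: x) = omega * (rho ^+ l * y x).
Proof.
move=> d0 /andP[r0 r1] Sx; have [P [hP lP yP]] := Hy.
have z1 : enorm (rho *: x) < 1 by rewrite enormZ (Sx : enorm x = 1) mulr1 ger0_norm.
rewrite yP// -(meval_homog _ _ hP) (poisson_formula_interior (v := fun x : E => meval (x ord0) P))//.
- by apply: eq_Rintegral => u; rewrite inE => Su; rewrite yP.
- by apply: continuous_subspaceT; exact: continuous_meval.
- by move=> z _; exact: dharmonic_meval.
Qed.

(** This relates the Newton and Poisson kernels. With the radius written [s ^ 2] and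
    the factor [s ^+ m], the derivative of the power of the distance has numerator
    [|x - s^2 u|^2 + 2 s^2 <x, u> - 2 s^4 = 1 - s^4], that of the Poisson kernel. *)
Lemma is_derive_newton_kernel (x u : E) (s : R) m : d = m.+1 -> S x -> S u ->
  0 < enorm (x - s ^+ 2 *: u) ->
  is_derive s (1 : R) (fun s : R => s ^+ m * enorm (x - s ^+ 2 *: u) ^- m)
    (m%:R * s ^+ m.-1 * poisson (s ^+ 2 *: x) u).
Proof.
move=> dm Sx Su q0; pose c := \sum_i x ord0 i * u ord0 i.
have dE (t : R) : enorm (x - t *: u) ^+ 2 = 1 + 2 * (- c) * t + t ^+ 2.
  rewrite enormB_sqr enormZ (Sx : enorm x = 1) (Su : enorm u = 1) mulr1 expr1n.
  rewrite -normrX ger0_norm ?sqr_ge0//.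
  rewrite (eq_bigr (fun i => t * (x ord0 i * u ord0 i))).
    by rewrite -mulr_sumr -/c; ring.
  by move=> i _; rewrite mxE; ring.
have dE' (t : R) : enorm (x - t *: u) = Num.sqrt (1 + 2 * (- c) * t + t ^+ 2).
  by rewrite -dE sqrtr_sqr ger0_norm// enorm_ge0.
have qs : 0 < 1 + 2 * (- c) * (s ^+ 2) + (s ^+ 2) ^+ 2 by rewrite -dE exprn_gt0.
have D1 := @is_derive_dist_line R 1 (- c) (s ^+ 2) m qs.
have D2 : is_derive s (1 : R) (fun s : R => s ^+ 2) (2 * s).
  apply: is_derive_eq (is_deriveX 2 (is_derive_id s (1 : R))) _.
  by rewrite /GRing.scale/= expr1 mulr1.
have D3 := @is_derive1_comp R _ (fun s : R => s ^+ 2) s _ _ D1 D2.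
have := is_deriveX m (is_derive_id s (1 : R)); rewrite exprfctE => D4.
have := is_deriveM D4 D3.
rewrite (_ : (_ : R -> R) * _ = (fun s : R => s ^+ m * enorm (x - s ^+ 2 *: u) ^- m)); last first.
  by apply/funext => t; rewrite dE'.
move=> D; apply: is_derive_eq D _; rewrite /GRing.scale/= /poisson.
have -> : enorm (s ^+ 2 *: x - u) = enorm (x - s ^+ 2 *: u).
  apply/eqP; rewrite -(@eqrXn2 _ 2)// ?enorm_ge0// dE enormB_sqr enormZ.
  rewrite (Sx : enorm x = 1) (Su : enorm u = 1) mulr1 expr1n.
  rewrite -normrX ger0_norm ?sqr_ge0//.
  rewrite (eq_bigr (fun i => s ^+ 2 * (x ord0 i * u ord0 i))).
    by rewrite -mulr_sumr -/c; apply/eqP; ring.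
  by move=> i _; rewrite mxE; ring.
have e1 : enorm (s ^+ 2 *: x) = s ^+ 2.
  by rewrite enormZ (Sx : enorm x = 1) mulr1 ger0_norm ?sqr_ge0.
rewrite -dE' e1.
set a := enorm _ in q0 *; have a2 := dE (s ^+ 2); rewrite -/a in a2.
rewrite dm.
case: m {dm D1 D3 D4} => [|m]; first by ring.
have -> : a ^- m.+1 = a ^+ 2 * a ^- m.+3 by rewrite !exprS; field; rewrite expf_eq0 (gt_eqF q0) andbF.
rewrite a2 mulr1 exprS/=.
by ring.
Qed.

Lemma is_derive_newton_integral (x : E) (a : R) m : d = m.+1 -> S x -> `|a| < 1 ->
  is_derive a (1 : R)
    (fun s : R => \int[sigma]_(u in S) (s ^+ m * enorm (x - s ^+ 2 *: u) ^- m * y u))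
    (m%:R * a ^+ m.-1 * (omega * ((a ^+ 2) ^+ l * y x))).
Proof.
move=> dm Sx a1; have d0 : (0 < d)%N by rewrite dm.
have [G yG] := spherical_harmonic_bounded.
have my := spherical_harmonic_measurable.
have mS := @measurable_sphere R d.+1 1.
have G0 : 0 <= G := le_trans (normr_ge0 _) (yG x Sx).
pose t := (1 + `|a|) / 2.
have t1 : t < 1 by rewrite /t; lra.
have ta : `|a| < t by rewrite /t; lra.
have t0 : 0 < t by exact: le_lt_trans ta.
have It (s : R) : s \in `](- t), t[ -> `|s| < t by rewrite in_itv/= -ltr_norml.
have t2 : t ^+ 2 < 1 by rewrite expr_lt1// ltW.
have s2t (s : R) : `|s| < t -> s ^+ 2 <= t ^+ 2.
  by move=> st; rewrite -real_normK ?num_real// lerXn2r ?nnegrE// ltW.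
have dist_gt (s : R) u : `|s| < t -> S u -> 1 - t ^+ 2 <= enorm (x - s ^+ 2 *: u).
  move=> /s2t st Su; have := enormB_ge x (s ^+ 2 *: u).
  rewrite (Sx : enorm x = 1) enormZ (Su : enorm u = 1) mulr1 ger0_norm ?sqr_ge0//; lra.
pose F (s : R) (u : E) := s ^+ m * enorm (x - s ^+ 2 *: u) ^- m * y u.
have DF (s : R) u : `|s| < t -> S u ->
    is_derive s (1 : R) (F ^~ u) (m%:R * s ^+ m.-1 * poisson (s ^+ 2 *: x) u * y u).
  move=> st Su; have q0 : 0 < enorm (x - s ^+ 2 *: u).
    by apply: lt_le_trans (dist_gt s u st Su); rewrite subr_gt0.
  have D := is_derive_newton_kernel dm Sx Su q0.
  have -> : F ^~ u = y u \*: (fun s : R => s ^+ m * enorm (x - s ^+ 2 *: u) ^- m).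
    by apply/funext => v; rewrite /F /= /GRing.scale/= mulrC.
  apply: is_derive_eq (is_deriveZ (y u) D) _.
  by rewrite /GRing.scale/= mulrC.
have mF (s : R) : measurable_fun S (F s).
  apply: measurable_funM => //; apply: measurable_funM => //; apply: measurable_funTS.
  exact: measurable_newton.
have iF (s : R) : s \in `](- t), t[ -> sigma.-integrable S (EFin \o F s).
  move=> /It st; apply: (@integrable_sphere _ _ sigma 1 _ ((1 - t ^+ 2) ^- m * G)) => // u Su.
  rewrite /F normrM ler_pM ?yG// normrM -[leRHS]mul1r ler_pM//.
    by rewrite normrX exprn_ile1// (le_trans (ltW st))// ltW.
  rewrite ger0_norm ?invr_ge0 ?exprn_ge0 ?enorm_ge0//.
  by rewrite ler_exprVn ?subr_gt0// dist_gt.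
pose K := m%:R * (2 * (1 - t ^+ 2) ^- d.+1) * G.
have tt : 0 < 1 - t ^+ 2 by rewrite subr_gt0.
have K0 : 0 <= K by rewrite /K !mulr_ge0// invr_ge0 exprn_ge0// ltW.
have d1E (s : R) u : `|s| < t -> S u ->
    derive1 (F ^~ u) s = m%:R * s ^+ m.-1 * poisson (s ^+ 2 *: x) u * y u.
  by move=> st Su; have [_ <-] := DF s u st Su; rewrite derive1E.
have dF_ub (s : R) u : s \in `](- t), t[ -> S u -> `|derive1 (F ^~ u) s| <= cst K u.
  move=> /It st Su; rewrite d1E// 3!normrM normr_nat ler_pM ?yG ?mulr_ge0//.
  rewrite -mulrA ler_wpM2l// -[leRHS]mul1r ler_pM//.
    by rewrite normrX exprn_ile1// (le_trans (ltW st))// ltW.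
  have zE : enorm (s ^+ 2 *: x) = s ^+ 2.
    by rewrite enormZ (Sx : enorm x = 1) mulr1 ger0_norm ?sqr_ge0.
  have s1 : s ^+ 2 < 1 by exact: le_lt_trans (s2t s st) t2.
  apply: (le_trans (poisson_bound Su _)); first by rewrite zE lt_eqF.
  rewrite zE ler_pM ?invr_ge0 ?exprn_ge0 ?addr_ge0 ?sqr_ge0//.
    have : (s ^+ 2) ^+ 2 <= 1 by rewrite exprn_ile1 ?sqr_ge0// ltW.
    lra.
  apply: ler_exprVn => //; rewrite ltr0_norm ?subr_lt0// opprB.
  by rewrite lerD2l lerN2 s2t.
have Ia : a \in `](- t), t[ by rewrite in_itv/= -ltr_norml.
have dF' (s : R) u : s \in `](- t), t[ -> S u -> derivable (F ^~ u) s 1.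
  by move=> /It st Su; have [] := DF s u st Su.
have iK : sigma.-integrable S (EFin \o cst K).
  by apply: (@integrable_sphere _ _ sigma 1 _ `|K|).
have h1 := @derivable_under_integral R _ E sigma F S mS a (- t) t Ia iF dF' (cst K) (fun=> K0) iK dF_ub.
have h2 := @differentiation_under_integral R _ E sigma F S mS a (- t) t Ia iF dF' (cst K) (fun=> K0) iK dF_ub.
split; first exact: h1.
rewrite -derive1E h2.
transitivity (\int[sigma]_(u in S) (m%:R * a ^+ m.-1 * (poisson (a ^+ 2 *: x) u * y u))).
  by apply: eq_Rintegral => u; rewrite inE => Su; rewrite /partial1of2 d1E// mulrA.
have a2 : a ^+ 2 < 1 by exact: le_lt_trans (s2t a ta) t2.
rewrite RintegralZl//; last first.
  apply: (integrable_poisson my yG).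
  by rewrite enormZ (Sx : enorm x = 1) mulr1 ger0_norm ?sqr_ge0// lt_eqF.
congr (_ * _); apply: poisson_integral_harmonic => //.
by rewrite sqr_ge0.
Qed.

Lemma integrable_newton_harmonic (rho : R) (x : E) m : 0 <= rho < 1 -> S x ->
  sigma.-integrable S (EFin \o (fun u => enorm (x - rho *: u) ^- m * y u)).
Proof.
move=> rho01 Sx; have [G yG] := spherical_harmonic_bounded.
apply: (@integrable_sphere _ _ sigma 1 _ ((1 - rho) ^- m * G)).
  apply: measurable_funM; last exact: spherical_harmonic_measurable.
  by apply: measurable_funTS; exact: measurable_newton.
by move=> u Su; rewrite normrM ler_pM ?yG ?newton_bound.
Qed.

(** Multiplied by [rho ^ ((d-1)/2)], the left side is a primitive in [s = sqrt rho] of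
    [(d-1) s ^ (d-2)] times the Poisson integral, which is known; both sides then vanish
    at [s = 0]. This is the Funk-Hecke formula for the Newton kernel. *)
Lemma newton_integral_harmonic (rho : R) (x : E) : (1 < d)%N -> 0 < rho < 1 -> S x ->
  \int[sigma]_(u in S) (enorm (x - rho *: u) ^- d.-1 * y u) =
    (d%:R - 1) * omega / (2 * l%:R + d%:R - 1) * (rho ^+ l * y x).
Proof.
move=> d1 /andP[rho0 rho1] Sx; pose m := d.-1.
have dm : d = m.+1 by rewrite prednK// ltnW.
have m0 : (0 < m)%N by rewrite -ltnS -dm.
rewrite -/m (_ : d%:R - 1 = m%:R :> R); last by rewrite dm -natr1 addrK.
rewrite (_ : 2 * l%:R + d%:R - 1 = (2 * l + m)%:R :> R); last first.
  by rewrite natrD natrM dm -natr1; ring.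
have lm0 : (2 * l + m)%:R != 0 :> R by rewrite pnatr_eq0 -lt0n addn_gt0 m0 orbT.
pose B (s : R) := \int[sigma]_(u in S) (s ^+ m * enorm (x - s ^+ 2 *: u) ^- m * y u).
pose c := m%:R * omega / (2 * l + m)%:R * y x.
pose s := Num.sqrt rho; have s0 : 0 < s by rewrite sqrtr_gt0.
have s2 : s ^+ 2 = rho by rewrite sqr_sqrtr// ltW.
have s1 : s < 1 by rewrite -(@expr_lt1 _ 2)// ?s2// ltW.
have DC (t : R) : t \in `[0, s] -> is_derive t (1 : R) (fun t => B t - c * t ^+ (2 * l + m)) 0.
  rewrite in_itv/= => /andP[t0 ts].
  have t1 : `|t| < 1 by rewrite ger0_norm// (le_lt_trans ts).
  have := is_deriveX (2 * l + m) (is_derive_id t (1 : R)); rewrite exprfctE => D2.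
  have D := is_deriveB (is_derive_newton_integral dm Sx t1) (is_deriveZ c D2).
  apply: is_derive_eq D _; rewrite /GRing.scale/= mulr1 -exprM.
  have -> : ((2 * l + m).-1 = 2 * l + m.-1)%N by rewrite -[in LHS](prednK m0) addnS.
  rewrite exprD /c; move: (2 * l + m)%:R lm0 => k k0.
  by field.
have B0 : B 0 - c * 0 ^+ (2 * l + m) = 0.
  rewrite /B [X in X - _](_ : _ = 0); last first.
    rewrite -[RHS](mul0r (fine (sigma S))) -Rintegral_cst; last exact: measurable_sphere.
    by apply: eq_Rintegral => u _; rewrite expr0n (gtn_eqF m0) !mul0r.
  by rewrite expr0n addn_eq0 (gtn_eqF m0) andbF mulr0 subr0.
have BsE : B s = \int[sigma]_(u in S) (s ^+ m * enorm (x - s ^+ 2 *: u) ^- m * y u) by [].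
clearbody B.
have [|u _] := @MVT R (fun t => B t - c * t ^+ (2 * l + m)) (fun=> 0) 0 s s0
  (fun t ts => DC t (subset_itv_oo_cc ts)).
  by apply: derivable_within_continuous => t /DC[].
rewrite B0 subr0 mul0r => /eqP; rewrite subr_eq0 => /eqP Bs.
have sm : s ^+ m != 0 by rewrite expf_eq0 (gt_eqF s0) andbF.
have iK : sigma.-integrable S (EFin \o (fun u => enorm (x - rho *: u) ^- m * y u)).
  by apply: integrable_newton_harmonic => //; rewrite ltW.
apply: (mulfI sm); rewrite -RintegralZl//; last exact: measurable_sphere.
transitivity (B s).
  by rewrite BsE; apply: eq_Rintegral => v _; rewrite s2 mulrA.
by rewrite Bs /c exprD exprM s2; move: (2 * l + m)%:R lm0 => k k0; field.
Qed.

End one_harmonic.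

End spherical_harmonics_kernels.

(** * Expansions in spherical harmonics *)

Section L2_expansions.
Context {R : realType} (d : nat).
Local Notation E := 'rV[R]_d.+1.
Local Notation S := (sphere 1 : set E).
Local Notation sigma := (@surface_measure R d.+1 1).
Local Notation omega := (@sphere_area R d).

Lemma sphere_Lnorm1 (r : R) (u : E -> R) :
  sphere_Lnorm r 1 u = (\int[surface_measure r]_(x in sphere r) `|u x|%:E)%E.
Proof.
rewrite /sphere_Lnorm Lnorm1 [RHS]integral_mkcond; apply: eq_integral => x _.
by rewrite /patch/=; case: ifP => _ //=; rewrite normr0.
Qed.

Lemma measurable_restrict_sphere (r : R) (u : E -> R) : measurable_fun (sphere r) u ->
  measurable_fun setT (u \_ (sphere r)).
Proof. by move=> mu; apply/(measurable_restrictT _ (@measurable_sphere R d.+1 r)). Qed.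

Let C : R := fine (sigma setT `^ 2^-1)%E.

(** The Hoelder inequality against the constant 1, the measure being finite. *)
Lemma sphere_L1_le_L2 (u : E -> R) (q : R) : measurable_fun S u ->
  (sphere_Lnorm 1 2%:E u <= q%:E)%E ->
  sigma.-integrable S (EFin \o u) /\ \int[sigma]_(x in S) `|u x| <= q * C.
Proof.
move=> mu uq; have mS := @measurable_sphere R d.+1 1.
have h : (\int[sigma]_(x in S) `|u x|%:E <= q%:E * (sigma setT `^ 2^-1))%E.
  rewrite -sphere_Lnorm1 /sphere_Lnorm.
  have := @hoelder _ _ R sigma (u \_ S) (cst 1) 2 2 (measurable_restrict_sphere mu)
    (measurable_cst _) (ltr0n _ _) (ltr0n _ _).
  rewrite (_ : 2^-1 + 2^-1 = 1 :> R); last by field.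
  move=> /(_ erefl); rewrite Lnorm_cst1 => h.
  rewrite (_ : (u \_ S \* cst 1)%R = u \_ S) in h; last first.
    by apply/funext => x; rewrite /= mulr1.
  by apply: (le_trans h); apply: lee_wpmul2r => //; exact: poweR_ge0.
have Cfin : (sigma setT `^ 2^-1)%E \is a fin_num.
  by rewrite fin_num_poweR// fin_num_measure.
rewrite -(fineK Cfin) -EFinM in h.
have iu : sigma.-integrable S (EFin \o u).
  apply/integrableP; split; first exact/measurable_EFinP.
  by apply: le_lt_trans h _; exact: ltry.
split => //; rewrite -lee_fin; apply: le_trans h.
rewrite /Rintegral fineK//; apply: integrable_fin_num => //.
by have := integrable_abse iu; rewrite /comp/=.
Qed.

Section one_expansion.
Variables (Y : @harmonic_family R d) (c : forall l, 'I_(harmonic_dim d l) -> R).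
Variables (g h : E -> R) (H : R).
Hypothesis hY : forall l k, spherical_harmonic l (@Y l k).
Hypothesis mg : measurable_fun S g.
Hypothesis mh : measurable_fun S h.
Hypothesis hH : forall x, S x -> `|h x| <= H.
Hypothesis cg : cvg_L2 Y c g.

Lemma measurable_partial_sum N : measurable_fun S (partial_sum Y c N).
Proof.
apply: measurable_sum => l; apply: measurable_sum => k; apply: measurable_funM => //.
exact: spherical_harmonic_measurable (hY k).
Qed.

Let integrable_hY l (k : 'I_(harmonic_dim d l)) :
  sigma.-integrable S (EFin \o (fun x => h x * Y k x)).
Proof.
have [G yG] := spherical_harmonic_bounded (hY k).
apply: (@integrable_sphere _ _ sigma 1 _ (H * G)).
  by apply: measurable_funM => //; exact: spherical_harmonic_measurable (hY k).
by move=> x Sx; rewrite normrM ler_pM ?hH ?yG.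
Qed.

Let hsumE N x : h x * partial_sum Y c N x =
  \sum_(l < N) \sum_(k < harmonic_dim d l) c k * (h x * Y k x).
Proof.
rewrite /partial_sum mulr_sumr; apply: eq_bigr => l _; rewrite mulr_sumr.
by apply: eq_bigr => k _; rewrite mulrCA.
Qed.

Let integrable_hsum N : sigma.-integrable S (EFin \o (fun x => h x * partial_sum Y c N x)).
Proof.
have mS := @measurable_sphere R d.+1 1.
under [X in EFin \o X]eq_fun do rewrite hsumE.
apply: integrable_sum_EFin => // l; apply: integrable_sum_EFin => // k.
exact: integrableZl_EFin.
Qed.

Lemma integral_partial_sum N :
  \int[sigma]_(x in S) (h x * partial_sum Y c N x) =
  \sum_(l < N) \sum_(k < harmonic_dim d l) c k * \int[sigma]_(x in S) (h x * Y k x).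
Proof.
have mS := @measurable_sphere R d.+1 1.
under eq_Rintegral do rewrite hsumE.
rewrite Rintegral_sum//; last first.
  by move=> l; apply: integrable_sum_EFin => // k; exact: integrableZl_EFin.
apply: eq_bigr => l _; rewrite Rintegral_sum//; last by move=> k; exact: integrableZl_EFin.
by apply: eq_bigr => k _; rewrite RintegralZl.
Qed.

Let close N q : (sphere_Lnorm 1 2%:E (fun x => partial_sum Y c N x - g x)%R <= q%:E)%E ->
  sigma.-integrable S (EFin \o (fun x => partial_sum Y c N x - g x)) /\
  \int[sigma]_(x in S) `|partial_sum Y c N x - g x| <= q * C.
Proof.
move=> hq; apply: sphere_L1_le_L2 => //.
by apply: measurable_funB => //; exact: measurable_partial_sum.
Qed.

Let small q : 0 < q -> \forall N \near \oo,
  (sphere_Lnorm 1 2%:E (fun x => partial_sum Y c N x - g x)%R <= q%:E)%E.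
Proof.
move=> q0; move: (cg) => /fine_cvgP[afin /cvgrPdist_le/(_ _ q0)]; apply: filterS2 afin => N.
move=> aN /=; rewrite sub0r normrN => /(le_trans (ler_norm _)).
by rewrite -lee_fin fineK.
Qed.

Lemma cvg_L2_integrable : sigma.-integrable S (EFin \o g).
Proof.
have mS := @measurable_sphere R d.+1 1.
have [N _ /(_ N (leqnn N))] := small ltr01; move=> /close[iN _].
have iP : sigma.-integrable S (EFin \o partial_sum Y c N).
  rewrite /partial_sum; apply: integrable_sum_EFin => // l.
  apply: integrable_sum_EFin => // k; apply: integrableZl_EFin => //.
  have [G yG] := spherical_harmonic_bounded (hY k).
  by apply: (@integrable_sphere _ _ sigma 1 _ G) => //; exact: spherical_harmonic_measurable (hY k).
have := integrableB_EFin mS iP iN; rewrite (_ : (fun x => _) = g)//.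
by apply/funext => x; rewrite opprB addrC subrK.
Qed.

(** Convergence in [L^2] implies convergence in [L^1], so expansions can be integrated
    term by term against a bounded function. *)
Lemma cvg_L2_integral :
  \int[sigma]_(x in S) (h x * partial_sum Y c N x) @[N --> \oo] -->
  \int[sigma]_(x in S) (h x * g x).
Proof.
have mS := @measurable_sphere R d.+1 1.
have C0 : 0 <= C by rewrite fine_ge0// poweR_ge0.
have H0 : 0 <= `|H| := normr_ge0 H.
apply/cvgrPdist_le => eps eps0; pose q := eps / (`|H| * C + 1).
have HC : 0 < `|H| * C + 1 by rewrite ltr_wpDl// mulr_ge0.
have q0 : 0 < q by rewrite divr_gt0.
apply: filterS (small q0) => N /close[iN iNq].
have ihN : sigma.-integrable S (EFin \o (fun x => h x * (partial_sum Y c N x - g x))).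
  have iHN := integrableZl_EFin mS `|H| iN.
  apply: (le_integrable mS _ _ iHN).
    apply/measurable_EFinP; apply: measurable_funM => //.
    by apply: measurable_funB => //; exact: measurable_partial_sum.
  move=> x Sx; rewrite /= lee_fin !normrM normr_id ler_wpM2r//.
  by rewrite (le_trans (hH Sx))// ler_norm.
have ihg : sigma.-integrable S (EFin \o (fun x => h x * g x)).
  have := integrableB_EFin mS (integrable_hsum N) ihN; rewrite (_ : (fun x => _ - _) = (fun x => h x * g x))//.
  by apply/funext => x; ring.
rewrite distrC -RintegralB//.
apply: (@le_trans _ _ (\int[sigma]_(x in S) (`|H| * `|partial_sum Y c N x - g x|))).
  apply: le_trans (le_normr_Rintegral _ _) _ => //.
    rewrite (_ : (fun x => _) = (fun x => h x * (partial_sum Y c N x - g x)))//.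
    by apply/funext => x; ring.
  have iA := integrable_abse iN; rewrite /comp/= in iA.
  apply: le_Rintegral => //.
  - have iB := integrable_abse ihN; rewrite /comp/= in iB.
    rewrite (_ : _ \o _ = (fun x => (`|h x * (partial_sum Y c N x - g x)|)%:E))//.
    by apply/funext => x /=; rewrite mulrBr.
  - by apply: integrableZl_EFin.
  move=> x Sx; rewrite -mulrBr normrM ler_wpM2r//.
  by rewrite (le_trans (hH Sx))// ler_norm.
rewrite RintegralZl//; last by have := integrable_abse iN; rewrite /comp/=.
apply: (le_trans (ler_wpM2l H0 iNq)).
rewrite /q [leLHS](_ : _ = eps * (`|H| * C) / (`|H| * C + 1)); last first.
  by field; rewrite gt_eqF.
rewrite ler_pdivrMr// ler_pM2l//; lra.
Qed.

End one_expansion.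

End L2_expansions.

(** * Representation by the Newton kernel *)

Section representation.
Context {R : realType} (d : nat).
Local Notation E := 'rV[R]_d.+1.
Local Notation S := (sphere 1 : set E).
Local Notation sigma := (@surface_measure R d.+1 1).
Local Notation omega := (@sphere_area R d).

Lemma sphere_L2_bounded (u : E -> R) (G : R) : (forall x, S x -> `|u x| <= G) ->
  measurable_fun S u -> (sphere_Lnorm 1 2%:E u < +oo)%E.
Proof.
move=> uG mu; have mS := @measurable_sphere R d.+1 1.
rewrite /sphere_Lnorm unlock; apply: poweR_lty.
apply: (@le_lt_trans _ _ (\int[sigma]_(x in setT) (`|G| `^ 2)%:E)%E); last first.
  by rewrite integral_cst// lte_mul_pinfty// ?ltey_eq ?fin_num_measure// lee_fin powR_ge0.
apply: ge0_le_integral => //.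
- by move=> x _; exact: poweR_ge0.
- apply/measurable_EFinP; apply: (measurableT_comp (measurable_powR _)).
  by apply: measurableT_comp => //; exact: measurable_restrict_sphere.
- move=> x _; rewrite lee_fin; apply: ge0_ler_powR => //; rewrite ?nnegrE//.
  rewrite /patch; case: ifPn => [|_]; last by rewrite normr0.
  by rewrite inE => Sx; rewrite (le_trans (uG x Sx))// ler_norm.
Qed.

(** The coefficient of degree [l] of the Newton kernel is that of the Poisson
    kernel divided by [(2l+d-1)/(d-1)], which is the multiplier of [D]: pairing
    [f] with the Poisson kernel is pairing [D f] with the Newton kernel. *)
Lemma newton_representation (r : R) (Y : @harmonic_family R d) (f Df : E -> R) (x : E) :
  (1 < d)%N -> 0 < r < 1 -> harmonic_onb Y -> class_F Y r f -> is_D Y r f Df -> S x ->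
  f x = r ^+ d.-1 *
    \int[sigma]_(u in S) (enorm (x - r *: u) ^- d.-1 * Df (r *: u)).
Proof.
move=> d1 /andP[r0 r1] [hY _ onbY] [hf cf f_inf _] [mDf cDf] Sx.
have d0 := ltnW d1; have mS := @measurable_sphere R d.+1 1.
have om0 := @sphere_area_gt0 R d.
pose v z := f (r *: z).
have cv : {within [set z | 1 <= enorm z], continuous v}.
  apply: (within_continuous_comp (g := fun z : E => r *: z) cf).
    exact: scaler_continuous.
  by move=> z /= z1; rewrite enormZ gtr0_norm// ler_pMr.
have hv z : 1 < enorm z -> dharmonic v z by exact: harmonic_on_dharmonic.
have v_inf eps : 0 < eps -> exists M : R, forall z, M < enorm z -> `|v z| < eps.
  move=> /f_inf[M HM]; exists (M / r) => z Mz; apply: HM.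
  by rewrite enormZ gtr0_norm// mulrC -ltr_pdivrMr.
have cS : {within S, continuous v}.
  by apply: continuous_subspaceW cv => z Sz /=; rewrite (Sz : enorm z = 1).
have [G vG] := sphere_continuous_bounded cS.
have mv := within_continuous_measurable mS cS.
have r01 : 0 <= r < 1 by rewrite ltW.
have zE : enorm (r *: x) = r by rewrite enormZ (Sx : enorm x = 1) mulr1 gtr0_norm.
have zn1 : enorm (r *: x) != 1 by rewrite zE lt_eqF.
have cv2 : cvg_L2 Y (@fourier_coef R d Y r f) v := onbY v mv (sphere_L2_bounded vG mv).
have mDfr : measurable_fun S (fun u => Df (r *: u)).
  apply: (measurable_comp (@measurable_sphere R d.+1 r) _ mDf).
    by move=> _ [u Su <-]; rewrite /sphere/= enormZ gtr0_norm// (Su : enorm u = 1) mulr1.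
  by apply: measurable_funTS; exact: measurable_scalerV.
pose h := poisson (r *: x); pose K u := enorm (x - r *: u) ^- d.-1.
have mh : measurable_fun S h by apply: measurable_funTS; exact: measurable_poisson.
have mK : measurable_fun S K by apply: measurable_funTS; exact: measurable_newton.
have hH u (Su : S u) := poisson_bound Su zn1.
have KH u (Su : S u) := newton_bound d.-1 r01 Sx Su.
have lim1 := cvg_L2_integral hY mv mh hH cv2.
have lim2 := cvg_L2_integral hY mDfr mK KH cDf.
have eq12 N : \int[sigma]_(u in S) (h u * partial_sum Y (@fourier_coef R d Y r f) N u) =
    omega * \int[sigma]_(u in S) (K u * partial_sum Y (@D_coef R d Y r f) N u).
  rewrite (integral_partial_sum _ hY mh hH) (integral_partial_sum _ hY mK KH).
  rewrite mulr_sumr; apply: eq_bigr => l _; rewrite mulr_sumr; apply: eq_bigr => k _.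
  have -> : \int[sigma]_(u in S) (h u * Y l k u) = omega * (r ^+ l * Y l k x).
    exact: (poisson_integral_harmonic (hY l k)).
  have -> : \int[sigma]_(u in S) (K u * Y l k u) =
      (d%:R - 1) * omega / (2 * l%:R + d%:R - 1) * (r ^+ l * Y l k x).
    by apply: (newton_integral_harmonic (hY l k)) => //; rewrite r0.
  have dd : 0 < d%:R - 1 :> R by rewrite subr_gt0 ltr1n.
  have dl : 0 < 2 * l%:R + d%:R - 1 :> R by rewrite -addrA ltr_wpDl// mulr_ge0.
  by rewrite /D_coef; field; rewrite ?(lt0r_neq0 dd) ?(lt0r_neq0 dl) ?(lt0r_neq0 om0).
have eqlim : poisson_integral v (r *: x) = omega * \int[sigma]_(u in S) (K u * Df (r *: u)).
  have lim3 : (fun N => omega * \int[sigma]_(u in S) (K u *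
      partial_sum Y (@D_coef R d Y r f) N u)) @ \oo --> omega * \int[sigma]_(u in S) (K u * Df (r *: u)).
    by apply: cvgMl_tmp; exact: lim2.
  rewrite -(funext eq12) in lim3.
  by rewrite -(cvg_lim (@Rhausdorff R) lim3); symmetry; apply: cvg_lim => //; exact: lim1.
have r'1 : 1 < r^-1 by rewrite invf_gt1.
have z1 : 1 < enorm (r^-1 *: x).
  by rewrite enormZ (Sx : enorm x = 1) mulr1 gtr0_norm ?invr_gt0.
have := poisson_formula_exterior d1 cv hv v_inf z1.
rewrite poisson_integral_inversion ?invr_gt0//; last first.
  by rewrite invrK; exact: (integrable_poisson mv vG zn1).
rewrite invrK eqlim /v scalerA divff ?scale1r ?gt_eqF// opprK => e.
apply: (mulfI (lt0r_neq0 om0)); rewrite e.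
rewrite exprVn invrK -{1}(prednK d0) exprSr mulfK ?gt_eqF//.
by rewrite mulrCA.
Qed.

End representation.

(** * Integrals against signed measures *)

Section charge_integral.
Context {R : realType} disp (T : measurableType disp) (D : set T).
Hypothesis mD : measurable D.

Lemma bounded_integrable (m : {measure set T -> \bar R}) (g : T -> R) (G : R) :
  (m D < +oo)%E -> measurable_fun D g -> (forall x, D x -> `|g x| <= G) ->
  m.-integrable D (EFin \o g).
Proof.
move=> mD_oo mg gG; apply: measurable_bounded_integrable => //.
exists G; split; first exact: num_real.
by move=> M GM x Dx /=; rewrite (le_trans (gG x Dx))// ltW.
Qed.

Lemma finite_measure_lty (m : {measure set T -> \bar R}) A :
  (m setT < +oo)%E -> measurable A -> (m A < +oo)%E.
Proof. by move=> mT mA; apply: le_lt_trans mT; rewrite le_measure ?inE. Qed.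

Lemma finite_measure_fin_num (m : {measure set T -> \bar R}) A :
  (m setT < +oo)%E -> measurable A -> m A \is a fin_num.
Proof. by move=> mT mA; rewrite ge0_fin_numE// finite_measure_lty. Qed.

(** A form of [measure_addE] for the measure structure instead of the set function. *)
Lemma measure_add_measureE (m1 m2 : {measure set T -> \bar R}) A :
  (measure_add m1 m2 : {measure set T -> \bar R}) A = (m1 A + m2 A)%E.
Proof. exact: measure_addE. Qed.

Lemma measure_add_lty (m1 m2 : {measure set T -> \bar R}) :
  (m1 setT < +oo)%E -> (m2 setT < +oo)%E ->
  ((measure_add m1 m2 : {measure set T -> \bar R}) setT < +oo)%E.
Proof. by move=> m1T m2T; rewrite measure_add_measureE lte_add_pinfty. Qed.

Lemma fin_num_sub_eq (a b c e : \bar R) : a \is a fin_num -> b \is a fin_num ->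
  c \is a fin_num -> e \is a fin_num -> (a - b = c - e)%E -> (c + b = a + e)%E.
Proof.
case: a b c e => [a| |] [b| |] [c| |] [e| |]// _ _ _ _.
by rewrite -!EFinN -!EFinD => /eqP; rewrite eqe => /eqP h; congr EFin; lra.
Qed.

Lemma Rintegral_measure_add (m1 m2 : {measure set T -> \bar R}) (g : T -> R) (G : R) :
  (m1 D < +oo)%E -> (m2 D < +oo)%E -> measurable_fun D g ->
  (forall x, D x -> `|g x| <= G) ->
  \int[measure_add m1 m2]_(x in D) g x =
    \int[m1]_(x in D) g x + \int[m2]_(x in D) g x.
Proof.
move=> m1D m2D mg gG.
have i1 := bounded_integrable m1D mg gG; have i2 := bounded_integrable m2D mg gG.
rewrite /Rintegral (integral_measure_add mD i1 i2).
by rewrite fineD// integrable_fin_num.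
Qed.

Lemma Rintegral_mscale (k : {nonneg R}) (m : {measure set T -> \bar R}) (g : T -> R) (G : R) :
  (m D < +oo)%E -> measurable_fun D g -> (forall x, D x -> `|g x| <= G) ->
  \int[mscale k m]_(x in D) g x = k%:num * \int[m]_(x in D) g x.
Proof.
move=> m1D mg gG; have i1 := bounded_integrable m1D mg gG.
have meg : measurable_fun D (EFin \o g) by exact/measurable_EFinP.
rewrite /Rintegral [in LHS]integralE [in RHS]integralE.
rewrite !ge0_integral_mscale//; [|exact: measurable_funeneg|exact: measurable_funepos].
have fp := integrable_pos_fin_num mD i1; have fn := integrable_neg_fin_num mD i1.
by rewrite -muleBr ?fin_num_adde_defr// fineM// fin_numB fp fn.
Qed.

(** If [nu = m1 - m2] then [m1 + nu^-] and [nu^+ + m2] are the same measure. *)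
Lemma charge_integralE (nu : {charge set T -> \bar R}) (m1 m2 : {measure set T -> \bar R})
    (g : T -> R) (G : R) :
  (m1 setT < +oo)%E -> (m2 setT < +oo)%E ->
  (forall A, measurable A -> nu A = m1 A - m2 A)%E ->
  measurable_fun D g -> (forall x, D x -> `|g x| <= G) ->
  charge_integral nu D g = \int[m1]_(x in D) g x - \int[m2]_(x in D) g x.
Proof.
move=> m1T m2T nuE mg gG.
rewrite /charge_integral; case: cid => P hP /=; case: cid => N nuPN /=.
set jp := jordan_pos _; set jn := jordan_neg _.
have jpT : (jp setT < +oo)%E by rewrite ltey_eq fin_num_measure.
have jnT : (jn setT < +oo)%E by rewrite ltey_eq fin_num_measure.
have e : \int[measure_add m1 jn]_(x in D) g x = \int[measure_add jp m2]_(x in D) g x.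
  congr fine; apply: eq_measure_integral => A mA _.
  transitivity (m1 A + jn A)%E; first exact: measure_addE.
  transitivity (jp A + m2 A)%E; last by symmetry; exact: measure_addE.
  have : (jp A - jn A = m1 A - m2 A)%E.
    by rewrite -nuE// (jordan_decomp nuPN mA) /cadd/= cscaleN1.
  by apply: fin_num_sub_eq; apply: finite_measure_fin_num.
have m1D := finite_measure_lty m1T mD; have m2D := finite_measure_lty m2T mD.
have jpD := finite_measure_lty jpT mD; have jnD := finite_measure_lty jnT mD.
move: e; rewrite (Rintegral_measure_add m1D jnD mg gG) (Rintegral_measure_add jpD m2D mg gG).
by move=> /eqP; rewrite -subr_eq addrAC => /eqP <-; rewrite addrK.
Qed.

(** The points of positive and of negative weight are collected in two measures. *)
Lemma discrete_chargeE n (a : 'I_n -> R) (t : 'I_n -> T) :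
  exists m1 m2 : {measure set T -> \bar R},
  [/\ (m1 setT < +oo)%E, (m2 setT < +oo)%E,
      forall A, measurable A -> discrete_charge a t A = (m1 A - m2 A)%E &
      forall (g : T -> R) (G : R), measurable_fun D g ->
        (forall x, D x -> `|g x| <= G) -> (forall k, D (t k)) ->
        \int[m1]_(x in D) g x - \int[m2]_(x in D) g x = \sum_(k < n) a k * g (t k)].
Proof.
rewrite /discrete_charge.
elim: (index_enum 'I_n) => [|k s [m1 [m2 [m1T m2T mE IH]]]].
  exists mzero, mzero; split.
  - by rewrite /= /mzero lt0y.
  - by rewrite /= /mzero lt0y.
  - by move=> A mA; rewrite big_nil /= /mzero sube0.
  - by move=> g G mg gG tD; rewrite big_nil subrr.
pose dk : {measure set T -> \bar R} := \d_(t k).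
have dkT : (dk setT < +oo)%E by rewrite /dk/= diracT ltry.
pose c : {nonneg R} := NngNum (normr_ge0 (a k)).
pose m : {measure set T -> \bar R} := mscale c dk.
have mT : (m setT < +oo)%E by rewrite /m /= /mscale/= diracT mule1 ltry.
have ig (g : T -> R) (G : R) : measurable_fun D g -> (forall x, D x -> `|g x| <= G) -> D (t k) ->
    \int[m]_(x in D) g x = `|a k| * g (t k).
  move=> mg gG tD; rewrite (Rintegral_mscale _ (finite_measure_lty dkT mD) mg gG); congr (_ * _).
  rewrite /Rintegral integral_dirac//; last exact/measurable_EFinP.
  by rewrite diracE mem_set// mul1e.
have mE' A : m A = (`|a k|%:E * \d_(t k) A)%E by [].
have mD_oo := finite_measure_lty mT mD.
case: (leP 0 (a k)) => ak.
- exists (measure_add m m1), m2; split=> //.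
  + exact: measure_add_lty.
  + move=> A mA; rewrite big_cons mE// (measure_add_measureE m m1 A) mE'.
    by rewrite ger0_norm// addeA.
  + move=> g G mg gG tD; rewrite big_cons -(IH g G)//.
    rewrite (Rintegral_measure_add mD_oo (finite_measure_lty m1T mD) mg gG).
    by rewrite (ig g G)// ger0_norm// addrA.
- exists m1, (measure_add m m2); split=> //.
  + exact: measure_add_lty.
  + move=> A mA; rewrite big_cons mE// (measure_add_measureE m m2 A) mE'.
    rewrite ltr0_norm// EFinN mulNe oppeD; last first.
      by rewrite fin_num_adde_defr// fin_numN fin_numM// fin_num_measure.
    by rewrite oppeK addeCA.
  + move=> g G mg gG tD; rewrite big_cons -(IH g G)//.
    rewrite (Rintegral_measure_add mD_oo (finite_measure_lty m2T mD) mg gG).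
    by rewrite (ig g G)// ltr0_norm// mulNr opprD opprK addrCA.
Qed.

Lemma charge_integral_discreteB (mu : {finite_measure set T -> \bar R}) n (a : 'I_n -> R)
    (t : 'I_n -> T) (g : T -> R) (G : R) :
  measurable_fun D g -> (forall x, D x -> `|g x| <= G) -> (forall k, D (t k)) ->
  charge_integral (cadd (charge_of_finite_measure mu) (copp (discrete_charge a t))) D g =
    \int[mu]_(x in D) g x - \sum_(k < n) a k * g (t k).
Proof.
move=> mg gG tD; have [m1 [m2 [m1T m2T mE IH]]] := discrete_chargeE a t.
have muT : (mu setT < +oo)%E by rewrite ltey_eq fin_num_measure.
have amT := measure_add_lty muT m2T.
rewrite (charge_integralE amT m1T _ mg gG); last first.
  move=> A mA; rewrite (measure_add_measureE mu m2 A).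
  transitivity (mu A - discrete_charge a t A)%E; first by [].
  rewrite mE// fin_num_oppeB ?finite_measure_fin_num// addeA addeAC.
  by [].
rewrite (Rintegral_measure_add (finite_measure_lty muT mD) (finite_measure_lty m2T mD) mg gG).
by rewrite -(IH g G)// opprB addrA.
Qed.

End charge_integral.

(** * The Hoelder inequality for all pairs of conjugate exponents *)

Section hoelder.
Context {R : realType} disp (T : measurableType disp).
Variable m : {measure set T -> \bar R}.
Local Open Scope ereal_scope.

(** The product is almost everywhere below the essential supremum of the first
    factor times the second factor. *)
Lemma hoelder_infty (f g : T -> R) : measurable_fun setT f -> measurable_fun setT g ->
  'N[m]_1[EFin \o (f \* g)%R] <= 'N[m]_+oo[EFin \o f] * 'N[m]_1[EFin \o g].
Proof.
move=> mf mg; rewrite !Lnorm1.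
have [m0|] := ltP 0 (m setT); last first.
  move=> mT; have m0 : m setT = 0 by apply/eqP; rewrite eq_le mT measure_ge0.
  rewrite (null_set_integral _ _ m0)//; last first.
    by apply: measurableT_comp => //; apply: measurableT_comp => //; exact: measurable_funM.
  by rewrite mule_ge0 ?Lnorm_ge0 ?integral_ge0.
have fE : 'N[m]_+oo[EFin \o f] = ess_sup m (abse \o (EFin \o f)) by rewrite unlock m0.
rewrite fE; set M := ess_sup m _.
have M0 : 0 <= M by rewrite /M -fE Lnorm_ge0.
rewrite -ge0_integralZl//; [|by do 2 apply: measurableT_comp => //].
apply: ae_ge0_le_integral => //.
- by do 2 apply: measurableT_comp => //; exact: measurable_funM.
- by move=> x _; rewrite mule_ge0.
- by apply: emeasurable_funM => //; do 2 apply: measurableT_comp => //.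
- apply: filterS (ess_sup_ge m (abse \o (EFin \o f))) => x fx _.
  have -> : (EFin \o (f \* g)%R) x = (f x)%:E * (g x)%:E by [].
  by rewrite abseM lee_pmul.
Qed.

Lemma hoelder_conjugate_exponents (f g : T -> R) (p q : \bar R) :
  measurable_fun setT f -> measurable_fun setT g ->
  1 <= p -> 1 <= q -> p^-1 + q^-1 = 1 ->
  'N[m]_1[EFin \o (f \* g)%R] <= 'N[m]_p[EFin \o f] * 'N[m]_q[EFin \o g].
Proof.
move=> mf mg.
have comm h k : 'N[m]_1[EFin \o (h \* k)%R] = 'N[m]_1[EFin \o (k \* h)%R].
  by congr (Lnorm _ _ _); apply/funext => x /=; rewrite mulrC.
have eq1 (x : R) : (1 <= x)%R -> (x%:E)^-1 = 1 -> x = 1%R.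
  move=> x1; rewrite inver gt_eqF ?(lt_le_trans ltr01)// => -[] /(congr1 GRing.inv).
  by rewrite invrK invr1.
case: p => [p| |]//; case: q => [q| |]//.
- rewrite !lee_fin => p1 q1 pq.
  have p0 : (0 < p)%R by rewrite (lt_le_trans ltr01).
  have q0 : (0 < q)%R by rewrite (lt_le_trans ltr01).
  apply: hoelder => //.
  by move: pq; rewrite !inver !gt_eqF// => -[].
- rewrite lee_fin => p1 _; rewrite invey adde0 => /(eq1 _ p1) ->.
  by rewrite comm muleC hoelder_infty.
- rewrite lee_fin => _ q1; rewrite invey add0e => /(eq1 _ q1) ->.
  exact: hoelder_infty.
- by move=> _ _; rewrite invey adde0 => /eqP; rewrite eq_sym onee_eq0.
Qed.

End hoelder.

(** * Exchanging the order of integration *)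

Section fubini.
Context {R : realType} d1 d2 (T1 : measurableType d1) (T2 : measurableType d2).
Variables (m1 : {finite_measure set T1 -> \bar R}) (m2 : {finite_measure set T2 -> \bar R}).
Variables (D1 : set T1) (D2 : set T2) (K : T1 * T2 -> R) (g : T2 -> R) (C : R).
Hypothesis mD1 : measurable D1.
Hypothesis mD2 : measurable D2.
Hypothesis mK : measurable_fun setT K.
Hypothesis KC : forall x y, D1 x -> D2 y -> `|K (x, y)| <= C.
Hypothesis ig : m2.-integrable D2 (EFin \o g).

Let mg : measurable_fun D2 g.
Proof. by apply/measurable_EFinP; exact: measurable_int ig. Qed.

Lemma integrable_kernel x : D1 x -> m2.-integrable D2 (fun y => (K (x, y) * g y)%:E).
Proof.
move=> D1x; apply: le_integrable (integrableZl_EFin mD2 C ig) => //.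
  apply/measurable_EFinP; apply: measurable_funM => //.
  by apply: measurable_funTS; apply: measurableT_comp => //; exact: measurable_pair1.
move=> y D2y /=; rewrite lee_fin !normrM ler_wpM2r//.
by rewrite (le_trans (KC D1x D2y))// ler_norm.
Qed.

(** The integrand extended by 0, for which the two inner integrals are finite
    everywhere. *)
Let F (z : T1 * T2) : \bar R := (\1_D1 z.1 * K z * (g \_ D2) z.2)%:E.

Let mF : measurable_fun setT F.
Proof.
apply/measurable_EFinP; apply: measurable_funM; first apply: measurable_funM => //.
  by apply: measurableT_comp => //; exact: measurable_indic.
by apply: measurableT_comp => //; exact/(measurable_restrictT _ mD2).
Qed.

Let iF : (m1 \x m2)%E.-integrable setT F.
Proof.
apply: (integrable12ltyP m1 m2 mF).2.
have ig' : (\int[m2]_y `|(g \_ D2) y|%:E < +oo)%E.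
  move/integrableP: ig => [_]; rewrite integral_mkcond; congr (_ < _)%E.
  apply: eq_integral => y _; rewrite /patch/=; case: ifP => //= _; by rewrite normr0.
have mg' : measurable_fun setT (fun y => `|(g \_ D2) y|%:E).
  by apply/measurable_EFinP; apply: measurableT_comp => //; exact/(measurable_restrictT _ mD2).
apply: (@le_lt_trans _ _ (\int[m1]_x (`|C|%:E * \int[m2]_y `|(g \_ D2) y|%:E))%E).
  apply: ge0_le_integral => //.
  - by move=> x _; exact: integral_ge0.
  - apply: (@measurable_fun_fubini_tonelli_F _ _ _ _ _ m2 (fun z => `|F z|%E)) => //.
    exact: measurableT_comp.
  - move=> x _; rewrite -ge0_integralZl//; apply: ge0_le_integral => //.
    + by apply: measurableT_comp => //; apply: measurableT_comp => //; exact: measurable_pair1.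
    + by apply: emeasurable_funM.
    + move=> y _; rewrite /F /= -EFinM lee_fin !normrM.
      rewrite /patch indicE; case: ifPn => [|_]; last by rewrite normr0 !mulr0.
      rewrite inE => D2y; case: (boolP (x \in D1)); last by rewrite normr0 !mul0r mulr_ge0.
      rewrite inE => D1x; rewrite normr1 mul1r ler_wpM2r//.
      by rewrite (le_trans (KC D1x D2y))// ler_norm.
rewrite integral_cst// lte_mul_pinfty//.
- by rewrite mule_ge0// integral_ge0.
- by rewrite fin_numM// ge0_fin_numE// integral_ge0.
- by rewrite ltey_eq fin_num_measure.
Qed.

Let fine_inner2 x : (fun x => \int[m2]_(y in D2) (K (x, y) * g y)) \_ D1 x =
  fine (\int[m2]_y F (x, y)).
Proof.
rewrite /F/= /patch indicE; case: ifPn => [|xD1].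
  rewrite inE => D1x; congr fine; rewrite [LHS]integral_mkcond; apply: eq_integral => y _.
  by rewrite /patch mul1r; case: ifP; rewrite ?mulr0.
by rewrite (eq_integral (fun=> 0%E)) ?integral0// => y _; rewrite !mul0r.
Qed.

Let fine_inner1 y : (fun y => g y * \int[m1]_(x in D1) K (x, y)) \_ D2 y =
  fine (\int[m1]_x F (x, y)).
Proof.
rewrite /F/= /patch; case: ifPn => [|yD2]; last first.
  by rewrite (eq_integral (fun=> 0%E)) ?integral0// => x _; rewrite mulr0.
rewrite inE => D2y; rewrite -RintegralZl//; last first.
  apply: (@bounded_integrable _ _ _ _ _ m1 _ C) => //; first by rewrite ltey_eq fin_num_measure.
    by apply: measurable_funTS; apply: measurableT_comp => //; exact: measurable_pair2.
  by move=> x D1x; exact: KC.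
congr fine; rewrite [LHS]integral_mkcond; apply: eq_integral => x _.
by rewrite /patch indicE; case: ifP; rewrite ?mul0r// mul1r mulrC.
Qed.

Let inner2E x : (\int[m2]_y F (x, y) =
  ((fun x => \int[m2]_(y in D2) (K (x, y) * g y)) \_ D1 x)%:E)%E.
Proof.
rewrite fine_inner2 fineK// /F; case: (boolP (x \in D1)) => [|xD1].
  rewrite inE => D1x; have := integrable_fin_num mD2 (integrable_kernel D1x).
  rewrite integral_mkcond; congr (_ \is a fin_num); apply: eq_integral => y _.
  by rewrite /patch/= indicE (mem_set D1x) mul1r; case: ifP; rewrite ?mulr0.
rewrite (eq_integral (fun=> 0%E)) ?integral0// => y _/=.
by rewrite indicE (negPf xD1) !mul0r.
Qed.

Let inner1E y : (\int[m1]_x F (x, y) =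
  ((fun y => g y * \int[m1]_(x in D1) K (x, y)) \_ D2 y)%:E)%E.
Proof.
rewrite fine_inner1 fineK// /F.
have := @integrable_fin_num _ _ _ m1 _ mD1 (fun x => (K (x, y) * (g \_ D2) y)%:E).
rewrite integral_mkcond (_ : (_ \_ D1) = (fun x => (\1_D1 x * K (x, y) * (g \_ D2) y)%:E)).
  apply; rewrite /patch; case: ifPn => [|_]; last first.
    by under eq_fun do rewrite mulr0; exact: integrable0.
  rewrite inE => D2y; under eq_fun do rewrite mulrC; apply: integrableZl_EFin => //.
  apply: (@bounded_integrable _ _ _ _ _ m1 _ C) => //; first by rewrite ltey_eq fin_num_measure.
      by apply: measurable_funTS; apply: measurableT_comp => //; exact: measurable_pair2.
  by move=> x D1x; exact: KC.
by apply/funext => x; rewrite /patch indicE; case: ifP; rewrite ?mul0r// mul1r.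
Qed.

Lemma integrable_kernel_integral :
  m2.-integrable D2 (fun y => (g y * \int[m1]_(x in D1) K (x, y))%:E).
Proof.
apply/(integrable_mkcond _ mD2); rewrite (_ : _ \_ _ = fubini_G m1 F); last first.
  apply/funext => y; rewrite /fubini_G inner1E /patch.
  by case: ifP.
apply/integrableP; split; first exact: measurable_fubini_G iF.
apply: le_lt_trans ((integrable21ltyP m1 m2 mF).1 iF); apply: ge0_le_integral => //.
- by apply: measurableT_comp => //; exact: measurable_fubini_G iF.
- apply: (@measurable_fun_fubini_tonelli_G _ _ _ _ _ m1 (fun z => `|F z|%E)) => //.
  exact: measurableT_comp.
- move=> y _; apply: le_abse_integral => //.
  by apply: measurableT_comp => //; exact: measurable_pair2.
Qed.

Lemma fubini_kernel :
  \int[m1]_(x in D1) \int[m2]_(y in D2) (K (x, y) * g y) =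
  \int[m2]_(y in D2) (g y * \int[m1]_(x in D1) K (x, y)).
Proof.
rewrite /Rintegral [in LHS]integral_mkcond [in RHS]integral_mkcond.
transitivity (fine (\int[m1]_x \int[m2]_y F (x, y))%E).
  congr fine; apply: eq_integral => x _; rewrite inner2E /patch.
  by case: ifP.
rewrite (Fubini iF); congr fine; apply: eq_integral => y _; rewrite inner1E /patch.
by case: ifP.
Qed.

End fubini.

(** * The quadrature error *)

Section quadrature.
Context {R : realType} (d : nat).
Local Notation E := 'rV[R]_d.+1.
Local Notation S := (sphere 1 : set E).
Local Notation sigma := (@surface_measure R d.+1 1).

Lemma measurable_dist_pair m :
  measurable_fun setT (fun z : E * E => enorm (z.1 - z.2) ^- m).
Proof.
apply: (measurableT_comp (@measurable_enormVn R d.+1 m)).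
apply: measurable_fun_rV => i; under eq_fun do rewrite mxE mxE.
apply: measurable_funB.
- exact: (measurableT_comp (measurable_coord i) measurable_fst).
- exact: (measurableT_comp (measurable_coord i) measurable_snd).
Qed.

Variables (r : R) (mu : {finite_measure set E -> \bar R}).
Variables (n : nat) (a : 'I_n -> R) (t : 'I_n -> E).
Hypothesis r01 : 0 < r < 1.
Hypothesis St : forall k, S (t k).

Let r0 : 0 < r. Proof. by case/andP: r01. Qed.
Let r1 : r < 1. Proof. by case/andP: r01. Qed.
Let mS := @measurable_sphere R d.+1 1.

Local Notation U := (newton_potential
  (cadd (charge_of_finite_measure mu) (copp (discrete_charge a t)))).

(** On the sphere of radius [r < 1] the kernel is bounded in [y], so the Jordan
    decomposition can be forgotten. *)
Lemma newton_potentialE (x : E) : sphere r x ->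
  U x = \int[mu]_(y in S) (enorm (x - y) ^- d.-1) -
        \sum_(k < n) a k * enorm (x - t k) ^- d.-1.
Proof.
move=> rx; apply: (@charge_integral_discreteB _ _ _ _ mS _ _ _ _ _ ((1 - r) ^- d.-1)) => //.
  by apply: measurable_funTS; exact: measurable_dist_Vn.
move=> y Sy; rewrite enormBC.
have -> : x = r *: (r^-1 *: x) by rewrite scalerA divff ?scale1r ?gt_eqF.
apply: newton_bound => //; first by rewrite ltW.
by rewrite /sphere/= enormZ (rx : enorm x = r) gtr0_norm ?invr_gt0// mulVf ?gt_eqF.
Qed.

Lemma measurable_newton_potential : measurable_fun (sphere r) U.
Proof.
have mr := @measurable_sphere R d.+1 r.
apply: (eq_measurable_fun (fun x : E => \int[mu]_(y in S) (enorm (x - y) ^- d.-1) -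
    \sum_(k < n) a k * enorm (x - t k) ^- d.-1)).
  by move=> x; rewrite inE => rx; rewrite newton_potentialE.
apply: measurable_funB; last first.
  apply: measurable_sum => k; apply: measurable_funM => //; apply: measurable_funTS.
  by under eq_fun do rewrite enormBC; exact: measurable_dist_Vn.
apply: measurable_funTS; apply: (measurableT_comp (f := fine)) => //.
under eq_fun do rewrite integral_mkcond.
pose F (z : E * E) : \bar R := ((\1_S z.2 * enorm (z.1 - z.2) ^- d.-1)%R)%:E.
rewrite (_ : (fun x => _) = fubini_F mu F).
  apply: (@measurable_fun_fubini_tonelli_F _ _ _ _ _ mu F) => //.
    apply/measurable_EFinP; apply: measurable_funM; last exact: measurable_dist_pair.
    by apply: measurableT_comp => //; exact: measurable_indic.
  by move=> z; rewrite lee_fin mulr_ge0// invr_ge0 exprn_ge0// enorm_ge0.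
apply/funext => x; apply: eq_integral => y _; rewrite /F /patch/= indicE.
by case: ifP; rewrite ?mul1r ?mul0r.
Qed.

(** Integrating the representation of [f] over [mu - nu] and exchanging the
    integrals makes the potential of [mu - nu] appear. *)
Lemma quadrature_errorE (Y : @harmonic_family R d) (f Df : E -> R) :
  (1 < d)%N -> harmonic_onb Y -> class_F Y r f -> is_D Y r f Df ->
  \int[mu]_(x in S) f x - \sum_(k < n) a k * f (t k) =
  \int[sigma]_(u in S) (r ^+ d.-1 * (Df (r *: u) * U (r *: u))).
Proof.
move=> d1 onbY Ff DfE; have [hY _ _] := onbY; have [mDf cDf] := DfE.
pose K (z : E * E) := enorm (z.1 - r *: z.2) ^- d.-1.
pose g u := r ^+ d.-1 * Df (r *: u).
have mDfr : measurable_fun S (fun u => Df (r *: u)).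
  apply: (measurable_comp (@measurable_sphere R d.+1 r) _ mDf).
    by move=> _ [u Su <-]; rewrite /sphere/= enormZ gtr0_norm// (Su : enorm u = 1) mulr1.
  by apply: measurable_funTS; exact: measurable_scalerV.
have iDf := cvg_L2_integrable hY mDfr cDf.
have ig : sigma.-integrable S (EFin \o g) by exact: integrableZl_EFin.
have mK : measurable_fun setT K.
  apply: (measurableT_comp (f := fun z : E * E => enorm (z.1 - z.2) ^- d.-1)
    (g := fun z : E * E => (z.1, r *: z.2)) (measurable_dist_pair d.-1)).
  apply: measurable_fun_pair => //.
  exact: (measurableT_comp (@measurable_scalerV R d.+1 r) measurable_snd).
have r01' : 0 <= r < 1 by rewrite ltW.
have KC x u : S x -> S u -> `|K (x, u)| <= (1 - r) ^- d.-1.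
  by move=> Sx Su; exact: newton_bound.
have fE x : S x -> f x = \int[sigma]_(u in S) (K (x, u) * g u).
  move=> Sx; rewrite (newton_representation d1 r01 onbY Ff DfE Sx).
  rewrite -RintegralZl//; last first.
    exact: (integrable_kernel mS mK KC iDf Sx).
  by apply: eq_Rintegral => u _; rewrite /K /g/= mulrCA.
have -> : \int[mu]_(x in S) f x = \int[mu]_(x in S) \int[sigma]_(u in S) (K (x, u) * g u).
  by apply: eq_Rintegral => x; rewrite inE => /fE.
rewrite (fubini_kernel mu mS mS mK KC ig).
have iK x : S x -> sigma.-integrable S (EFin \o (fun u => K (x, u) * g u)).
  by move=> Sx; exact: (integrable_kernel mS mK KC ig Sx).
have -> : \sum_(k < n) a k * f (t k) = \int[sigma]_(u in S) (\sum_(k < n) a k * (K (t k, u) * g u)).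
  rewrite Rintegral_sum//; last by move=> k; apply: integrableZl_EFin => //; exact: iK.
  by apply: eq_bigr => k _; rewrite RintegralZl ?fE//; exact: iK.
rewrite -RintegralB//; last 2 first.
- have := integrable_kernel_integral mu mS mS mK KC ig; exact.
- by apply: integrable_sum_EFin => // k; apply: integrableZl_EFin => //; exact: iK.
apply: eq_Rintegral => u; rewrite inE => Su.
have ru : sphere r (r *: u) by rewrite /sphere/= enormZ (Su : enorm u = 1) mulr1 gtr0_norm.
rewrite (newton_potentialE ru).
have e1 : \int[mu]_(x in S) K (x, u) = \int[mu]_(y in S) (enorm (r *: u - y) ^- d.-1).
  by apply: eq_Rintegral => y _; rewrite /K /= enormBC.
have perm (x y z : R) : x * (y * z) = z * (x * y) by ring.
have e2 : \sum_(k < n) a k * (K (t k, u) * g u) =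
    g u * \sum_(k < n) a k * enorm (r *: u - t k) ^- d.-1.
  rewrite mulr_sumr; apply: eq_bigr => k _; rewrite /K /= enormBC.
  exact: perm.
have distr (x y z w : R) : x * y * z - x * y * w = x * (y * (z - w)) by ring.
by rewrite e1 e2; exact: distr.
Qed.

Lemma sphere_hoelder (u v : E -> R) (p q : \bar R) :
  measurable_fun (sphere r) u -> measurable_fun (sphere r) v ->
  (1 <= p)%E -> (1 <= q)%E -> (p^-1 + q^-1 = 1)%E ->
  (sphere_Lnorm r 1 (u \* v)%R <= sphere_Lnorm r p u * sphere_Lnorm r q v)%E.
Proof.
move=> mu' mv p1 q1 pq; rewrite /sphere_Lnorm.
rewrite (_ : (u \* v) \_ _ = (u \_ (sphere r)) \* (v \_ (sphere r))).
  by apply: hoelder_conjugate_exponents => //; exact: measurable_restrict_sphere.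
by apply/funext => x; rewrite /patch/=; case: ifP => //; rewrite mulr0.
Qed.

(** Passing from the unit sphere to that of radius [r] multiplies the surface measure
    by [r ^ d]. *)
Lemma abs_sphere_integral_le (w : E -> R) : (0 < d)%N -> measurable_fun (sphere r) w ->
  (`|\int[sigma]_(u in S) (r ^+ d.-1 * w (r *: u))|%:E <= (r^-1)%:E * sphere_Lnorm r 1 w)%E.
Proof.
move=> d0 mw.
have mwr : measurable_fun S (fun u => w (r *: u)).
  apply: (measurable_comp (@measurable_sphere R d.+1 r) _ mw).
    by move=> _ [u Su <-]; rewrite /sphere/= enormZ gtr0_norm// (Su : enorm u = 1) mulr1.
  by apply: measurable_funTS; exact: measurable_scalerV.
have fine_le (x : \bar R) : (`|fine x|%:E <= `|x|)%E by case: x => [x| |]//=; rewrite normr0 leey.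
apply: le_trans (fine_le _) _.
apply: le_trans (le_abse_integral _ _ _) _ => //.
  by apply/measurable_EFinP; apply: measurable_funM.
rewrite sphere_Lnorm1 ge0_integral_sphere_scale//; last first.
  by apply/measurable_EFinP; exact: measurableT_comp.
have rd : r^-1 * r ^+ d = r ^+ d.-1 by rewrite -[in LHS](prednK d0) exprS mulKf ?gt_eqF.
rewrite muleA -EFinM rd.
rewrite -ge0_integralZl//; last 2 first.
- by apply/measurable_EFinP; exact: measurableT_comp.
- by rewrite lee_fin exprn_ge0// ltW.
apply: ge0_le_integral => //.
- by apply/measurable_EFinP; apply: measurableT_comp => //; exact: measurable_funM.
- by apply/measurable_EFinP; apply: measurable_funM => //; exact: measurableT_comp.
- by move=> u _ /=; rewrite lee_fin normrM ger0_norm// exprn_ge0// ltW.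
Qed.

End quadrature.

Theorem corollary3 (R : realType) (d : nat) (r0 r : R)
    (Y : @harmonic_family R d) (f Df : 'rV[R]_d.+1 -> R)
    (n : nat) (t : 'I_n -> 'rV[R]_d.+1) (a : 'I_n -> R)
    (mu : {finite_measure set 'rV[R]_d.+1 -> \bar R}) (p p' : \bar R) :
  (2 <= d)%N -> 0 < r0 -> r0 < r -> r < 1 ->
  harmonic_onb Y ->
  class_F Y r f -> is_D Y r f Df ->
  (forall eta : 'rV[R]_d.+1, sphere 1 eta ->
    partial_sum Y (fourier_coef Y r f) N eta @[N --> \oo] --> f (r *: eta)) ->
  (1 <= n)%N -> injective t -> (forall k, sphere 1 (t k)) ->
  measure_support mu `<=` sphere 1 ->
  (1 <= p)%E -> (1 <= p')%E -> (p^-1 + p'^-1 = 1)%E ->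
  ((`| \int[mu]_(x in sphere 1) f x - \sum_(k < n) a k * f (t k) |)%:E <=
    (r0^-1)%:E * sphere_Lnorm r p Df *
    sphere_Lnorm r p' (newton_potential
      (cadd (charge_of_finite_measure mu) (copp (discrete_charge a t)))))%E.
Proof.
move=> d1 r0_gt0 r0r r1 onbY Ff DfE _ _ _ St _ p1 p'1 pp'.
have rgt0 : 0 < r by exact: lt_trans r0r.
have r01 : 0 < r < 1 by rewrite rgt0.
have mU := @measurable_newton_potential R d r mu n a t r01 St.
have mDf : measurable_fun (sphere r) Df := DfE.1.
rewrite (quadrature_errorE mu a r01 St d1 onbY Ff DfE).
apply: le_trans (abs_sphere_integral_le r01 (ltnW d1) (measurable_funM mDf mU)) _.
rewrite -muleA; apply: lee_pmul.
- by rewrite lee_fin invr_ge0 ltW.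
- exact: Lnorm_ge0.
- by rewrite lee_fin lef_pV2 ?posrE// ltW.
- exact: sphere_hoelder.
Qed.
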